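(* Consider the single-server retrial queue with event-dependent arrivals described in the context, in its stationary regime under the stability condition given there. Then the stationary distribution of $(C,X,I)$ has the following (partial) generating functions: $$P_{0}^{*}(0,z)=\frac{p_{0,0}\,z(1-\alpha^{*}(\lambda^{-}))(A_{e}(z)-1)}{\alpha^{*}(\lambda^{-})(zA_{e}(z)-A_{r}(z))+z(1-A_{e}(z))},$$ $$P_{1,2}^{*}(0,z)=\lambda^{-}\frac{1-\beta^{*}(\lambda^{e})}{\lambda^{e}}\,(p_{0,0}+P_{0}^{*}(0,z)),\qquad P_{1,3}^{*}(0,z)=\frac{1-\beta^{*}(\lambda^{r})}{\lambda^{r}}K(z),$$ $$P_{1,4}^{*}(0,z)+P_{1,5}^{*}(0,z)=\frac{\lambda^{-}z\left[1-\beta^{*}(\lambda^{e})-\frac{\lambda^{e}(1-\beta^{*}(\lambda_{+}^{e}(1-z)))}{\lambda_{+}^{e}(1-z)}\right]}{\lambda_{+}^{e}(1-z)-\lambda^{e}}\,(p_{0,0}+P_{0}^{*}(0,z)),$$ $$P_{1,6}^{*}(0,z)+P_{1,7}^{*}(0,z)=\frac{z\left[1-\beta^{*}(\lambda^{r})-\frac{\lambda^{r}(1-\beta^{*}(\lambda_{+}^{r}(1-z)))}{\lambda_{+}^{r}(1-z)}\right]}{\lambda_{+}^{r}(1-z)-\lambda^{r}}\,K(z),$$ where $$K(z)=\frac{\lambda^{-}\alpha^{*}(\lambda^{-})\,[p_{0,0}(A_{e}(z)-1)+A_{e}(z)P_{0}^{*}(0,z)]}{z-\alpha^{*}(\lambda^{-})A_{r}(z)},$$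 $$p_{0,0}=\frac{\alpha^{*}(\lambda^{-})(\lambda^{e}t_{r}+\lambda^{r}t_{e})-\lambda^{r}t_{e}}{\alpha^{*}(\lambda^{-})\,[(1+\lambda^{-}\bar b)\lambda^{e}t_{r}+\lambda^{-}\bar b\,\lambda^{r}t_{e}]},$$ $$t_{e}=(\lambda^{e}-\lambda_{+}^{e})(1-\beta^{*}(\lambda^{e}))+\lambda^{e}\lambda_{+}^{e}\bar b,\qquad t_{r}=(\lambda^{r}-\lambda_{+}^{r})\beta^{*}(\lambda^{r})+\lambda_{+}^{r}(1-\lambda^{r}\bar b).$$
   Context: Model. A single server with no waiting room and an infinite-capacity orbit. Service times are i.i.d. with density $b(\cdot)$, Laplace-Stieltjes transform (LST) $\beta^{*}(s)=\int_0^\infty e^{-st}b(t)\,dt$ and finite mean $\bar b$. A customer arriving at a busy server joins the orbit. After each service completion the customer leaves and, if the orbit is nonempty, the server starts seeking a customer from the orbit; seeking times are i.i.d. with density $a(\cdot)$ and LST $\alpha^{*}(s)=\int_0^\infty e^{-st}a(t)\,dt$. If an external (primary) customer arrives during seeking, the seeking is cancelled and the arriving customer is served; otherwise at the end of the seeking time one orbiting (retrial) customer leaves the orbit and starts service. If the orbit is empty, the server waits for an external arrival. Interarrival, service and seeking times are mutually independent. Event-dependent arrival rates (all positive): while the server is idle, external customers arrive at rate $\lambda^{-}$. During a service of an external customer (type $e$) the first arrival occurs at rate $\lambda^{e}$ and all subsequent arrivals during that service at rate $\lambda_{+}^{e}$. During a service of a retrial customer (type $r$) the first arrival occurs at rate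 $\lambda^{r}$ and all subsequent arrivals during that service at rate $\lambda_{+}^{r}$. State. $X(t)$ is the number of orbiting customers; $C(t)=1$ if the server is busy and $0$ if idle; $I(t)$ is the last realized event: $E_1$ = service completion (server idle); $E_2$ = an external arrival occupied the server (no arrival since); $E_3$ = a retrial customer occupied the server (no arrival since); $E_4$ = exactly one arrival has occurred during the current service of an external customer; $E_5$ = at least two arrivals have occurred during the current service of an external customer; $E_6$, $E_7$ = same as $E_4$, $E_5$ respectively, but for the current service of a retrial customer. $(C,X,I)$ denotes the stationary version. Stationary quantities: $p_{0,0}=P(C=0,X=0,I=E_1)$, and for $|z|\le1$ $$P_0^*(0,z)=\sum_{j\ge1}P(C=0,X=j,I=E_1)z^j,\qquad P_{1,k}^*(0,z)=\sum_{j\ge j_k}P(C=1,X=j,I=E_k)z^j,$$ where $j_k=0$ for $k=2,3$; $j_k=1$ for $k=4,6$; $j_k=2$ for $k=5,7$. For $k\in\{e,r\}$, $A_k(z)$ is the probability generating function of the number of arrivals during a service of a type-$k$ customer, i.e. $$A_k(z)=\frac{\beta^{*}(\lambda^{k})(\lambda_{+}^{k}-\lambda^{k})(1-z)-\lambda^{k}z\beta^{*}(\lambda_{+}^{k}(1-z))}{\lambda_{+}^{k}(1-z)-\lambda^{k}}.$$ Stability condition: $$\bar b<\frac{\alpha^{*}(\lambda^{-})[\lambda_{+}^{r}+(\lambda^{r}-\lambda_{+}^{r})\beta^{*}(\lambda^{r})]}{\lambda^{r}[\lambda_{+}^{e}+(\lambda_{+}^{r}-\lambda_{+}^{e})\alpha^{*}(\lambda^{-})]}-\frac{(1-\alpha^{*}(\lambda^{-}))(\lambda^{e}-\lambda_{+}^{e})(1-\beta^{*}(\lambda^{e}))}{\lambda^{e}[\lambda_{+}^{e}+(\lambda_{+}^{r}-\lambda_{+}^{e})\alpha^{*}(\lambda^{-})]}.$$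 Ratios at points where a denominator vanishes (e.g. $z=1$) are understood as limits. *)

(* Defs.v *)
From HB Require Import structures.
From mathcomp Require Import all_boot all_order all_algebra.
From mathcomp Require Import complex.
From mathcomp Require Import all_classical all_reals all_analysis.
Set Implicit Arguments.
Unset Strict Implicit.
Unset Printing Implicit Defensive.
Import Order.TTheory GRing.Theory Num.Theory numFieldNormedType.Exports.
Local Open Scope classical_set_scope.
Local Open Scope ring_scope.
Local Open Scope complex_scope.

(* The topology of a numFieldType is not found on the bare type R[i]; this
   alias makes it available. *)
Definition C (R : realType) : numFieldType := R[i].

Definition RtoC (R : realType) (x : R) : C R := x%:C.

Definition cexp (R : realType) (s : C R) : C R :=
  (expR (complex.Re s) * cos (complex.Im s))
  +i* (expR (complex.Re s) * sin (complex.Im s)).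

Section Transforms.
Context {R : realType}.
Implicit Types (f : R -> R) (s z : C R).

Local Notation mu := (@lebesgue_measure R).

Definition is_pdf f : Prop :=
  [/\ measurable_fun (`[0, +oo[ : set R) f,
      (forall t, 0 <= t -> 0 <= f t)
    & (\int[mu]_(t in `[0%R, +oo[) (f t)%:E = 1)%E].

Definition finite_mean f : Prop :=
  mu.-integrable `[0, +oo[ (fun t => (t * f t)%:E).

Definition mean f : R := \int[mu]_(t in `[0, +oo[) (t * f t).

Definition lst f (s : R) : R :=
  \int[mu]_(t in `[0, +oo[) (expR (- s * t) * f t).

Definition clst f s : C R :=
  (\int[mu]_(t in `[0, +oo[) (complex.Re (cexp (- s * RtoC t)) * f t))
  +i* (\int[mu]_(t in `[0, +oo[) (complex.Im (cexp (- s * RtoC t)) * f t)).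

(* num z / den z, understood at a zero z of den as the limit of num w / den w
   for w tending to z in the closed unit disc. *)
Definition lim_ratio (num den : C R -> C R) z : C R :=
  if den z == 0 then
    lim (num w / den w @[w --> within [set w | `|w| <= 1 /\ den w != 0]
                                      (nbhs z)])
  else num z / den z.

(* The power series over j >= m. *)
Definition genfun (m : nat) (p : nat -> R) z : C R :=
  limn (fun n => \sum_(m <= j < n) RtoC (p j) * z ^+ j).

(* Generating function of the number of arrivals during a service with density
   b, the first arrival having rate l and the next ones rate lp. *)
Definition arrivals_pgf (b : R -> R) (l lp : R) : C R -> C R :=
  lim_ratio
    (fun z => RtoC (lst b l) * RtoC (lp - l) * (1 - z)
              - RtoC l * z * clst b (RtoC lp * (1 - z)))
    (fun z => RtoC lp * (1 - z) - RtoC l).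

End Transforms.

(* Last realized event. *)
Inductive event :=
  | E1    (* service completion; the server is idle *)
  | E2    (* an external customer occupied the server, no arrival since *)
  | E3    (* a retrial customer occupied the server, no arrival since *)
  | E4    (* one arrival during the current service of an external customer *)
  | E5    (* at least two arrivals during such a service *)
  | E6    (* one arrival during the current service of a retrial customer *)
  | E7.   (* at least two arrivals during such a service *)

Record rates (R : realType) := Rates {
  rate_idle : R;    (* server idle *)
  rate_e : R;       (* first arrival in the service of an external customer *)
  rate_eplus : R;   (* next arrivals in such a service *)
  rate_r : R;       (* first arrival in the service of a retrial customer *)
  rate_rplus : R }. (* next arrivals in such a service *)

(* res is the residual service time if the server is busy and the residual
   seeking time if it is seeking; it is 0 if the server is idle and the orbit
   is empty. *)
Record state (R : realType) := State { ev : event; orb : nat; res : R }.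

Section Dynamics.
Context {R : realType}.
Variable r : rates R.
Implicit Types (s : state R) (x t : R).

Definition busy s : nat := if ev s is E1 then 0%N else 1%N.

Definition empty_idle s : bool :=
  match ev s, orb s with E1, 0%N => true | _, _ => false end.

Definition orb_min (k : event) : nat :=
  match k with E1 | E2 | E3 => 0%N | E4 | E6 => 1%N | E5 | E7 => 2%N end.

Definition valid_state s : Prop :=
  [/\ (orb_min (ev s) <= orb s)%N, 0 <= res s & empty_idle s -> res s = 0].

Definition arrival_rate (k : event) : R :=
  match k with
  | E1 => rate_idle r
  | E2 => rate_e r
  | E3 => rate_r r
  | E4 | E5 => rate_eplus r
  | E6 | E7 => rate_rplus r
  end.

(* The process jumps at each event. A jump chain step out of s uses a standard
   exponential variable x, so that x / arrival_rate (ev s) is the time to the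
   next arrival; the clock is drawn anew after every jump, which by lack of
   memory is the same as interrupting the arrival process at each change of
   rate. *)
Definition clock s x : R := x / arrival_rate (ev s).

Definition arrival_first s x : bool := empty_idle s || (clock s x < res s).

Definition duration s x : R :=
  if arrival_first s x then clock s x else res s.

(* b is the duration of a service that starts at the jump, a that of a seeking
   phase that starts at the jump. *)
Definition next_state s (x b a : R) : state R :=
  if arrival_first s x then
    match ev s with
    | E1 => State E2 (orb s) b
    | E2 => State E4 (orb s).+1 (res s - clock s x)
    | E3 => State E6 (orb s).+1 (res s - clock s x)
    | E4 | E5 => State E5 (orb s).+1 (res s - clock s x)
    | E6 | E7 => State E7 (orb s).+1 (res s - clock s x)
    end
  else
    match ev s with
    | E1 => State E3 (orb s).-1 b
    | _ => State E1 (orb s) (if orb s is 0%N then 0 else a)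
    end.

Definition elapse t s : state R :=
  if empty_idle s then s else State (ev s) (orb s) (res s - t).

Section Path.
Context {Omega : Type}.
Variables (S0 : Omega -> state R) (xi B A : nat -> Omega -> R).

Fixpoint jump_state (n : nat) (w : Omega) : state R :=
  if n is m.+1 then next_state (jump_state m w) (xi m w) (B m w) (A m w)
  else S0 w.

Fixpoint jump_time (n : nat) (w : Omega) : R :=
  if n is m.+1 then jump_time m w + duration (jump_state m w) (xi m w)
  else 0.

(* The event that the state at time t belongs to Q. *)
Definition state_in (t : R) (Q : set (state R)) : set Omega :=
  [set w | exists n : nat,
    jump_time n w <= t < jump_time n.+1 w
    /\ Q (elapse (t - jump_time n w) (jump_state n w))].

End Path.
End Dynamics.

(* As event and nat are countable, the laws on state R are determined by these
   sets with V Borel. *)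
Definition cyl (R : realType) (k : event) (j : nat) (V : set R)
  : set (state R) := [set s | [/\ ev s = k, orb s = j & V (res s)]].

Section Stochastic.
Context {R : realType} {d : measure_display} {Omega : measurableType d}.
Variable P : probability Omega R.

Definition has_pdf (X : {RV P >-> R}) (f : R -> R) : Prop :=
  forall V : set R, measurable V ->
    P (X @^-1` V)
    = (\int[@lebesgue_measure R]_(t in V `&` `[0%R, +oo[) (f t)%:E)%E.

Definition has_std_exponential_law (X : {RV P >-> R}) : Prop :=
  forall V : set R, measurable V -> P (X @^-1` V) = exponential_prob (1 : R) V.

Definition state_measurable (S0 : Omega -> state R) : Prop :=
  forall k j (V : set R), measurable V -> measurable (S0 @^-1` cyl k j V).

(* Mutual independence of S0 and of all the xi n, B n, A n. *)
Definition mutually_independent (S0 : Omega -> state R)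
    (xi B A : nat -> {RV P >-> R}) : Prop :=
  forall (N : nat) (k : event) (j : nat) (V : set R) (Vx Vb Va : nat -> set R),
    measurable V ->
    (forall n, [/\ measurable (Vx n), measurable (Vb n) & measurable (Va n)]) ->
    P (S0 @^-1` cyl k j V `&`
       \bigcap_(n in `I_N) (xi n @^-1` Vx n `&` B n @^-1` Vb n
                            `&` A n @^-1` Va n))
    = (P (S0 @^-1` cyl k j V) *
       \prod_(n < N) (P (xi n @^-1` Vx n) * P (B n @^-1` Vb n)
                      * P (A n @^-1` Va n)))%E.

(* The law of the state at time t does not depend on t. Together with the
   residual time, (C, X, I) is a Markov process, so this is stationarity. *)
Definition stationary (r : rates R) (S0 : Omega -> state R)
    (xi B A : nat -> {RV P >-> R}) : Prop :=
  forall t : R, 0 <= t ->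
  forall k j (V : set R), measurable V ->
    P (state_in r S0 xi B A t (cyl k j V)) = P (S0 @^-1` cyl k j V).

(* P(C = c, X = j, I = k) *)
Definition joint_prob (S0 : Omega -> state R) (c : nat) (k : event) (j : nat)
  : R :=
  fine (P [set w | [/\ busy (S0 w) = c, orb (S0 w) = j & ev (S0 w) = k]]).

End Stochastic.

(* Main.v *)
(* Together with the residual service or seeking time, the queue is a Markov
   process. Letting h tend to 0 in E F(S_h) = E F(S_0), where only the first two
   jumps matter at first order, shows that its generator has mean 0 against
   every smooth bounded test function F that is preserved on average when a
   phase ends. Test functions z^j v(x), z^j u(x) of the orbit size j and the
   residual time x, with v before and u after the first arrival of a service,
   turn this into linear equations between the generating functions as soon as
   u and v solve linear differential equations with constant right-hand side:
   exponentials in x yield P0, and four inhomogeneous solutions yield P12, P13,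
   P14 + P15 and P16 + P17. They degenerate at finitely many z, which are
   recovered by continuity on the closed disc.
   With al = lst a lm, the denominator of P0 is w - G(w) for
   G(w) = (1 - al) w Ae(w) + al Ar(w). Stability says that G has a Lipschitz
   constant less than 1 on the disc, so that w = 1 is the only zero. Dividing
   the equation for P0 by 1 - z and normalising at z = 1 gives p00. *)

Require Import Defs.
From HB Require Import structures.
From mathcomp Require Import all_boot all_order all_algebra.
From mathcomp Require Import complex.
From mathcomp Require Import all_classical all_reals all_analysis.
From mathcomp Require Import measurable_realfun.
From mathcomp Require Import ring lra.
Set Implicit Arguments.
Unset Strict Implicit.
Unset Printing Implicit Defensive.
Import Order.TTheory GRing.Theory Num.Theory numFieldNormedType.Exports.
Local Open Scope classical_set_scope.
Local Open Scope ring_scope.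

(** * Expectations *)

(** The error in [E F(S_h)] must be o(h), but nothing is assumed on the stationary law of the
    residual time, which could a priori charge the neighbourhood of 0 too heavily, nor on the
    densities near 0. Stationarity itself closes the first gap: the end of a phase restores, with
    probability bounded below, a fixed amount of residual time, while the flow consumes at most [h],
    so a phase ends before [h] with probability O(h). Of a fresh phase one only knows that it is
    shorter than [h] with probability tending to 0; this suffices, since it always multiplies an
    O(h). Stationarity also rules out explosion, as the law at time [t] would otherwise lose mass.
    The Lipschitz constant of the generating function of arrivals must be sharp, because stability
    leaves no room for a loss. Given a service of length [t], a mean value inequality bounds the
    increment by the mean number of arrivals during [t]; averaging yields the slope at 1. *)

Section WeightedTransfer.
Context {R : realType}.
Import HBNNSimple.

Lemma integral_nnsfun_weighted d (T : measurableType d)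
    (mu : {measure set T -> \bar R}) (D : set T) (Y : T -> R) (w : T -> R)
    (g : {nnsfun R >-> R}) :
  measurable D -> measurable_fun setT Y -> measurable_fun D w ->
  (forall x, D x -> 0 <= w x) ->
  (\int[mu]_(x in D) (g (Y x) * w x)%:E =
   \sum_(k \in range g)
     k%:E * \int[mu]_(x in D `&` Y @^-1` (g @^-1` [set k])) (w x)%:E)%E.
Proof.
move=> mD mY mw w0.
have mgY k : measurable (Y @^-1` (g @^-1` [set k])).
  by rewrite -(setTI (_ @^-1` _)); exact: mY.
transitivity (\sum_(k \in range g)
  \int[mu]_(x in D) (k * (\1_(Y @^-1` (g @^-1` [set k])) x * w x))%:E)%E.
  rewrite -ge0_integral_fsum//.
  - apply: eq_integral => x _; rewrite fsumEFin// fimfunE; congr EFin.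
    by rewrite mulr_fsuml; apply: eq_fsbigr => k _; rewrite mulrA.
  - move=> k; apply/measurable_EFinP; apply: measurable_funM => //.
    by apply: measurable_funM => //; exact: measurable_funTS.
  - move=> k x Dx; rewrite lee_fin mulrA mulr_ge0 ?w0//.
    have := nnfun_muleindic_ge0 g k (Y x); rewrite -EFinM lee_fin.
    by rewrite !indicE; congr (0 <= k * _); rewrite !inE/=.
apply: eq_fsbigr => k; rewrite inE => -[y _ <-].
under eq_integral do rewrite EFinM.
rewrite ge0_integralZl_EFin//; last 2 first.
- by move=> x Dx; rewrite lee_fin mulr_ge0// w0.
- apply/measurable_EFinP; apply: measurable_funM => //.
congr (_ * _)%E.
rewrite [RHS]integral_mkcondr; apply: eq_integral => x _.
by rewrite patchE indicE; case: ifPn => _; rewrite ?mul1r ?mul0r.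
Qed.

(** Weights let one statement serve both an event under [P], with an indicator as weight, and a
    density under Lebesgue measure. Simple functions approximate a nonnegative [psi]; the signed
    case asks for no integrability, because both integrals are differences of the same two parts. *)
Lemma weighted_transfer d1 (T1 : measurableType d1)
    (m1 : {measure set T1 -> \bar R}) (D1 : set T1) (Y1 w1 : T1 -> R)
    d2 (T2 : measurableType d2)
    (m2 : {measure set T2 -> \bar R}) (D2 : set T2) (Y2 w2 : T2 -> R)
    (psi : R -> R) :
  measurable D1 -> measurable_fun setT Y1 -> measurable_fun D1 w1 ->
  (forall x, D1 x -> 0 <= w1 x) ->
  measurable D2 -> measurable_fun setT Y2 -> measurable_fun D2 w2 ->
  (forall x, D2 x -> 0 <= w2 x) ->
  (forall V, measurable V ->
    \int[m1]_(x in D1 `&` Y1 @^-1` V) (w1 x)%:E =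
    \int[m2]_(x in D2 `&` Y2 @^-1` V) (w2 x)%:E)%E ->
  measurable_fun setT psi ->
  (\int[m1]_(x in D1) (psi (Y1 x) * w1 x)%:E =
   \int[m2]_(x in D2) (psi (Y2 x) * w2 x)%:E)%E.
Proof.
move=> mD1 mY1 mw1 w10 mD2 mY2 mw2 w20 Hm.
have nonneg (phi : R -> R) : measurable_fun setT phi ->
    (forall y, 0 <= phi y) ->
  (\int[m1]_(x in D1) (phi (Y1 x) * w1 x)%:E =
   \int[m2]_(x in D2) (phi (Y2 x) * w2 x)%:E)%E.
  move=> mphi phi0.
  have mephi : measurable_fun setT (EFin \o phi) by exact/measurable_EFinP.
  pose g_ := nnsfun_approx measurableT mephi.
  have gcvg y : (g_ n y)%:E @[n --> \oo] --> (phi y)%:E.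
    by apply: (cvg_nnsfun_approx measurableT mephi) => // z _; rewrite lee_fin.
  have gen d (T : measurableType d) (m : {measure set T -> \bar R}) D
      (Y w : T -> R) : measurable D -> measurable_fun setT Y ->
      measurable_fun D w -> (forall x, D x -> 0 <= w x) ->
      (\int[m]_(x in D) (phi (Y x) * w x)%:E =
       limn (fun n => \int[m]_(x in D) (g_ n (Y x) * w x)%:E))%E.
    move=> mD mY mw w0.
    rewrite -monotone_convergence//; last 3 first.
    - move=> n; apply/measurable_EFinP/measurable_funM => //.
      by apply: measurable_funTS; apply: measurableT_comp.
    - by move=> n x Dx; rewrite lee_fin mulr_ge0// w0.
    - move=> x Dx m' n mn; rewrite lee_fin ler_wpM2r ?w0//.
      exact/lefP/nd_nnsfun_approx.
    apply: eq_integral => x /set_mem Dx; apply/esym/cvg_lim => //.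
    under eq_fun do rewrite EFinM.
    rewrite EFinM; apply: cvgeZr => //; exact: gcvg.
  rewrite gen// [RHS]gen//.
  have -> : (fun n => \int[m1]_(x in D1) (g_ n (Y1 x) * w1 x)%:E)%E =
            (fun n => \int[m2]_(x in D2) (g_ n (Y2 x) * w2 x)%:E)%E; last by [].
  apply/funext => n.
  rewrite !integral_nnsfun_weighted//; apply: eq_fsbigr => k _.
  by rewrite Hm.
move=> mpsi.
rewrite integralE [RHS]integralE.
congr (_ - _)%E.
- transitivity (\int[m1]_(x in D1) (psi^\+ (Y1 x) * w1 x)%:E)%E.
    apply: eq_integral => x /set_mem Dx; rewrite funeposE /funrpos.
    by rewrite -EFin_max maxr_pMl ?w10// mul0r.
  rewrite nonneg//; last exact: measurable_funrpos.
  apply: eq_integral => x /set_mem Dx; rewrite funeposE /funrpos.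
  by rewrite -EFin_max maxr_pMl ?w20// mul0r.
- transitivity (\int[m1]_(x in D1) (psi^\- (Y1 x) * w1 x)%:E)%E.
    apply: eq_integral => x /set_mem Dx; rewrite funenegE /funrneg.
    by rewrite -EFinN -EFin_max maxr_pMl ?w10// mul0r mulNr.
  rewrite nonneg//; last exact: measurable_funrneg.
  apply: eq_integral => x /set_mem Dx; rewrite funenegE /funrneg.
  by rewrite -EFinN -EFin_max maxr_pMl ?w20// mul0r mulNr.
Qed.

End WeightedTransfer.

Section Expectation.
Context {R : realType} {d : measure_display} {T : measurableType d}.
Variable P : probability T R.
Implicit Types (f g : T -> R) (A D : set T).

(** Boundedness is imposed throughout, so that integrability under a probability is automatic. *)
Definition bmeas f := measurable_fun setT f /\ exists M, forall x, `|f x| <= M.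

Definition Ex f : R := \int[P]_x f x.

Lemma bmeas_cst c : bmeas (fun=> c).
Proof. by split; [exact: measurable_cst | exists `|c|]. Qed.

Lemma bmeasD f g : bmeas f -> bmeas g -> bmeas (fun x => f x + g x).
Proof.
move=> [mf [M fM]] [mg [N gN]]; split; first exact: measurable_funD.
exists (M + N) => x; exact: le_trans (ler_normD _ _) (lerD (fM x) (gN x)).
Qed.

Lemma bmeasM f g : bmeas f -> bmeas g -> bmeas (fun x => f x * g x).
Proof.
move=> [mf [M fM]] [mg [N gN]]; split; first exact: measurable_funM.
by exists (M * N) => x; rewrite normrM ler_pM.
Qed.

Lemma bmeasZ c f : bmeas f -> bmeas (fun x => c * f x).
Proof. by apply: bmeasM; exact: bmeas_cst. Qed.

Lemma bmeasN f : bmeas f -> bmeas (fun x => - f x).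
Proof.
move=> bf; have -> : (fun x => - f x) = (fun x => -1 * f x).
  by apply/funext => x; rewrite mulN1r.
exact: bmeasZ.
Qed.

Lemma bmeasB f g : bmeas f -> bmeas g -> bmeas (fun x => f x - g x).
Proof. by move=> bf /bmeasN; exact: bmeasD. Qed.

Lemma bmeas_indic A : measurable A -> bmeas (\1_A).
Proof.
move=> mA; split; first exact: measurable_indic.
by exists 1 => x; rewrite indicE ger0_norm// lern1 leq_b1.
Qed.

Lemma bmeas_norm f : bmeas f -> bmeas (fun x => `|f x|).
Proof.
move=> [mf [M fM]]; split; first exact: measurableT_comp.
by exists M => x; rewrite normr_id.
Qed.

Lemma bmeas_sum (I : Type) (s : seq I) (f : I -> T -> R) :
  (forall i, bmeas (f i)) -> bmeas (fun x => \sum_(i <- s) f i x).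
Proof.
move=> bf; elim: s => [|i s IH].
  by under eq_fun do rewrite big_nil; exact: bmeas_cst.
by under eq_fun do rewrite big_cons; exact: bmeasD.
Qed.

Lemma bmeas_integrable f : bmeas f -> P.-integrable setT (EFin \o f).
Proof.
move=> [mf [M fM]]; apply: measurable_bounded_integrable => //.
  by apply: (@le_lt_trans _ _ 1%E); [exact: probability_le1|exact: ltry].
by rewrite /bounded_near; near=> N => x _ /=; rewrite (le_trans (fM x)).
Unshelve. all: by end_near. Qed.

Lemma ExD f g : bmeas f -> bmeas g -> Ex (fun x => f x + g x) = Ex f + Ex g.
Proof. by move=> bf bg; rewrite /Ex RintegralD//; exact: bmeas_integrable. Qed.

Lemma ExZ c f : bmeas f -> Ex (fun x => c * f x) = c * Ex f.
Proof. by move=> bf; rewrite /Ex RintegralZl//; exact: bmeas_integrable. Qed.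

Lemma ExB f g : bmeas f -> bmeas g -> Ex (fun x => f x - g x) = Ex f - Ex g.
Proof. by move=> bf bg; rewrite /Ex RintegralB//; exact: bmeas_integrable. Qed.

Lemma Ex_le f g : bmeas f -> bmeas g -> (forall x, f x <= g x) -> Ex f <= Ex g.
Proof. by move=> bf bg fg; apply: le_Rintegral => //; exact: bmeas_integrable. Qed.

Lemma Ex_cst c : Ex (fun=> c) = c.
Proof. by rewrite /Ex Rintegral_cst// [X in _ * fine X]probability_setT mulr1. Qed.

Lemma Ex_ge0 f : (forall x, 0 <= f x) -> 0 <= Ex f.
Proof. by move=> f0; apply: Rintegral_ge0. Qed.

Lemma Ex_sum (I : Type) (s : seq I) (f : I -> T -> R) :
  (forall i, bmeas (f i)) ->
  Ex (fun x => \sum_(i <- s) f i x) = \sum_(i <- s) Ex (f i).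
Proof.
move=> bf; elim: s => [|i s IH].
  by under [in LHS]eq_fun do rewrite big_nil; rewrite big_nil Ex_cst.
under [in LHS]eq_fun do rewrite big_cons.
by rewrite big_cons ExD ?IH//; exact: bmeas_sum.
Qed.

Lemma Ex_norm_le f g : bmeas f -> bmeas g -> (forall x, `|f x| <= g x) ->
  `|Ex f| <= Ex g.
Proof.
move=> bf bg fg; apply: le_trans (le_normr_Rintegral _ (bmeas_integrable bf)) _ => //.
by apply: Ex_le => //; exact: bmeas_norm.
Qed.

Lemma Ex_indic A : measurable A -> Ex \1_A = fine (P A).
Proof. by move=> mA; rewrite /Ex /Rintegral integral_indic// setIT. Qed.

Lemma Ex_transfer D D' (Y Y' : T -> R) c (psi : R -> R) :
  measurable D -> measurable D' ->
  measurable_fun setT Y -> measurable_fun setT Y' -> 0 <= c ->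
  (forall V, measurable V ->
    P (D `&` Y @^-1` V) = (c%:E * P (D' `&` Y' @^-1` V))%E) ->
  measurable_fun setT psi -> (exists M, forall x, `|psi x| <= M) ->
  Ex (fun x => \1_D x * psi (Y x)) = c * Ex (fun x => \1_D' x * psi (Y' x)).
Proof.
move=> mD mD' mY mY' c0 H mpsi [M psiM].
have b1 : bmeas (fun x => \1_D' x * psi (Y' x)).
  apply: bmeasM; first exact: bmeas_indic.
  by split; [exact: measurableT_comp|exists M].
rewrite -ExZ// /Ex /Rintegral; congr fine.
transitivity (\int[P]_(x in setT) (psi (Y x) * \1_D x)%:E)%E.
  by apply: eq_integral => x _; rewrite mulrC.
rewrite (@weighted_transfer R _ T P setT Y (\1_D) _ T P setT Y'
  (fun x => c * \1_D' x) psi) //.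
- by apply: eq_integral => x _; rewrite mulrC mulrA.
- by apply: measurable_funM.
- by move=> x _; rewrite mulr_ge0// indicE.
- move=> V mV.
  have mYV : measurable (setT `&` Y @^-1` V) by exact: mY.
  have mYV' : measurable (setT `&` Y' @^-1` V) by exact: mY'.
  rewrite integral_indic//.
  under eq_integral do rewrite EFinM.
  rewrite ge0_integralZl_EFin//; last first.
    by apply/measurable_EFinP; exact: measurable_funTS.
  by rewrite integral_indic// !setTI; exact: H.
Qed.

Lemma Ex_density D (Y : T -> R) c (f : R -> R) (psi : R -> R) :
  measurable D -> measurable_fun setT Y -> 0 <= c ->
  measurable_fun (`[0, +oo[ : set R) f -> (forall t, 0 <= t -> 0 <= f t) ->
  (forall V, measurable V ->
    P (D `&` Y @^-1` V) =
    (c%:E * \int[@lebesgue_measure R]_(t in V `&` `[0%R, +oo[) (f t)%:E)%E) ->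
  measurable_fun setT psi ->
  Ex (fun x => \1_D x * psi (Y x)) =
  \int[@lebesgue_measure R]_(t in `[0, +oo[) (c * (psi t * f t)).
Proof.
move=> mD mY c0 mf f0 H mpsi.
rewrite /Ex /Rintegral; congr fine.
transitivity (\int[P]_(x in setT) (psi (Y x) * \1_D x)%:E)%E.
  by apply: eq_integral => x _; rewrite mulrC.
rewrite (@weighted_transfer R _ T P setT Y (\1_D) _ (measurableTypeR R) (@lebesgue_measure R)
  `[0%R, +oo[%classic idfun (fun t => c * f t) psi) //.
- by apply: eq_integral => x _ /=; rewrite mulrCA.
- exact: measurable_id.
- by apply: measurable_funM => //; exact: measurable_cst.
- by move=> x /=; rewrite in_itv/= andbT => x0; rewrite mulr_ge0// f0.
- move=> V mV.
  have mYV : measurable (setT `&` Y @^-1` V) by exact: mY.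
  rewrite integral_indic// setTI; apply: (eq_trans (H V mV)).
  under [RHS]eq_integral do rewrite EFinM.
  have mVI : measurable (`[0%R, +oo[%classic `&` idfun @^-1` V : set R).
    by apply: measurableI.
  rewrite ge0_integralZl_EFin//.
  + by rewrite setIC.
  + by move=> x [/=]; rewrite in_itv/= andbT => x0 _; rewrite lee_fin f0.
  + apply/measurable_EFinP; apply: measurable_funS mf => //.
Qed.

Lemma Ex_partition (A : nat -> set T) f :
  (forall n, measurable (A n)) -> trivIset setT A -> \bigcup_n A n = setT ->
  bmeas f ->
  \sum_(0 <= n < N) Ex (fun x => \1_(A n) x * f x) @[N --> \oo] --> Ex f.
Proof.
move=> mA tA cA bf.
have bAf n : bmeas (fun x => \1_(A n) x * f x).
  by apply: bmeasM => //; exact: bmeas_indic.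
(* [g N] is the indicator of the union of the [A n] with [n >= N]. Its mean tends to 0 by countable
   additivity, and [M] times it dominates the remainder of the series. *)
pose g N x : R := 1 - \sum_(0 <= n < N) \1_(A n) x.
have bA n : bmeas (\1_(A n)) by exact: bmeas_indic.
have bg N : bmeas (g N) by apply: bmeasB; [exact: bmeas_cst|exact: bmeas_sum].
have g0 N x : 0 <= g N x.
  have [n0 _ An0] : (\bigcup_n A n) x by rewrite cA.
  rewrite /g subr_ge0 big_mkord.
  have [n0N|Nn0] := ltnP n0 N.
    rewrite (bigD1 (Ordinal n0N))//= big1 ?addr0 ?indicE ?mem_set//.
    move=> i /eqP in0; rewrite indicE memNset// => Ai.
    apply: in0; apply/val_inj => /=.
    by apply: (tA i n0) => //; exists x.
  rewrite big1// => i _; rewrite indicE memNset// => Ai.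
  have := ltn_ord i; rewrite ltnNge (_ : i = n0 :> nat) ?Nn0//.
  by apply: (tA i n0) => //; exists x.
have [_ [M fM]] := bf.
have M0 : 0 <= M by apply: le_trans (fM point); exact: normr_ge0.
have gcvg : Ex (g N) @[N --> \oo] --> (0 : R).
  have -> : (fun N => Ex (g N)) =
      (fun N => 1 - \sum_(0 <= n < N) fine (P (A n))).
    apply/funext => N; rewrite ExB; [|exact: bmeas_cst|exact: bmeas_sum].
    by rewrite Ex_cst Ex_sum//; congr (_ - _); apply: eq_bigr => n _; exact: Ex_indic.
  rewrite -[X in _ --> X](subrr (1 : R)); apply: cvgB; first exact: cvg_cst.
  have := @measure_semi_sigma_additive _ _ _ P A mA tA.
  rewrite cA => /(_ measurableT).
  have -> : (P : {measure set T -> \bar R}) setT = 1%:E :> \bar R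
    by exact: probability_setT.
  move=> /fine_cvgP[_]; apply: cvg_trans; apply: near_eq_cvg.
  near=> N => /=; rewrite -sum_fine// => n _.
  exact: fin_num_measure.
have HM : M * Ex (g N) @[N --> \oo] --> (0 : R).
  by rewrite -(mulr0 M); apply: cvgZr => //; exact: gcvg.
have Hb N : `|Ex f - \sum_(0 <= n < N) Ex (fun x => \1_(A n) x * f x)| <= M * Ex (g N).
  rewrite -Ex_sum// -ExB//; last exact: bmeas_sum.
  rewrite -ExZ//; apply: Ex_norm_le.
  - by apply: bmeasB => //; exact: bmeas_sum.
  - exact: bmeasZ.
  - move=> x; rewrite -big_distrl/= -{1}(mul1r (f x)) -mulrBl normrM.
    by rewrite (ger0_norm (g0 N x)) mulrC ler_wpM2r.
apply/cvgrPdist_le => e e0.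
move/cvgrPdist_le : HM => /(_ e e0); apply: filterS => N.
rewrite sub0r normrN => HN; apply: le_trans (Hb N) _.
exact: le_trans (ler_norm _) HN.
Unshelve. all: by end_near. Qed.

End Expectation.

(** * The state process *)

Definition events : seq event := [:: E1; E2; E3; E4; E5; E6; E7].

Section StateMeasurability.
Context {R : realType} {d : measure_display} {T : measurableType d}.
Implicit Types (S : T -> state R) (k : event) (j : nat).

Definition label S k j : set T := [set w | ev (S w) = k /\ orb (S w) = j].

Lemma label_measurable S k j : state_measurable S -> measurable (label S k j).
Proof.
move=> mS; rewrite (_ : label S k j = S @^-1` cyl k j setT); first exact: mS.
by apply/seteqP; split=> w /= [? ?].
Qed.

(** [state R] carries no sigma-algebra here. Event and orbit size take countably many values, so
    measurability is checked on each label, where a state reduces to its residual time and the case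
    analyses of [next_state] disappear. *)
Lemma measurable_by_label S (D : set T) : state_measurable S ->
  (forall k j, measurable (label S k j `&` D)) -> measurable D.
Proof.
move=> mS H.
rewrite (_ : D = \bigcup_j (label S E1 j `&` D `|` (label S E2 j `&` D)
  `|` (label S E3 j `&` D) `|` (label S E4 j `&` D) `|` (label S E5 j `&` D)
  `|` (label S E6 j `&` D) `|` (label S E7 j `&` D))).
  by apply: bigcupT_measurable => j; repeat apply: measurableU; exact: H.
apply/seteqP; split=> [w Dw|w [j _]]; last first.
  by rewrite /=; tauto.
exists (orb (S w)) => //; rewrite /label /=.
by case: (ev (S w)); tauto.
Qed.

Lemma res_measurable S : state_measurable S -> measurable_fun setT (fun w => res (S w)).
Proof.
move=> mS _ V mV; rewrite setTI.
apply: (measurable_by_label mS) => k j.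
rewrite (_ : _ `&` _ = S @^-1` cyl k j V); first exact: mS.
by apply/seteqP; split=> w /=; rewrite /label /cyl /=; [case=> -[]|case].
Qed.

Lemma measurable_label_fun d' (T' : measurableType d') S
    (g : event -> nat -> T -> T') :
  state_measurable S -> (forall k j, measurable_fun setT (g k j)) ->
  measurable_fun setT (fun w => g (ev (S w)) (orb (S w)) w).
Proof.
move=> mS mg _ V mV; rewrite setTI.
apply: (measurable_by_label mS) => k j.
rewrite (_ : _ `&` _ = label S k j `&` (setT `&` g k j @^-1` V)).
  by apply: measurableI; [exact: label_measurable|exact: mg].
by rewrite setTI; apply/seteqP; split=> w [[<- <-]].
Qed.

Lemma state_measurable_label S (F : event -> nat -> T -> state R) :
  state_measurable S -> (forall k j, state_measurable (F k j)) ->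
  state_measurable (fun w => F (ev (S w)) (orb (S w)) w).
Proof.
move=> mS mF k' j' V mV.
apply: (measurable_by_label mS) => k j.
rewrite (_ : _ `&` _ = label S k j `&` (F k j @^-1` cyl k' j' V)).
  by apply: measurableI; [exact: label_measurable|exact: mF].
by apply/seteqP; split=> w [[<- <-]].
Qed.

Lemma state_measurable_if (c : T -> bool) S1 S2 : measurable_fun setT c ->
  state_measurable S1 -> state_measurable S2 ->
  state_measurable (fun w => if c w then S1 w else S2 w).
Proof.
move=> mc m1 m2 k j V mV.
have mct : measurable (c @^-1` [set true]) by rewrite -[X in measurable X]setTI; exact: mc.
rewrite (_ : _ @^-1` _ = (c @^-1` [set true] `&` S1 @^-1` cyl k j V) `|`
    (~` (c @^-1` [set true]) `&` S2 @^-1` cyl k j V)).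
  apply: measurableU; first by apply: measurableI => //; exact: m1.
  by apply: measurableI; [exact: measurableC|exact: m2].
apply/seteqP; split=> w /=.
  by case: (c w) => /= H; [left|right]; split.
by case: (c w) => /= -[] [].
Qed.

Lemma state_measurable_State k j (f : T -> R) : measurable_fun setT f ->
  state_measurable (fun w => State k j (f w)).
Proof.
move=> mf k' j' V mV.
have mfV : measurable (f @^-1` V) by rewrite -[X in measurable X]setTI; exact: mf.
have [->|kk'] := pselect (k = k'); last first.
  rewrite (_ : _ @^-1` _ = set0)//.
  by apply/seteqP; split=> w //= [].
have [->|jj'] := pselect (j = j'); last first.
  rewrite (_ : _ @^-1` _ = set0)//.
  by apply/seteqP; split=> w //= [].
rewrite (_ : _ @^-1` _ = f @^-1` V)//.
by apply/seteqP; split=> w //= [].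
Qed.

Variable r : rates R.

Lemma clock_measurable S x : state_measurable S -> measurable_fun setT x ->
  measurable_fun setT (fun w => clock r (S w) (x w)).
Proof.
move=> mS mx.
apply: (@measurable_label_fun _ _ S (fun k j w => x w / arrival_rate r k)) => // k j.
by apply: measurable_funM => //; exact: measurable_cst.
Qed.

Lemma arrival_first_measurable S x :
  state_measurable S -> measurable_fun setT x ->
  measurable_fun setT (fun w => arrival_first r (S w) (x w)).
Proof.
move=> mS mx.
pose g k j w := empty_idle (State k j (0 : R)) || (clock r (S w) (x w) < res (S w)).
rewrite (_ : (fun _ => _) = fun w => g (ev (S w)) (orb (S w)) w); last first.
  by apply/funext => w; rewrite /arrival_first /g /empty_idle /=.
apply: measurable_label_fun => // k j; rewrite /g.
case: (empty_idle _) => /=; first exact: measurable_cst.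
apply: measurable_fun_ltr; first exact: clock_measurable.
exact: res_measurable.
Qed.

Lemma duration_measurable S x : state_measurable S -> measurable_fun setT x ->
  measurable_fun setT (fun w => duration r (S w) (x w)).
Proof.
move=> mS mx; apply: measurable_fun_ifT.
- exact: arrival_first_measurable.
- exact: clock_measurable.
- exact: res_measurable.
Qed.

Lemma next_state_measurable S x b a : state_measurable S ->
  measurable_fun setT x -> measurable_fun setT b -> measurable_fun setT a ->
  state_measurable (fun w => next_state r (S w) (x w) (b w) (a w)).
Proof.
move=> mS mx mb ma.
have msub : measurable_fun setT (fun w => res (S w) - clock r (S w) (x w)).
  by apply: measurable_funB; [exact: res_measurable|exact: clock_measurable].
apply: state_measurable_if; first exact: arrival_first_measurable.
- pose F k j w := match k with
    | E1 => State E2 j (b w)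
    | E2 => State E4 j.+1 (res (S w) - clock r (S w) (x w))
    | E3 => State E6 j.+1 (res (S w) - clock r (S w) (x w))
    | E4 | E5 => State E5 j.+1 (res (S w) - clock r (S w) (x w))
    | E6 | E7 => State E7 j.+1 (res (S w) - clock r (S w) (x w))
    end.
  by apply: (@state_measurable_label S F) => // -[] j; exact: state_measurable_State.
- pose F k j w := match k with
    | E1 => State E3 j.-1 (b w)
    | _ => State E1 j (if j is 0%N then 0 else a w)
    end.
  apply: (@state_measurable_label S F) => // -[] j; apply: state_measurable_State => //;
    by case: j => // ; exact: measurable_cst.
Qed.

Lemma elapse_measurable S t : state_measurable S -> measurable_fun setT t ->
  state_measurable (fun w => elapse (t w) (S w)).
Proof.
move=> mS mt.
pose F k j w := if empty_idle (State k j (0 : R)) then State k j (res (S w))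
                else State k j (res (S w) - t w).
rewrite (_ : (fun _ => _) = fun w => F (ev (S w)) (orb (S w)) w); last first.
  apply/funext => w; rewrite /elapse /F /empty_idle /=.
  by case: (S w) => -[] [|j] s.
apply: state_measurable_label => // k j; rewrite /F.
case: (empty_idle _); apply: state_measurable_State; first exact: res_measurable.
by apply: measurable_funB => //; exact: res_measurable.
Qed.

Section Path.
Variables (S0 : T -> state R) (xi B A : nat -> T -> R).
Hypotheses (mS0 : state_measurable S0)
  (mxi : forall n, measurable_fun setT (xi n))
  (mB : forall n, measurable_fun setT (B n))
  (mA : forall n, measurable_fun setT (A n)).

Lemma jump_state_measurable n : state_measurable (jump_state r S0 xi B A n).
Proof. by elim: n => //= n IH; exact: next_state_measurable. Qed.

Lemma jump_time_measurable n :
  measurable_fun setT (jump_time r S0 xi B A n).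
Proof.
elim: n => [|n IH]; first exact: measurable_cst.
apply: measurable_funD => //; apply: duration_measurable => //.
exact: jump_state_measurable.
Qed.

Variable t : R.

Definition current n w : bool :=
  (jump_time r S0 xi B A n w <= t) && (t < jump_time r S0 xi B A n.+1 w).

Definition state_of n w : state R :=
  elapse (t - jump_time r S0 xi B A n w) (jump_state r S0 xi B A n w).

(* The junk value [S0 w] is used after an explosion, an event of measure 0 in
   the stationary regime. *)
Definition state_at w : state R :=
  match pselect (exists n, current n w) with
  | left e => state_of (ex_minn e) w
  | right _ => S0 w
  end.

(** Off [good_path] a duration may be negative, and several [n] may then be current at once. Taking
    the least one makes [state_at] defined and measurable on the whole space. *)
Definition first_current n : set T :=
  [set w | current n w /\ forall m, (m < n)%N -> ~~ current m w].

Lemma state_atE n w : first_current n w -> state_at w = state_of n w.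
Proof.
move=> [cn mn]; rewrite /state_at; case: pselect => [e|[]]; last by exists n.
case: ex_minnP => m cm le_m; congr (state_of _ w).
apply/eqP; rewrite eqn_leq le_m//= leqNgt; apply/negP => /mn.
by rewrite cm.
Qed.

Lemma current_measurable n : measurable [set w | current n w].
Proof.
rewrite -[X in measurable X]setTI.
have : measurable_fun setT (current n).
  apply: measurable_and; first by apply: measurable_fun_ler => //; [exact: jump_time_measurable].
  by apply: measurable_fun_ltr => //; exact: (jump_time_measurable n.+1).
by move=> /(_ measurableT [set true]); apply.
Qed.

Lemma first_current_measurable n : measurable (first_current n).
Proof.
rewrite (_ : first_current n = [set w | current n w] `&`
    \bigcap_(m in `I_n) ~` [set w | current m w]).
  apply: measurableI; first exact: current_measurable.
  by apply: bigcap_measurableType => m _; exact/measurableC/current_measurable.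
by apply/seteqP; split=> w /= [cn mn]; split=> // m /mn /negP.
Qed.

Lemma state_of_measurable n : state_measurable (state_of n).
Proof.
apply: elapse_measurable; first exact: jump_state_measurable.
by apply: measurable_funB; [exact: measurable_cst|exact: jump_time_measurable].
Qed.

(** For [0 <= t], the complement is explosion on good paths: infinitely many jumps by time [t]. *)
Definition survives : set T := \bigcup_n [set w | current n w].

Lemma survives_measurable : measurable survives.
Proof. by apply: bigcupT_measurable => n; exact: current_measurable. Qed.

Lemma state_at_measurable : state_measurable state_at.
Proof.
move=> k j V mV.
rewrite (_ : _ @^-1` _ =
    \bigcup_n (first_current n `&` state_of n @^-1` cyl k j V) `|`
    (~` survives `&` S0 @^-1` cyl k j V)).
  apply: measurableU.
    apply: bigcupT_measurable => n; apply: measurableI.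
      exact: first_current_measurable.
    exact: state_of_measurable.
  by apply: measurableI; [exact/measurableC/survives_measurable|exact: mS0].
apply/seteqP; split=> w; last first.
  case=> [[n _ [fn]]|[ns]]; first by rewrite /= (state_atE fn).
  rewrite /= /state_at; case: pselect => // -[n cn].
  by exfalso; apply: ns; exists n.
rewrite /= => H.
have [e|ne] := pselect (exists n, current n w); last first.
  right; split; first by move=> [n _ cn]; apply: ne; exists n.
  by move: H; rewrite /state_at; case: pselect.
left; have fn : first_current (ex_minn e) w.
  case: ex_minnP => m cm le_m; split=> // i im; apply/negP => /le_m.
  by rewrite leqNgt im.
by exists (ex_minn e) => //; split=> //=; rewrite -(state_atE fn).
Qed.

(** The laws give these signs only almost surely. Path estimates are proved on this event and
    transported to expectations by [Ex_good]. *)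
Definition good_path : set T :=
  [set w | forall n, [/\ 0 <= xi n w, 0 <= B n w & 0 <= A n w]].

End Path.
End StateMeasurability.

(** * Expectations of functions of the state *)

Section Pdf.
Context {R : realType}.
Local Notation leb := (@lebesgue_measure R).
Variable f : R -> R.
Hypothesis f_pdf : is_pdf f.

Lemma pdf_ge0 t : 0 <= t -> 0 <= f t.
Proof. by case: f_pdf => _ + _; exact. Qed.

Lemma pdf_integrable : leb.-integrable `[0, +oo[ (EFin \o f).
Proof.
have [mf f0 f1] := f_pdf.
apply/integrableP; split; first exact/measurable_EFinP.
rewrite (_ : (\int[_]_(x in _) _)%E = 1%E) ?ltry// -f1.
apply: eq_integral => x; rewrite inE/= in_itv/= andbT => x0.
by rewrite ger0_norm// f0.
Qed.

Lemma pdfM_integrable (psi : R -> R) (M : R) :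
  measurable_fun setT psi -> (forall t, 0 <= t -> `|psi t| <= M) ->
  leb.-integrable `[0, +oo[ (EFin \o (fun t => psi t * f t)).
Proof.
move=> mpsi psiM; have [mf f0 _] := f_pdf.
have : leb.-integrable `[0%R, +oo[ (fun x => M%:E * (EFin \o f) x)%E.
  by apply: integrableZl => //; exact: pdf_integrable.
apply: le_integrable => //.
- by apply/measurable_EFinP; apply: measurable_funM => //; exact: measurable_funTS.
- move=> x; rewrite /= in_itv/= andbT => x0.
  rewrite lee_fin !normrM ler_wpM2r// (le_trans (psiM _ x0))//.
  by rewrite ler_norm.
Qed.

Lemma pdf_Rintegral : \int[leb]_(t in `[0, +oo[) f t = 1.
Proof. by have [_ _ f1] := f_pdf; rewrite /Rintegral f1. Qed.

Lemma pdf_le (psi phi : R -> R) :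
  leb.-integrable `[0, +oo[ (EFin \o (fun t => psi t * f t)) ->
  leb.-integrable `[0, +oo[ (EFin \o (fun t => phi t * f t)) ->
  (forall t, 0 <= t -> psi t <= phi t) ->
  \int[leb]_(t in `[0, +oo[) (psi t * f t) <=
  \int[leb]_(t in `[0, +oo[) (phi t * f t).
Proof.
move=> i1 i2 H; apply: le_Rintegral => // x /=; rewrite in_itv/= andbT => x0.
by rewrite ler_wpM2r ?pdf_ge0// H.
Qed.

Lemma pdf_norm_le (psi phi : R -> R) :
  leb.-integrable `[0, +oo[ (EFin \o (fun t => psi t * f t)) ->
  leb.-integrable `[0, +oo[ (EFin \o (fun t => phi t * f t)) ->
  (forall t, 0 <= t -> `|psi t| <= phi t) ->
  `|\int[leb]_(t in `[0, +oo[) (psi t * f t)| <=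
  \int[leb]_(t in `[0, +oo[) (phi t * f t).
Proof.
move=> i1 i2 H; rewrite ler_norml -mulN1r -RintegralZl//; apply/andP; split.
  rewrite (_ : (fun x => _) = (fun t => (- phi t) * f t)); last first.
    by apply/funext => t; rewrite mulN1r mulNr.
  apply: pdf_le => //.
    rewrite (_ : _ \o _ = (fun t => ((-1)%:E * (phi t * f t)%:E)%E)); last first.
      by apply/funext => t; rewrite /= -EFinM mulN1r mulNr.
    exact: integrableZl.
  by move=> t t0; have := H t t0; rewrite ler_norml => /andP[].
by apply: pdf_le => // t t0; have := H t t0; rewrite ler_norml => /andP[].
Qed.

Lemma pdf_bound (psi : R -> R) (M : R) :
  measurable_fun setT psi -> (forall t, 0 <= t -> `|psi t| <= M) ->
  `|\int[leb]_(t in `[0, +oo[) (psi t * f t)| <= M.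
Proof.
move=> mpsi psiM.
have -> : M = \int[leb]_(t in `[0, +oo[) (M * f t).
  by rewrite RintegralZl ?pdf_Rintegral ?mulr1//; exact: pdf_integrable.
apply: pdf_norm_le => //; first exact: pdfM_integrable psiM.
by apply: (@pdfM_integrable _ `|M|) => //; exact: measurable_cst.
Qed.
End Pdf.

Section Labels.
Context {R : realType} {d : measure_display} {T : measurableType d}.
Variable P : probability T R.
Implicit Types (S : T -> state R).

Definition at_state (F : event -> nat -> R -> R) (s : state R) : R :=
  F (ev s) (orb s) (res s).

Definition bfun (F : event -> nat -> R -> R) :=
  (forall k j, measurable_fun setT (F k j)) /\
  exists M, forall k j x, `|F k j x| <= M.

Lemma bmeas_at_state S F : state_measurable S -> bfun F ->
  bmeas (fun w => at_state F (S w)).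
Proof.
move=> mS [mF [M FM]]; split; last by exists M => w; exact: FM.
apply: (@measurable_label_fun _ _ _ _ _ S (fun k j w => F k j (res (S w)))) => // k j.
by apply: measurableT_comp => //; exact: res_measurable.
Qed.

Lemma bmeas_label (E : event -> set T) S : state_measurable S ->
  (forall k, measurable (E k)) -> bmeas (fun w => \1_(E (ev (S w))) w : R).
Proof.
move=> mS mE; split.
  apply: (@measurable_label_fun _ _ _ _ _ S (fun k j w => \1_(E k) w : R)) => // k _.
  exact: measurable_indic.
by exists 1 => x; rewrite indicE ger0_norm// lern1 leq_b1.
Qed.

Lemma Ex_labels S G : state_measurable S -> bmeas G ->
  \sum_(0 <= j < N) \sum_(k <- events) Ex P (fun w => \1_(label S k j) w * G w)
    @[N --> \oo] --> Ex P G.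
Proof.
move=> mS bG.
pose A j : set T := [set w | orb (S w) = j].
have bl k j : bmeas (fun w => \1_(label S k j) w * G w).
  by apply: bmeasM => //; apply: bmeas_indic; exact: label_measurable.
have AE j w : \1_(A j) w * G w = \sum_(k <- events) \1_(label S k j) w * G w.
  rewrite -big_distrl/=; congr (_ * _).
  rewrite /events !big_cons big_nil addr0 !indicE.
  have l1 k : ev (S w) = k -> orb (S w) = j -> w \in label S k j = true.
    by move=> e o; rewrite mem_set.
  have l0 k : ev (S w) <> k -> w \in label S k j = false.
    by move=> e; apply/memNset => -[].
  have [oj|oj] := pselect (orb (S w) = j); last first.
    have l2 k : w \in label S k j = false by apply/memNset => -[].
    by rewrite memNset// !l2 !addr0.
  rewrite mem_set//; case E : (ev (S w)); rewrite (l1 _ E oj);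
    do ![rewrite l0; last by rewrite E]; by rewrite ?add0r ?addr0.
have mA j : measurable (A j).
  apply: (measurable_by_label mS) => k i.
  have [->|ij] := pselect (i = j).
    rewrite (_ : _ `&` _ = label S k j); first exact: label_measurable.
    by apply/seteqP; split=> w; [case|move=> [? ?]].
  rewrite (_ : _ `&` _ = set0)//.
  by apply/seteqP; split=> w // -[[_ e1] e2]; apply: ij; rewrite -e1 -e2.
have := @Ex_partition _ _ _ P A G mA.
have -> : (fun N => \sum_(0 <= j < N) \sum_(k <- events) Ex P (fun w => \1_(label S k j) w * G w))
  = (fun N => \sum_(0 <= j < N) Ex P (fun w => \1_(A j) w * G w)).
  apply/funext => N; apply: eq_bigr => j _.
  rewrite -Ex_sum//; congr Ex; apply/funext => w; by rewrite AE.
apply => //.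
- by move=> i j _ _ [w [<- <-]].
- by apply/seteqP; split=> // w _; exists (orb (S w)).
Qed.

(** Stationarity and independence are only given on the sets [cyl k j V]. On one label a function of
    the state is a function of the residual time alone, to which the transfer lemmas apply; this
    lemma sums the results. *)
Lemma Ex_eq_labels S S' G G' : state_measurable S -> state_measurable S' ->
  bmeas G -> bmeas G' ->
  (forall k j, Ex P (fun w => \1_(label S k j) w * G w) =
               Ex P (fun w => \1_(label S' k j) w * G' w)) ->
  Ex P G = Ex P G'.
Proof.
move=> mS mS' bG bG' H.
have h1 := Ex_labels mS bG; have h2 := Ex_labels mS' bG'.
have e : (fun N => \sum_(0 <= j < N) \sum_(k <- events)
      Ex P (fun w => \1_(label S k j) w * G w)) =
    (fun N => \sum_(0 <= j < N) \sum_(k <- events)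
      Ex P (fun w => \1_(label S' k j) w * G' w)).
  by apply/funext => N; apply: eq_bigr => j _; apply: eq_bigr => k _; rewrite H.
move: h1; rewrite e => h1.
exact: cvg_unique h1 h2.
Qed.

Lemma label_cyl S k j V :
  label S k j `&` (fun w => res (S w)) @^-1` V = S @^-1` cyl k j V.
Proof. by apply/seteqP; split=> w /=; [case=> -[]|case]. Qed.

Lemma Ex_same_law S S' F : state_measurable S -> state_measurable S' ->
  bfun F ->
  (forall k j V, measurable V -> P (S @^-1` cyl k j V) = P (S' @^-1` cyl k j V)) ->
  Ex P (fun w => at_state F (S w)) = Ex P (fun w => at_state F (S' w)).
Proof.
move=> mS mS' bF H.
apply: (Ex_eq_labels mS mS'); [exact: bmeas_at_state|exact: bmeas_at_state|].
move=> k j.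
have cE S1 : (fun w => \1_(label S1 k j) w * at_state F (S1 w)) =
   (fun w => \1_(label S1 k j) w * F k j (res (S1 w))).
  apply/funext => w; rewrite indicE; have [|] := boolP (w \in label S1 k j).
    by rewrite inE => -[e1 e2]; rewrite /at_state e1 e2.
  by rewrite !mul0r.
rewrite !cE.
have [mF [M FM]] := bF.
rewrite (@Ex_transfer _ _ _ P (label S k j) (label S' k j) (fun w => res (S w))
  (fun w => res (S' w)) 1 (F k j)) ?mul1r//.
- exact: label_measurable.
- exact: label_measurable.
- exact: res_measurable.
- exact: res_measurable.
- by move=> V mV; rewrite mul1e !label_cyl H.
- by exists M.
Qed.

(** [E] varies with the current event because the threshold under which the exponential clock rings
    before [h] involves the current rate. Independence is therefore used label by label. *)
Lemma Ex_indep_event S F (E : event -> set T) (c : event -> R) :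
  state_measurable S -> bfun F -> (forall k, measurable (E k)) ->
  (forall k, 0 <= c k <= 1) ->
  (forall k j V, measurable V ->
    P (S @^-1` cyl k j V `&` E k) = ((c k)%:E * P (S @^-1` cyl k j V))%E) ->
  Ex P (fun w => \1_(E (ev (S w))) w * at_state F (S w)) =
  Ex P (fun w => c (ev (S w)) * at_state F (S w)).
Proof.
move=> mS bF mE c01 H.
have [mF [M FM]] := bF.
have bc : bmeas (fun w => c (ev (S w))).
  apply: (@bmeas_at_state S (fun k j x => c k)) => //; split=> [k j|].
    exact: measurable_cst.
  by exists 1 => k _ _; have /andP[c0 c1] := c01 k; rewrite ger0_norm.
apply: (Ex_eq_labels mS mS).
- by apply: bmeasM; [exact: bmeas_label|exact: bmeas_at_state].
- by apply: bmeasM => //; exact: bmeas_at_state.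
move=> k j.
transitivity (Ex P (fun w => \1_(label S k j `&` E k) w * F k j (res (S w)))).
  congr Ex; apply/funext => w; rewrite indicI/=.
  rewrite [in LHS]indicE [\1_(label S k j) w]indicE.
  have [|] := boolP (w \in label S k j); rewrite ?mul0r// inE => -[e1 e2].
  by rewrite /at_state e1 e2 mulrA.
rewrite (@Ex_transfer _ _ _ P _ (label S k j) (fun w => res (S w))
  (fun w => res (S w)) (c k) (F k j)).
- rewrite -ExZ; last first.
    apply: bmeasM; first by apply: bmeas_indic; exact: label_measurable.
    split; last by exists M.
    by apply: measurableT_comp => //; exact: res_measurable.
  congr Ex; apply/funext => w; rewrite indicE.
  have [|] := boolP (w \in label S k j); rewrite ?mul0r ?mulr0// inE => -[e1 e2].
  by rewrite /at_state e1 e2 !mul1r.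
- by apply: measurableI => //; exact: label_measurable.
- exact: label_measurable.
- exact: res_measurable.
- exact: res_measurable.
- by have /andP[] := c01 k.
- by move=> V mV; rewrite label_cyl -H// -label_cyl setIAC.
- exact: mF.
- by exists M.
Qed.

(** Integrates out the duration of a phase that starts at a jump: [U] selects the states concerned,
    [E] is an independent condition such as an early arrival. *)
Lemma Ex_indep_density S (E : event -> set T) (c : event -> R)
    (U : event -> nat -> set R) (Y : T -> R) (f : R -> R)
    (psi : event -> nat -> R -> R) :
  state_measurable S -> (forall k, measurable (E k)) ->
  (forall k, 0 <= c k <= 1) -> (forall k j, measurable (U k j)) ->
  measurable_fun setT Y -> is_pdf f -> bfun psi ->
  (forall k j V W, measurable V -> measurable W ->
    P (S @^-1` cyl k j V `&` E k `&` Y @^-1` W) =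
    ((c k)%:E * P (S @^-1` cyl k j V) *
     \int[@lebesgue_measure R]_(t in W `&` `[0%R, +oo[) (f t)%:E)%E) ->
  let pbar k j := \int[@lebesgue_measure R]_(t in `[0, +oo[) (psi k j t * f t) in
  Ex P (fun w => \1_(E (ev (S w))) w *
     (\1_(U (ev (S w)) (orb (S w))) (res (S w)) *
      psi (ev (S w)) (orb (S w)) (Y w))) =
  Ex P (fun w => c (ev (S w)) *
     (\1_(U (ev (S w)) (orb (S w))) (res (S w)) *
      pbar (ev (S w)) (orb (S w)))).
Proof.
move=> mS mE c01 mU mY f_pdf [mpsi [M psiM]] H pbar.
have pbM k j : `|pbar k j| <= M by exact: pdf_bound.
have bU : bmeas (fun w => \1_(U (ev (S w)) (orb (S w))) (res (S w)) : R).
  apply: (@bmeas_at_state S (fun k j x => \1_(U k j) x)) => //; split.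
    by move=> k j; exact: measurable_indic.
  by exists 1 => k j x; rewrite indicE ger0_norm// lern1 leq_b1.
have bpsi : bmeas (fun w => psi (ev (S w)) (orb (S w)) (Y w)).
  split; last by exists M.
  apply: (@measurable_label_fun _ _ _ _ _ S (fun k j w => psi k j (Y w))) => // k j.
  by apply: measurableT_comp.
have bc : bmeas (fun w => c (ev (S w))).
  apply: (@bmeas_at_state S (fun k j x => c k)) => //; split=> [k j|].
    exact: measurable_cst.
  by exists 1 => k _ _; have /andP[c0 c1] := c01 k; rewrite ger0_norm.
have bpb : bmeas (fun w => pbar (ev (S w)) (orb (S w))).
  apply: (@bmeas_at_state S (fun k j x => pbar k j)) => //; split=> [k j|].
    exact: measurable_cst.
  by exists M.
apply: (Ex_eq_labels mS mS).
- by apply: bmeasM; [exact: bmeas_label|exact: bmeasM].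
- by apply: bmeasM => //; exact: bmeasM.
move=> k j.
have mSU : measurable (S @^-1` cyl k j (U k j)) by exact: mS.
transitivity (Ex P (fun w => \1_(S @^-1` cyl k j (U k j) `&` E k) w * psi k j (Y w))).
  congr Ex; apply/funext => w; rewrite indicI/= -label_cyl indicI/=.
  rewrite [in LHS]indicE [\1_(label S k j) w]indicE.
  have [|] := boolP (w \in label S k j); rewrite ?mul0r// inE => -[e1 e2].
  rewrite e1 e2 !mulrA; congr (_ * _); rewrite -!mulrA; congr (_ * _); rewrite mulrC.
  by congr (_ * _); rewrite !indicE.
rewrite (@Ex_density _ _ _ P _ Y (c k * fine (P (S @^-1` cyl k j (U k j)))) f)//.
- transitivity (Ex P (fun w => c k * pbar k j * \1_(S @^-1` cyl k j (U k j)) w)).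
    rewrite ExZ; last exact: bmeas_indic.
    rewrite Ex_indic// RintegralZl//; first by rewrite mulrAC.
    exact: (pdfM_integrable f_pdf (M := M)).
  congr Ex; apply/funext => w; rewrite -label_cyl indicI/=.
  rewrite ![\1_(label S k j) w]indicE.
  have [|] := boolP (w \in label S k j); rewrite ?mul0r ?mulr0// inE => -[e1 e2].
  rewrite e1 e2 !mul1r mulrAC -mulrA; congr (_ * (_ * _)).
- by apply: measurableI => //.
- by rewrite mulr_ge0//; [have /andP[] := c01 k|exact: fine_ge0].
- by case: f_pdf.
- exact: pdf_ge0.
- move=> V mV; rewrite H//; congr (_ * _)%E.
  by rewrite EFinM fineK//; exact: fin_num_measure.
Qed.
End Labels.

Section BoundedFunctions.
Context {R : realType}.
Implicit Types (G H : event -> nat -> R -> R).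

Lemma bfunD G H : bfun G -> bfun H -> bfun (fun k j x => G k j x + H k j x).
Proof.
move=> [mG [N GN]] [mH [N' HN]]; split=> [k j|]; first exact: measurable_funD.
exists (N + N') => k j x; apply: le_trans (ler_normD _ _) _.
by rewrite lerD// ?GN ?HN.
Qed.

Lemma bfunM G H : bfun G -> bfun H -> bfun (fun k j x => G k j x * H k j x).
Proof.
move=> [mG [N GN]] [mH [N' HN]]; split=> [k j|]; first exact: measurable_funM.
by exists (N * N') => k j x; rewrite normrM ler_pM.
Qed.

Lemma bfun_event (u : event -> R) :
  bfun (fun k (_ : nat) (_ : R) => u k).
Proof.
split=> [k j|]; first exact: measurable_cst.
exists (\sum_(k <- events) `|u k|) => k _ _.
rewrite /events !big_cons big_nil addr0.
have n i : 0 <= `|u i| by [].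
have := n E1; have := n E2; have := n E3; have := n E4; have := n E5.
have := n E6; have := n E7; case: k; lra.
Qed.

Lemma bfunN G : bfun G -> bfun (fun k j x => - G k j x).
Proof.
move=> bG; rewrite (_ : (fun _ => _) = (fun k j x => -1 * G k j x)); last first.
  by apply/funext => k; apply/funext => j; apply/funext => x; rewrite mulN1r.
by apply: bfunM => //; exact: (bfun_event (fun=> -1 : R)).
Qed.

End BoundedFunctions.

(** * Complex exponentials and transforms *)

Section PointwiseDerivatives.
Context {R : realType}.
Implicit Types (f g : R -> R) (k t df dg : R).

Lemma deriveD_fun f g t df dg : is_derive t 1 f df -> is_derive t 1 g dg ->
  is_derive t 1 (fun u => f u + g u) (df + dg).
Proof. exact: is_deriveD. Qed.

Lemma deriveB_fun f g t df dg : is_derive t 1 f df -> is_derive t 1 g dg ->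
  is_derive t 1 (fun u => f u - g u) (df - dg).
Proof. exact: is_deriveB. Qed.

Lemma deriveM_fun f g t df dg : is_derive t 1 f df -> is_derive t 1 g dg ->
  is_derive t 1 (fun u => f u * g u) (f t * dg + g t * df).
Proof. move=> d1 d2; exact: (is_deriveM d1 d2). Qed.

Lemma deriveMl_fun f k t df : is_derive t 1 f df ->
  is_derive t 1 (fun u => k * f u) (k * df).
Proof. exact: (@is_deriveZ R R R). Qed.

Lemma derive_affine k df t : is_derive t 1 (fun u : R => k + u * df) df.
Proof.
have h1 : is_derive t 1 (fun u : R => df * u) (df * 1) by apply: deriveMl_fun.
have h2 : is_derive t 1 (fun u : R => k) 0 by exact: is_derive_cst.
have := deriveD_fun h2 h1; rewrite add0r mulr1.
by congr is_derive; apply/funext => u; rewrite mulrC.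
Qed.
End PointwiseDerivatives.

Section ComplexNumbers.
Context {R : realType}.
Implicit Types (z w s : C R) (x y t : R).

Definition nrm z : R := ComplexField.Normc.normc z.

Lemma normE z : `|z| = RtoC (nrm z).
Proof. by case: z => x y; rewrite /nrm normc_def. Qed.

Lemma norm_le1 z : (`|z| <= 1) = (nrm z <= 1).
Proof. by rewrite normE -(_ : RtoC 1 = 1 :> C R)// /RtoC lecR. Qed.

Lemma nrm_ge0 z : 0 <= nrm z.
Proof. by case: z => x y; exact: sqrtr_ge0. Qed.

Lemma nrmM z w : nrm (z * w) = nrm z * nrm w.
Proof. exact: ComplexField.Normc.normcM. Qed.

Lemma nrmD z w : nrm (z + w) <= nrm z + nrm w.
Proof. exact: le_normcD. Qed.

Lemma nrmN z : nrm (- z) = nrm z.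
Proof. exact: normcN. Qed.

Lemma nrmB z w : nrm (z - w) <= nrm z + nrm w.
Proof. by rewrite -(nrmN w); exact: nrmD. Qed.

Lemma nrm0 : nrm 0 = 0.
Proof. exact: ComplexField.Normc.normc0. Qed.

Lemma nrm1 : nrm 1 = 1.
Proof. exact: ComplexField.Normc.normc1. Qed.

Lemma nrmV z : nrm z^-1 = (nrm z)^-1.
Proof. exact: ComplexField.Normc.normcV. Qed.

Lemma nrmX z n : nrm (z ^+ n) = nrm z ^+ n.
Proof. by elim: n => [|n IH]; rewrite ?expr0 ?nrm1// !exprS nrmM IH. Qed.

Lemma nrm_eq0 z : nrm z = 0 -> z = 0.
Proof. exact: ComplexField.Normc.eq0_normc. Qed.

Lemma nrm_gt0 z : z != 0 -> 0 < nrm z.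
Proof.
move=> z0; rewrite lt0r nrm_ge0 andbT; apply/eqP => /nrm_eq0 e.
by rewrite e eqxx in z0.
Qed.

Lemma nrm_RtoC x : nrm (RtoC x) = `|x|.
Proof. by rewrite /nrm /= expr0n addr0 sqrtr_sqr. Qed.

Lemma nrm_Re z : `|complex.Re z| <= nrm z.
Proof.
by case: z => x y; rewrite /nrm /= -sqrtr_sqr ler_wsqrtr// lerDl sqr_ge0.
Qed.

Lemma nrm_Im z : `|complex.Im z| <= nrm z.
Proof.
by case: z => x y; rewrite /nrm /= -sqrtr_sqr ler_wsqrtr// lerDr sqr_ge0.
Qed.

Lemma nrm_le z : nrm z <= `|complex.Re z| + `|complex.Im z|.
Proof.
case: z => x y; rewrite /nrm /= -[leRHS]ger0_norm ?addr_ge0// -sqrtr_sqr.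
rewrite ler_wsqrtr// sqrrD !real_normK ?num_real// lerD2r lerDl mulrn_wge0//.
Qed.

Lemma cReD z w : complex.Re (z + w) = complex.Re z + complex.Re w.
Proof. by case: z w => [? ?] [? ?]. Qed.
Lemma cImD z w : complex.Im (z + w) = complex.Im z + complex.Im w.
Proof. by case: z w => [? ?] [? ?]. Qed.
Lemma cReN z : complex.Re (- z) = - complex.Re z.
Proof. by case: z. Qed.
Lemma cImN z : complex.Im (- z) = - complex.Im z.
Proof. by case: z. Qed.
Lemma cReB z w : complex.Re (z - w) = complex.Re z - complex.Re w.
Proof. by rewrite cReD cReN. Qed.
Lemma cImB z w : complex.Im (z - w) = complex.Im z - complex.Im w.
Proof. by rewrite cImD cImN. Qed.
Lemma cReM z w : complex.Re (z * w) =
  complex.Re z * complex.Re w - complex.Im z * complex.Im w.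
Proof. by case: z w => [? ?] [? ?]. Qed.
Lemma cImM z w : complex.Im (z * w) =
  complex.Re z * complex.Im w + complex.Im z * complex.Re w.
Proof. by case: z w => [? ?] [? ?]. Qed.
Lemma Re_RtoCM x z : complex.Re (RtoC x * z) = x * complex.Re z.
Proof. by rewrite cReM /= mul0r subr0. Qed.
Lemma Im_RtoCM x z : complex.Im (RtoC x * z) = x * complex.Im z.
Proof. by rewrite cImM /= mul0r addr0. Qed.

Lemma complex_ext z w : complex.Re z = complex.Re w ->
  complex.Im z = complex.Im w -> z = w.
Proof. by case: z w => [? ?] [? ?] /= -> ->. Qed.

Lemma RtoCD x y : RtoC (x + y) = RtoC x + RtoC y.
Proof. by apply: complex_ext; rewrite ?cReD ?cImD //= addr0. Qed.
Lemma RtoCN x : RtoC (- x) = - RtoC x.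
Proof. by apply: complex_ext; rewrite ?cReN ?cImN //= oppr0. Qed.
Lemma RtoCB x y : RtoC (x - y) = RtoC x - RtoC y.
Proof. by rewrite RtoCD RtoCN. Qed.
Lemma RtoCM x y : RtoC (x * y) = RtoC x * RtoC y.
Proof. by apply: complex_ext; rewrite ?Re_RtoCM ?Im_RtoCM //= mulr0. Qed.
Lemma RtoC0 : RtoC 0 = 0 :> C R. Proof. by []. Qed.
Lemma RtoC1 : RtoC 1 = 1 :> C R. Proof. by []. Qed.
Lemma RtoC_inj x y : RtoC x = RtoC y -> x = y.
Proof. by move=> /(congr1 (@complex.Re R)). Qed.
Lemma RtoC_eq0 x : (RtoC x == 0) = (x == 0).
Proof. by apply/eqP/eqP => [/RtoC_inj|->]. Qed.
Lemma RtoCV x : RtoC x^-1 = (RtoC x)^-1.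
Proof.
have [->|x0] := eqVneq x 0; first by rewrite RtoC0 !invr0.
apply: (@mulfI _ (RtoC x)); first by rewrite RtoC_eq0.
by rewrite -RtoCM !divff ?RtoC_eq0.
Qed.
Lemma RtoC_sum (I : Type) (r : seq I) (f : I -> R) :
  RtoC (\sum_(i <- r) f i) = \sum_(i <- r) RtoC (f i).
Proof. by elim/big_rec2: _ => // i y1 y2 _ <-; rewrite RtoCD. Qed.
Lemma Re_sum (I : Type) (r : seq I) (f : I -> C R) :
  complex.Re (\sum_(i <- r) f i) = \sum_(i <- r) complex.Re (f i).
Proof. by elim/big_rec2: _ => // i y1 y2 _ <-; rewrite cReD. Qed.
Lemma Im_sum (I : Type) (r : seq I) (f : I -> C R) :
  complex.Im (\sum_(i <- r) f i) = \sum_(i <- r) complex.Im (f i).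
Proof. by elim/big_rec2: _ => // i y1 y2 _ <-; rewrite cImD. Qed.

Lemma cexpD z w : cexp (z + w) = cexp z * cexp w.
Proof.
case: z w => [a b] [c d]; apply: complex_ext; rewrite /cexp ?cReM ?cImM /= expRD.
  by rewrite cosD; ring.
by rewrite sinD; ring.
Qed.

Lemma cexp_RtoC x : cexp (RtoC x) = RtoC (expR x).
Proof. by apply: complex_ext; rewrite /= ?cos0 ?sin0 ?mulr1 ?mulr0. Qed.

Lemma cexp0 : cexp 0 = 1 :> C R.
Proof. by rewrite -RtoC0 cexp_RtoC expR0. Qed.

Lemma nrm_cexp z : nrm (cexp z) = expR (complex.Re z).
Proof.
case: z => a b; rewrite /nrm /cexp /= !exprMn -mulrDr cos2Dsin2 mulr1 sqrtr_sqr.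
by rewrite ger0_norm ?expR_ge0.
Qed.

Definition cderive (G G' : R -> C R) : Prop := forall t,
  is_derive t 1 (fun u => complex.Re (G u)) (complex.Re (G' t)) /\
  is_derive t 1 (fun u => complex.Im (G u)) (complex.Im (G' t)).

(** [c] is the conjugate of [D] divided by its modulus. It reduces the estimate of a complex
    quantity to the real part of one rotation, without the loss incurred by bounding both parts
    separately. *)
Lemma unit_multiplier (D : C R) :
  exists c : C R, nrm c <= 1 /\ complex.Re (c * D) = nrm D.
Proof.
have [D0|D0] := eqVneq D 0; first by exists 0; rewrite D0 nrm0 mul0r ler01.
have n0 := nrm_gt0 D0.
have ED : nrm D ^+ 2 = complex.Re D ^+ 2 + complex.Im D ^+ 2.
  by case: (D) => p q; rewrite /nrm /= sqr_sqrtr// addr_ge0 ?sqr_ge0.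
exists (RtoC (nrm D)^-1 * (complex.Re D -i* complex.Im D)%C); split.
  rewrite nrmM nrm_RtoC ger0_norm ?invr_ge0 ?(ltW n0)// mulrC ler_pdivrMr// mul1r.
  by rewrite {1}/nrm /= sqrrN; case: (D) => p q.
rewrite cReM Re_RtoCM Im_RtoCM /=.
transitivity ((nrm D)^-1 * (complex.Re D ^+ 2 + complex.Im D ^+ 2)); first by ring.
by rewrite -ED expr2 mulrA mulVf ?mul1r// gt_eqF.
Qed.

(* Apply the real mean value inequality to Re (e^{i theta} G) - g for the
   angle theta that makes e^{i theta} (G x - G 0) real. *)
Lemma mean_value_le (G G' : R -> C R) (g g' : R -> R) x : 0 <= x ->
  cderive G G' -> (forall t, is_derive t 1 g (g' t)) ->
  (forall t, 0 < t < x -> nrm (G' t) <= g' t) ->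
  nrm (G x - G 0) <= g x - g 0.
Proof.
move=> x0 dG dg H; set D := G x - G 0.
have [c [c1 cD]] := unit_multiplier D.
pose phi t := complex.Re c * complex.Re (G t) - complex.Im c * complex.Im (G t) - g t.
pose phi' t := complex.Re c * complex.Re (G' t) - complex.Im c * complex.Im (G' t) - g' t.
have dphi t : is_derive t 1 phi (phi' t).
  have [d1 d2] := dG t; have d3 := dg t.
  by apply: deriveB_fun => //; apply: deriveB_fun; exact: deriveMl_fun.
have le_phi : phi x <= phi 0.
  apply: (@ler0_derive1_nincr _ phi 0 x) => //.
  - move=> t; rewrite in_itv/= => tx.
    rewrite derive1E (@derive_val _ _ _ _ _ _ _ (dphi t)) /phi' subr_le0.
    apply: le_trans (H t tx).
    apply: (@le_trans _ _ (nrm (c * G' t))).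
      by rewrite -cReM; apply: le_trans (ler_norm _) (nrm_Re _).
    by rewrite nrmM ler_piMl ?nrm_ge0.
  - apply: derivable_within_continuous => t _.
    by case: (dphi t).
move: le_phi; rewrite /phi => le_phi.
rewrite -cD cReM cReB cImB; lra.
Qed.

Lemma cderive_cexp (p q : C R) :
  cderive (fun t => cexp (p + RtoC t * q)) (fun t => q * cexp (p + RtoC t * q)).
Proof.
move=> t; case: p q => [a b] [c d].
have E u : (a +i* b)%C + RtoC u * (c +i* d)%C = ((a + u * c) +i* (b + u * d))%C :> C R.
  by apply: complex_ext; rewrite ?cReD ?cImD ?Re_RtoCM ?Im_RtoCM.
have da := derive_affine a c t; have db := derive_affine b d t.
have de : is_derive t 1 (fun u : R => expR (a + u * c)) (expR (a + t * c) * c).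
  exact: is_derive1_comp.
have dc : is_derive t 1 (fun u : R => cos (b + u * d)) (- sin (b + t * d) * d).
  exact: is_derive1_comp.
have ds : is_derive t 1 (fun u : R => sin (b + u * d)) (cos (b + t * d) * d).
  exact: is_derive1_comp.
split.
- rewrite (_ : (fun u => _) = (fun u : R => expR (a + u * c) * cos (b + u * d))); last first.
    by apply/funext => u; rewrite E.
  apply: (is_derive_eq (deriveM_fun de dc)).
  by rewrite cReM E /cexp /=; ring.
- rewrite (_ : (fun u => _) = (fun u : R => expR (a + u * c) * sin (b + u * d))); last first.
    by apply/funext => u; rewrite E.
  apply: (is_derive_eq (deriveM_fun de ds)).
  by rewrite cImM E /cexp /=; ring.
Qed.
End ComplexNumbers.

Section ComplexExponential.
Context {R : realType}.
Implicit Types (z w s p q c : C R) (x y t : R).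

Lemma cderiveD G H G' H' : cderive (R := R) G G' -> cderive H H' ->
  cderive (fun t => G t + H t) (fun t => G' t + H' t).
Proof.
move=> dG dH t; have [g1 g2] := dG t; have [h1 h2] := dH t; split.
- rewrite cReD (_ : (fun u => _) = fun u => complex.Re (G u) + complex.Re (H u)).
    exact: deriveD_fun.
  by apply/funext => u; rewrite cReD.
- rewrite cImD (_ : (fun u => _) = fun u => complex.Im (G u) + complex.Im (H u)).
    exact: deriveD_fun.
  by apply/funext => u; rewrite cImD.
Qed.

Lemma cderiveM c G G' : cderive (R := R) G G' ->
  cderive (fun t => c * G t) (fun t => c * G' t).
Proof.
move=> dG t; have [g1 g2] := dG t; split.
- rewrite cReM (_ : (fun u => _) = fun u => complex.Re c * complex.Re (G u) -
      complex.Im c * complex.Im (G u)).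
    by apply: deriveB_fun; exact: deriveMl_fun.
  by apply/funext => u; rewrite cReM.
- rewrite cImM (_ : (fun u => _) = fun u => complex.Re c * complex.Im (G u) +
      complex.Im c * complex.Re (G u)).
    by apply: deriveD_fun; exact: deriveMl_fun.
  by apply/funext => u; rewrite cImM.
Qed.

Lemma cderive_id c : cderive (fun t => RtoC t * c) (fun=> c).
Proof.
move=> t; split.
- rewrite (_ : (fun u => _) = fun u : R => 0 + u * complex.Re c).
    exact: derive_affine.
  by apply/funext => u; rewrite Re_RtoCM add0r.
- rewrite (_ : (fun u => _) = fun u : R => 0 + u * complex.Im c).
    exact: derive_affine.
  by apply/funext => u; rewrite Im_RtoCM add0r.
Qed.

Lemma nrm_cexp_le1 p : complex.Re p <= 0 -> nrm (cexp p) <= 1.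
Proof. by move=> p0; rewrite nrm_cexp -expR0 ler_expR. Qed.

Lemma Re_segment p q t : complex.Re p <= 0 -> complex.Re q <= 0 -> 0 < t < 1 ->
  complex.Re (p + RtoC t * (q - p)) <= 0.
Proof.
move=> p0 q0 /andP[t0 t1]; rewrite cReD Re_RtoCM cReB.
have h1 : t * complex.Re q <= 0 by rewrite mulr_ge0_le0// ltW.
have h2 : (1 - t) * complex.Re p <= 0 by rewrite mulr_ge0_le0// subr_ge0 ltW.
lra.
Qed.

Lemma cexp_lipschitz p q : complex.Re p <= 0 -> complex.Re q <= 0 ->
  nrm (cexp q - cexp p) <= nrm (q - p).
Proof.
move=> p0 q0.
have dg t : is_derive t 1 (fun u : R => 0 + u * nrm (q - p)) (nrm (q - p)).
  exact: derive_affine.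
have := mean_value_le (x := 1) ler01 (cderive_cexp p (q - p)) dg.
rewrite (_ : p + RtoC 1 * (q - p) = q); last by rewrite RtoC1; ring.
rewrite (_ : p + RtoC 0 * (q - p) = p); last by rewrite RtoC0; ring.
rewrite (_ : 0 + 1 * _ - (0 + 0 * _) = nrm (q - p)); last by ring.
apply => t t01; rewrite nrmM ler_piMr ?nrm_ge0// nrm_cexp_le1//.
exact: Re_segment.
Qed.

(** The mean value inequality along the segment, applied to [cexp (p + t * d) - t * d * cexp p]: its
    derivative is [d] times an increment of [cexp], which [cexp_lipschitz] bounds by the modulus of
    [d]. *)
Lemma cexp_taylor p q : complex.Re p <= 0 -> complex.Re q <= 0 ->
  nrm (cexp q - cexp p - (q - p) * cexp p) <= nrm (q - p) ^+ 2.
Proof.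
move=> p0 q0.
have dg t : is_derive t 1 (fun u : R => 0 + u * (nrm (q - p) ^+ 2)) (nrm (q - p) ^+ 2).
  exact: derive_affine.
pose d := q - p.
have dG : cderive (fun t => cexp (p + RtoC t * d) + (-1) * (RtoC t * (d * cexp p)))
  (fun t => d * cexp (p + RtoC t * d) + (-1) * (d * cexp p)).
  by apply: cderiveD; [exact: cderive_cexp|apply: cderiveM; exact: cderive_id].
have := mean_value_le (x := 1) ler01 dG dg.
rewrite (_ : _ + _ - _ = cexp q - cexp p - d * cexp p); last first.
  rewrite RtoC1 RtoC0 (_ : p + 1 * d = q); last by rewrite /d; ring.
  by rewrite (_ : p + 0 * d = p); ring.
rewrite (_ : 0 + 1 * _ - (0 + 0 * _) = nrm (q - p) ^+ 2); last by ring.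
apply => t t01; have /andP[t0 t1] := t01.
rewrite (_ : _ + _ = d * (cexp (p + RtoC t * d) - cexp p)); last by ring.
rewrite nrmM expr2 ler_wpM2l ?nrm_ge0//.
apply: le_trans (cexp_lipschitz p0 (Re_segment p0 q0 t01)) _.
rewrite addrC addKr nrmM nrm_RtoC ger0_norm ?(ltW t0)//.
by rewrite ler_piMl ?nrm_ge0 ?ltW.
Qed.

Lemma cderive_measurable G G' : cderive (R := R) G G' ->
  measurable_fun setT (fun t => complex.Re (G t)) /\
  measurable_fun setT (fun t => complex.Im (G t)).
Proof.
move=> dG; split; apply: continuous_measurable_fun => t;
  apply: differentiable_continuous; apply/derivable1_diffP;
  by have [[? ?] [? ?]] := dG t.
Qed.

Lemma cderive_cexp_neg s :
  cderive (fun t => cexp (- s * RtoC t)) (fun t => - s * cexp (- s * RtoC t)).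
Proof.
have := cderive_cexp 0 (- s).
by congr cderive; apply/funext => t; rewrite add0r [RtoC t * _]mulrC.
Qed.
End ComplexExponential.

(** * Integration of complex functions against a density *)

Section ComplexIntegral.
Context {R : realType}.
Variable f : R -> R.
Hypothesis f_pdf : is_pdf f.
Implicit Types (s z c : C R) (g h : R -> C R).
Local Notation leb := (@lebesgue_measure R).

Definition cint g : C R :=
  ((\int[leb]_(t in `[0, +oo[) (complex.Re (g t) * f t)) +i*
   (\int[leb]_(t in `[0, +oo[) (complex.Im (g t) * f t)))%C.

Definition cintegrable g :=
  leb.-integrable `[0, +oo[ (EFin \o (fun t => complex.Re (g t) * f t)) /\
  leb.-integrable `[0, +oo[ (EFin \o (fun t => complex.Im (g t) * f t)).

Lemma clstE s : clst f s = cint (fun t => cexp (- s * RtoC t)).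
Proof. by []. Qed.

Lemma integrableD_fun (u v : R -> R) :
  leb.-integrable `[0, +oo[ (EFin \o u) -> leb.-integrable `[0, +oo[ (EFin \o v) ->
  leb.-integrable `[0, +oo[ (EFin \o (fun t => u t + v t)).
Proof.
move=> iu iv; rewrite (_ : EFin \o _ = (EFin \o u) \+ (EFin \o v))%E//.
exact: integrableD.
Qed.

Lemma integrableM_fun (k : R) (u : R -> R) :
  leb.-integrable `[0, +oo[ (EFin \o u) ->
  leb.-integrable `[0, +oo[ (EFin \o (fun t => k * u t)).
Proof.
move=> iu; rewrite (_ : EFin \o _ = (fun t => k%:E * (EFin \o u) t))%E//.
exact: integrableZl.
Qed.

Lemma cintegrableD g h : cintegrable g -> cintegrable h ->
  cintegrable (fun t => g t + h t).
Proof.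
move=> [g1 g2] [h1 h2]; split.
- rewrite (_ : (fun t => _) = fun t => complex.Re (g t) * f t + complex.Re (h t) * f t).
    exact: integrableD_fun.
  by apply/funext => t; rewrite cReD mulrDl.
- rewrite (_ : (fun t => _) = fun t => complex.Im (g t) * f t + complex.Im (h t) * f t).
    exact: integrableD_fun.
  by apply/funext => t; rewrite cImD mulrDl.
Qed.

Lemma cintD g h : cintegrable g -> cintegrable h ->
  cint (fun t => g t + h t) = cint g + cint h.
Proof.
move=> [g1 g2] [h1 h2]; apply: complex_ext; rewrite ?cReD ?cImD /=.
- rewrite -RintegralD//; apply: eq_Rintegral => t _.
  by rewrite cReD mulrDl.
- rewrite -RintegralD//; apply: eq_Rintegral => t _.
  by rewrite cImD mulrDl.
Qed.

Lemma cintegrableM c g : cintegrable g -> cintegrable (fun t => c * g t).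
Proof.
move=> [g1 g2]; split.
- rewrite (_ : (fun t => _) = fun t => complex.Re c * (complex.Re (g t) * f t) +
      - complex.Im c * (complex.Im (g t) * f t)).
    by apply: integrableD_fun; exact: integrableM_fun.
  by apply/funext => t; rewrite cReM; ring.
- rewrite (_ : (fun t => _) = fun t => complex.Re c * (complex.Im (g t) * f t) +
      complex.Im c * (complex.Re (g t) * f t)).
    by apply: integrableD_fun; exact: integrableM_fun.
  by apply/funext => t; rewrite cImM; ring.
Qed.

Lemma cintM c g : cintegrable g -> cint (fun t => c * g t) = c * cint g.
Proof.
move=> [g1 g2]; apply: complex_ext; rewrite ?cReM ?cImM /=.
- rewrite -!RintegralZl// -RintegralB//; [|exact: integrableM_fun..].
  by apply: eq_Rintegral => t _; rewrite cReM; ring.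
- rewrite -!RintegralZl// -RintegralD//; [|exact: integrableM_fun..].
  by apply: eq_Rintegral => t _; rewrite cImM; ring.
Qed.

Lemma cintegrable_bounded g (N : R) :
  measurable_fun setT (fun t => complex.Re (g t)) ->
  measurable_fun setT (fun t => complex.Im (g t)) ->
  (forall t, 0 <= t -> nrm (g t) <= N) -> cintegrable g.
Proof.
move=> m1 m2 gN; split.
- apply: (pdfM_integrable f_pdf (M := N)) => // t t0.
  by apply: le_trans (nrm_Re _) (gN _ t0).
- apply: (pdfM_integrable f_pdf (M := N)) => // t t0.
  by apply: le_trans (nrm_Im _) (gN _ t0).
Qed.

Lemma cintegrable_cexp s : 0 <= complex.Re s ->
  cintegrable (fun t => cexp (- s * RtoC t)).
Proof.
move=> s0; have [m1 m2] := cderive_measurable (cderive_cexp_neg s).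
apply: (cintegrable_bounded (N := 1)) => // t t0.
by apply: nrm_cexp_le1; rewrite mulrC Re_RtoCM cReN mulrN oppr_le0 mulr_ge0.
Qed.

Lemma cintegrable_cst c : cintegrable (fun=> c).
Proof.
by apply: (cintegrable_bounded (N := nrm c)) => //; exact: measurable_cst.
Qed.

Lemma cint_cst c : cint (fun=> c) = c.
Proof.
by apply: complex_ext; rewrite /= RintegralZl ?(pdf_Rintegral f_pdf) ?mulr1//;
  exact: (pdf_integrable f_pdf).
Qed.

(** Rotating the integral onto the positive axis keeps the bound sharp. This matters: uniqueness of
    the zeros of the denominators rests on a Lipschitz constant that stability only just keeps below
    1. *)
Lemma cint_norm g (phi : R -> R) : cintegrable g ->
  leb.-integrable `[0, +oo[ (EFin \o (fun t => phi t * f t)) ->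
  (forall t, 0 <= t -> nrm (g t) <= phi t) ->
  nrm (cint g) <= \int[leb]_(t in `[0, +oo[) (phi t * f t).
Proof.
move=> ig iphi gphi; set D := cint g.
have [c [c1 cD]] := unit_multiplier D.
rewrite -cD -cintM//= ; have [i1 _] := cintegrableM c ig.
apply: (pdf_le f_pdf) => // t t0.
apply: le_trans (ler_norm _) _; apply: le_trans (nrm_Re _) _.
rewrite nrmM; apply: le_trans (gphi t t0).
by rewrite ler_piMl ?nrm_ge0.
Qed.

Lemma lst_clst (x : R) : RtoC (lst f x) = clst f (RtoC x).
Proof.
have E t : cexp (- RtoC x * RtoC t) = RtoC (expR (- x * t)).
  by rewrite -RtoCN -RtoCM cexp_RtoC.
have -> : clst f (RtoC x) = cint (fun t => RtoC (expR (- x * t))).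
  by rewrite clstE; congr cint; apply/funext => t; exact: E.
apply: complex_ext => //=.
transitivity (\int[leb]_(t in `[0, +oo[) (0 : R)).
  by rewrite Rintegral_cst//= mul0r.
by apply: eq_Rintegral => t _; rewrite mul0r.
Qed.

End ComplexIntegral.

(** * Derivative of the transform in the closed half-plane *)

Section TransformLimits.
Context {R : realType}.
Variable f : R -> R.
Hypotheses (f_pdf : is_pdf f) (f_mean : finite_mean f).
Implicit Types (s z c : C R).
Local Notation leb := (@lebesgue_measure R).

Lemma meanM_integrable (k : R) :
  leb.-integrable `[0, +oo[ (EFin \o (fun t => k * t * f t)).
Proof.
rewrite (_ : (fun t => _) = fun t => k * (t * f t)).
  exact: integrableM_fun.
by apply/funext => t; rewrite mulrA.
Qed.

Lemma RintegralM_mean (k : R) :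
  \int[leb]_(t in `[0, +oo[) (k * t * f t) = k * mean f.
Proof. by rewrite /mean -RintegralZl//; apply: eq_Rintegral => t _; rewrite mulrA. Qed.

Lemma Re_transform_arg s t : 0 <= complex.Re s -> 0 <= t ->
  complex.Re (- s * RtoC t) <= 0.
Proof. by move=> s0 t0; rewrite mulrC Re_RtoCM cReN mulrN oppr_le0 mulr_ge0. Qed.

Lemma clst_lipschitz s s' : 0 <= complex.Re s -> 0 <= complex.Re s' ->
  nrm (clst f s - clst f s') <= nrm (s - s') * mean f.
Proof.
move=> s0 s'0; have i1 := cintegrable_cexp f_pdf s0; have i2 := cintegrable_cexp f_pdf s'0.
rewrite !clstE -[X in _ - X]mul1r -mulNr -cintM// -cintD//; last exact: cintegrableM.
rewrite -RintegralM_mean; apply: (cint_norm f_pdf).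
- by apply: cintegrableD => //; exact: cintegrableM.
- exact: meanM_integrable.
- move=> t t0; rewrite mulN1r.
  apply: le_trans (cexp_lipschitz _ _) _; rewrite ?Re_transform_arg//.
  rewrite (_ : _ - _ = - (s - s') * RtoC t); last by ring.
  by rewrite nrmM nrmN nrm_RtoC ger0_norm.
Qed.

(** Minus the derivative of the transform at [x], as [clst_quotient] shows. *)
Definition cmean (x : R) : C R :=
  cint f (fun t => RtoC t * cexp (- RtoC x * RtoC t)).

Lemma cmean0 : cmean 0 = RtoC (mean f).
Proof.
rewrite /cmean (_ : (fun t => _) = fun t => RtoC t).
  apply: complex_ext => //=.
  transitivity (\int[leb]_(t in `[0, +oo[) (0 : R)).
    by apply: eq_Rintegral => t _; rewrite mul0r.
  by rewrite Rintegral_cst//= mul0r.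
by apply/funext => t; rewrite RtoC0 oppr0 mul0r cexp0 mulr1.
Qed.

Lemma cintegrable_mean (x : R) : 0 <= x ->
  cintegrable f (fun t => RtoC t * cexp (- RtoC x * RtoC t)).
Proof.
move=> x0.
have E t : cexp (- RtoC x * RtoC t) = RtoC (expR (- x * t)).
  by rewrite -RtoCN -RtoCM cexp_RtoC.
have mf : measurable_fun (`[0, +oo[ : set R) f by case: f_pdf.
split.
- rewrite (_ : (fun t => _) = fun t => t * expR (- x * t) * f t); last first.
    by apply/funext => t; rewrite E -RtoCM.
  apply: le_integrable (f_mean) => //.
    apply/measurable_EFinP; apply: measurable_funM => //; apply: measurable_funTS.
    apply: measurable_funM => //.
    have [m1 _] := cderive_measurable (cderive_cexp_neg (RtoC x)).
    by move: m1; congr measurable_fun; apply/funext => t; rewrite E.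
  move=> t /=; rewrite in_itv/= andbT => t0.
  rewrite lee_fin !normrM ler_wpM2r// ler_piMr// ger0_norm ?expR_ge0//.
  by rewrite -expR0 ler_expR mulNr oppr_le0 mulr_ge0.
- rewrite (_ : (fun t => _) = fun t => 0 * f t); last first.
    by apply/funext => t; rewrite E -RtoCM.
  apply: integrableM_fun; exact: (pdf_integrable f_pdf).
Qed.

(** Only the first moment is finite, so the quadratic Taylor remainder cannot be integrated. The
    minimum combines it with the linear bound; the integrand is dominated by [2 * t * f t] and tends
    to 0 pointwise. *)
Lemma truncated_mean_cvg :
  \int[leb]_(t in `[0, +oo[) (t * Num.min 2 (n.+1%:R^-1 * t) * f t)
    @[n --> \oo] --> (0 : R).
Proof.
have mf : measurable_fun (`[0, +oo[ : set R) f by case: f_pdf.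
have f0 := pdf_ge0 f_pdf.
pose g n t : \bar R := (t * Num.min 2 (n.+1%:R^-1 * t) * f t)%:E.
have mD : measurable (`[0%R, +oo[%classic : set (measurableTypeR R)) by [].
have [|||||_ _ H] := @dominated_convergence _ _ _ leb `[0%R, +oo[%classic mD g
  (fun=> 0%E) (fun t => (2 * t * f t)%:E).
- move=> n; apply/measurable_EFinP; apply: measurable_funM => //.
  apply: measurable_funTS; apply: measurable_funM => //.
  apply: measurable_minr; first exact: measurable_cst.
  by apply: measurable_funM => //; exact: measurable_cst.
- exact: measurable_cst.
- apply: aeW => t; rewrite /= in_itv/= andbT => t0.
  rewrite /g; apply: cvg_EFin; first by near=> n.
  rewrite -[X in _ --> X](mul0r (f t)); apply: cvgMl.
  rewrite -[X in _ --> X](mulr0 t); apply: cvgMr.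
  apply: (@squeeze_cvgr _ _ _ _ (fun=> 0) (fun n => n.+1%:R^-1 * t)).
  + near=> n; rewrite ge_min lexx orbT andbT le_min.
    by rewrite ler0n/= mulr_ge0// invr_ge0.
  + exact: cvg_cst.
  + rewrite -[X in _ --> X](mul0r t); apply: cvgMl; exact: cvg_harmonic.
- exact: meanM_integrable.
- apply: aeW => t n; rewrite /= in_itv/= andbT => t0.
  rewrite lee_fin normrM (ger0_norm (f0 _ t0)) ler_wpM2r ?f0//.
  rewrite normrM (ger0_norm t0) mulrC ler_wpM2r// ger0_norm ?ge_min ?lexx//.
  by rewrite le_min ler0n/= mulr_ge0// invr_ge0.
move: H; rewrite integral0 => /fine_cvgP[_].
by apply: cvg_trans; apply: near_eq_cvg; near=> n.
Unshelve. all: by end_near. Qed.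

(** Differentiability up to the boundary point [x = 0]. It fills two removable singularities:
    [x = l] in the generating function of arrivals, and [x = 0] in the ratios at [z = 1]. *)
Lemma clst_quotient (x e : R) : 0 <= x -> 0 < e ->
  exists2 del, 0 < del & forall s, 0 <= complex.Re s -> s != RtoC x ->
    nrm (s - RtoC x) <= del ->
    nrm ((clst f (RtoC x) - clst f s) / (s - RtoC x) - cmean x) <= e.
Proof.
move=> x0 e0.
have /cvgrPdist_le/(_ e e0)[N _ /(_ N (leqnn N))] := truncated_mean_cvg.
rewrite sub0r normrN => HN.
exists N.+1%:R^-1; first by rewrite invr_gt0.
move=> s s0 sx sd.
have sx0 : s - RtoC x != 0 by rewrite subr_eq0.
have ns0 := nrm_gt0 sx0.
have i1 := cintegrable_cexp f_pdf s0.
have i2 := cintegrable_cexp f_pdf (s := RtoC x) x0.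
have i3 := cintegrable_mean x0.
have E : (clst f (RtoC x) - clst f s) / (s - RtoC x) - cmean x =
  cint f (fun t => (s - RtoC x)^-1 * (cexp (- RtoC x * RtoC t) + (-1) * cexp (- s * RtoC t))
    + (-1) * (RtoC t * cexp (- RtoC x * RtoC t))).
  rewrite cintD; [|apply: cintegrableM; apply: cintegrableD => //; exact: cintegrableM
    |exact: cintegrableM].
  rewrite cintM; last by apply: cintegrableD => //; exact: cintegrableM.
  rewrite cintD//; last exact: cintegrableM.
  by rewrite !cintM// -!clstE /cmean; ring.
rewrite E; apply: le_trans (le_trans (ler_norm _) HN).
apply: (cint_norm f_pdf).
- apply: cintegrableD; last exact: cintegrableM.
  by apply: cintegrableM; apply: cintegrableD => //; exact: cintegrableM.
- have mf : measurable_fun (`[0, +oo[ : set R) f by case: f_pdf.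
  apply: le_integrable (meanM_integrable 2) => //.
    apply/measurable_EFinP; apply: measurable_funM => //.
    apply: measurable_funTS; apply: measurable_funM => //.
    apply: measurable_minr; first exact: measurable_cst.
    by apply: measurable_funM => //; exact: measurable_cst.
  move=> t /=; rewrite in_itv/= andbT => t0.
  rewrite lee_fin !normrM ler_wpM2r// mulrC ler_wpM2r//.
  rewrite !ger0_norm ?ge_min ?lexx//.
  by rewrite le_min ler0n/= mulr_ge0// invr_ge0.
move=> t t0; set p := - RtoC x * RtoC t; set q := - s * RtoC t.
have p0 : complex.Re p <= 0 by exact: Re_transform_arg.
have q0 : complex.Re q <= 0 by exact: Re_transform_arg.
have qp : q - p = - (s - RtoC x) * RtoC t by rewrite /p /q; ring.
have nqp : nrm (q - p) = nrm (s - RtoC x) * t.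
  by rewrite qp nrmM nrmN nrm_RtoC ger0_norm.
have -> : (s - RtoC x)^-1 * (cexp p + (-1) * cexp q) + (-1) * (RtoC t * cexp p) =
  - ((s - RtoC x)^-1 * (cexp q - cexp p - (q - p) * cexp p)).
  by rewrite qp; field.
rewrite nrmN nrmM nrmV mulrC ler_pdivrMr//.
(* The remainder is at most the square of [nrm (q - p)] and at most twice [nrm (q - p)]. Divided by
   [nrm (s - RtoC x)], these become the two entries of the truncated mean. *)
have b1 : nrm (cexp q - cexp p - (q - p) * cexp p) <= nrm (q - p) ^+ 2.
  exact: cexp_taylor.
have b2 : nrm (cexp q - cexp p - (q - p) * cexp p) <= 2 * nrm (q - p).
  apply: le_trans (nrmB _ _) _; rewrite nrmM mulr2n mulrDl mul1r lerD//.
    exact: cexp_lipschitz.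
  by rewrite ler_piMr ?nrm_ge0// nrm_cexp_le1.
rewrite minr_pMr// minr_pMl ?nrm_ge0// le_min; apply/andP; split.
  by apply: le_trans b2 _; rewrite nqp; lra.
apply: le_trans b1 _; rewrite nqp.
rewrite (_ : (nrm (s - RtoC x) * t) ^+ 2 = nrm (s - RtoC x) * (t * t * nrm (s - RtoC x))); last by ring.
rewrite (_ : t * (N.+1%:R^-1 * t) * _ = N.+1%:R^-1 * (t * t * nrm (s - RtoC x))); last by ring.
by rewrite ler_wpM2r// !mulr_ge0 ?nrm_ge0.
Qed.
End TransformLimits.

(** * Continuity on the closed disc and limits of ratios *)

Section DiscContinuity.
Context {R : realType}.
Implicit Types (z w u : C R) (g h num den : C R -> C R).

Definition disc_cont g z : Prop := forall e : R, 0 < e ->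
  exists2 del, 0 < del & forall w, nrm w <= 1 -> nrm (w - z) <= del ->
    nrm (g w - g z) <= e.

Lemma disc_cont_cst u z : disc_cont (fun=> u) z.
Proof. by move=> e e0; exists 1 => // w _ _; rewrite subrr nrm0 ltW. Qed.

Lemma disc_cont_lip g z (L : R) :
  (forall w, nrm w <= 1 -> nrm (g w - g z) <= L * nrm (w - z)) -> disc_cont g z.
Proof.
move=> H e e0; pose L' := Num.max L 1.
have L0 : 0 < L' by rewrite lt_max ltr01 orbT.
exists (e / L'); first by rewrite divr_gt0.
move=> w w1 wd; apply: le_trans (H w w1) _.
apply: (@le_trans _ _ (L' * nrm (w - z))).
  by rewrite ler_wpM2r ?nrm_ge0// le_max lexx.
by rewrite mulrC -ler_pdivlMr.
Qed.

Lemma disc_cont_id z : disc_cont id z.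
Proof. by apply: (disc_cont_lip (L := 1)) => w _; rewrite mul1r. Qed.

Lemma disc_contD g h z : disc_cont g z -> disc_cont h z ->
  disc_cont (fun w => g w + h w) z.
Proof.
move=> cg ch e e0; have e20 : 0 < e / 2 by rewrite divr_gt0.
have [d1 d10 H1] := cg _ e20; have [d2 d20 H2] := ch _ e20.
exists (Num.min d1 d2); first by rewrite lt_min d10.
move=> w w1; rewrite le_min => /andP[wd1 wd2].
rewrite (_ : _ - _ = (g w - g z) + (h w - h z)); last by ring.
apply: le_trans (nrmD _ _) _; have := H1 w w1 wd1; have := H2 w w1 wd2; lra.
Qed.

Lemma disc_contM g h z : disc_cont g z -> disc_cont h z ->
  disc_cont (fun w => g w * h w) z.
Proof.
move=> cg ch e e0.
pose M := nrm (g z) + nrm (h z) + 1.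
have M0 : 0 < M by rewrite ltr_wpDl// addr_ge0 ?nrm_ge0.
have eM : 0 < Num.min 1 (e / (2 * M)).
  by rewrite lt_min ltr01 divr_gt0// mulr_gt0.
have [d1 d10 H1] := cg _ eM; have [d2 d20 H2] := ch _ eM.
exists (Num.min d1 d2); first by rewrite lt_min d10.
move=> w w1; rewrite le_min => /andP[wd1 wd2].
have := H1 w w1 wd1; rewrite le_min => /andP[g1 g2].
have := H2 w w1 wd2; rewrite le_min => /andP[h1 h2].
rewrite (_ : _ - _ = (g w - g z) * (h w - h z) + g z * (h w - h z) + (g w - g z) * h z);
  last by ring.
apply: le_trans (nrmD _ _) _; rewrite nrmM.
have := nrmD ((g w - g z) * (h w - h z)) (g z * (h w - h z)); rewrite !nrmM => Hn.
have k1 : nrm (g w - g z) * nrm (h w - h z) <= e / (2 * M) * 1.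
  by rewrite ler_pM ?nrm_ge0.
have k2 : nrm (g z) * nrm (h w - h z) <= nrm (g z) * (e / (2 * M)).
  by rewrite ler_wpM2l ?nrm_ge0.
have k3 : nrm (g w - g z) * nrm (h z) <= e / (2 * M) * nrm (h z).
  by rewrite ler_wpM2r ?nrm_ge0.
have k4 : e / (2 * M) * M = e / 2 by field; rewrite gt_eqF.
move: k4; rewrite {2}/M => k4.
lra.
Qed.

Lemma disc_contN g z : disc_cont g z -> disc_cont (fun w => - g w) z.
Proof.
move=> cg e e0; have [d d0 H] := cg e e0; exists d => // w w1 wd.
by rewrite -opprD nrmN; exact: H.
Qed.

Lemma disc_contB g h z : disc_cont g z -> disc_cont h z ->
  disc_cont (fun w => g w - h w) z.
Proof. by move=> cg /disc_contN; exact: disc_contD. Qed.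

Lemma disc_contV g z : g z != 0 -> disc_cont g z ->
  disc_cont (fun w => (g w)^-1) z.
Proof.
move=> gz cg e e0; have n0 := nrm_gt0 gz; set n := nrm (g z) in n0.
have E0 : 0 < Num.min (n / 2) (e * (n * (n / 2))).
  by rewrite lt_min divr_gt0// !mulr_gt0.
have [d d0 H] := cg _ E0; exists d => // w w1 wd.
have := H w w1 wd; rewrite le_min => /andP[h1 h2].
have gw : n / 2 <= nrm (g w).
  have := nrmB (g w) (g w - g z); rewrite (_ : g w - _ = g z); last by ring.
  by rewrite -/n; lra.
have gw0 : g w != 0.
  by apply/eqP => g0; move: gw; rewrite g0 nrm0; lra.
rewrite (_ : _ - _ = - (g w - g z) / (g z * g w)); last by field; rewrite gz gw0.
rewrite nrmM nrmN nrmV nrmM ler_pdivrMr ?mulr_gt0 ?nrm_gt0//.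
apply: (le_trans h2); rewrite ler_wpM2l ?(ltW e0)// -/n ler_wpM2l ?(ltW n0)//.
Qed.

Lemma disc_cont_ext g h z (del : R) : 0 < del -> g z = h z ->
  (forall w, nrm w <= 1 -> nrm (w - z) <= del -> g w = h w) ->
  disc_cont g z -> disc_cont h z.
Proof.
move=> d0 ez H cg e e0; have [d1 d10 H1] := cg e e0.
exists (Num.min del d1); first by rewrite lt_min d0.
move=> w w1; rewrite le_min => /andP[wd wd1].
by rewrite -H// -ez; exact: H1.
Qed.

(** Convexity: go from [z] a small fraction [t] of the way to another point [u] of the disc. This
    works on the unit circle too, so continuity within the disc determines the values at isolated
    points. *)
Lemma disc_accumulation z (del : R) : nrm z <= 1 -> 0 < del ->
  exists w, [/\ nrm w <= 1, nrm (w - z) <= del & w != z].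
Proof.
move=> z1 d0.
have [u [u1 uz]] : exists u, nrm u <= 1 /\ u != z.
  have [->|z0] := eqVneq z 0; first by exists 1; rewrite nrm1 oner_neq0.
  by exists 0; rewrite nrm0 ler01 eq_sym.
pose t := Num.min 1 (del / 2).
have t0 : 0 < t by rewrite lt_min ltr01 divr_gt0.
have t1 : t <= 1 by rewrite ge_min lexx.
have td : t <= del / 2 by rewrite ge_min lexx orbT.
exists (RtoC (1 - t) * z + RtoC t * u); split.
- apply: le_trans (nrmD _ _) _; rewrite !nrmM !nrm_RtoC.
  rewrite (ger0_norm (ltW t0)) ger0_norm ?subr_ge0//.
  have : (1 - t) * nrm z <= (1 - t) * 1 by rewrite ler_wpM2l// subr_ge0.
  have : t * nrm u <= t * 1 by rewrite ler_wpM2l// ltW.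
  lra.
- rewrite (_ : _ - z = RtoC t * (u - z)); last by rewrite RtoCB RtoC1; ring.
  rewrite nrmM nrm_RtoC (ger0_norm (ltW t0)).
  have nb : nrm (u - z) <= 2 by apply: le_trans (nrmB _ _) _; lra.
  have : t * nrm (u - z) <= del / 2 * 2 by rewrite ler_pM ?nrm_ge0// ltW.
  lra.
- rewrite -subr_eq0 (_ : _ - z = RtoC t * (u - z)); last by rewrite RtoCB RtoC1; ring.
  by apply: mulf_neq0; [rewrite RtoC_eq0 gt_eqF|rewrite subr_eq0].
Qed.

Lemma isolated (S : seq (C R)) z : exists2 del : R, 0 < del &
  forall w, nrm (w - z) <= del -> w \in S -> w = z.
Proof.
elim: S => [|a S [d d0 H]]; first by exists 1.
have [->|az] := eqVneq a z.
  by exists d => // w wd; rewrite inE => /orP[/eqP//|]; exact: H.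
have n0 : 0 < nrm (a - z) by apply: nrm_gt0; rewrite subr_eq0.
exists (Num.min d (nrm (a - z) / 2)); first by rewrite lt_min d0 divr_gt0.
move=> w; rewrite le_min => /andP[wd wa]; rewrite inE => /orP[/eqP e|]; last exact: H.
by exfalso; move: wa; rewrite e; lra.
Qed.

Lemma disc_cont_eq g h (S : seq (C R)) z : nrm z <= 1 ->
  disc_cont g z -> disc_cont h z ->
  (forall w, nrm w <= 1 -> w \notin S -> g w = h w) -> g z = h z.
Proof.
move=> z1 cg ch H.
have [del d0 iso] := isolated S z.
apply/eqP; rewrite -subr_eq0; apply/eqP/nrm_eq0/le_anti; rewrite nrm_ge0 andbT.
apply/ler_addgt0Pr => e e0; rewrite add0r.
have e20 : 0 < e / 2 by rewrite divr_gt0.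
have [d1 d10 H1] := cg _ e20; have [d2 d20 H2] := ch _ e20.
have dm : 0 < Num.min del (Num.min d1 d2) by rewrite !lt_min d0 d10.
have [w [w1 wd wz]] := disc_accumulation z1 dm.
move: wd; rewrite !le_min => /and3P[wd wd1 wd2].
have wS : w \notin S by apply/negP => /(iso w wd) e1; rewrite e1 eqxx in wz.
have := H1 w w1 wd1; have := H2 w w1 wd2; rewrite (H w w1 wS) => k1 k2.
rewrite (_ : g z - h z = (h w - h z) - (h w - g z)); last by ring.
by apply: le_trans (nrmB _ _) _; lra.
Qed.

(** A ratio is identified through a continuous [g] known beforehand. By the last hypothesis a zero
    [z] of [den] is its only zero in the disc, so the filter in [lim_ratio] is proper and [lim]
    returns the actual limit rather than a default. *)
Lemma lim_ratioE num den g z : nrm z <= 1 -> disc_cont g z ->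
  (forall w, nrm w <= 1 -> den w != 0 -> num w = g w * den w) ->
  (forall w, nrm w <= 1 -> den z = 0 -> den w = 0 -> w = z) ->
  lim_ratio num den z = g z.
Proof.
move=> z1 cg H zero; rewrite /lim_ratio; case: ifPn => [/eqP dz|dz]; last first.
  by rewrite H// mulfK.
set A := [set w : C R | `|w| <= 1 /\ den w != 0].
have PF : ProperFilter (within A (nbhs z)).
  apply: Build_ProperFilter_ex => B.
  rewrite /within/= => /nbhs_ballP[e /= e0 HB].
  have e0' : 0 < complex.Re e by move: e0; rewrite ltcE => /andP[_].
  have eE : e = RtoC (complex.Re e).
    by move: e0; rewrite ltcE => /andP[/eqP ei _]; apply: complex_ext.
  have [w [w1 wd wz]] := disc_accumulation z1 (divr_gt0 e0' (ltr0n R 2)).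
  exists w; apply: HB.
    rewrite /ball /= normE -opprB nrmN eE /RtoC ltcR.
    by apply: le_lt_trans wd _; lra.
  split; first by rewrite norm_le1.
  by apply/eqP => dw; have := zero w w1 dz dw => e1; rewrite e1 eqxx in wz.
apply/cvg_lim; first exact: norm_hausdorff.
apply/cvgrPdist_le => e e0.
have e0' : 0 < complex.Re e by move: e0; rewrite ltcE => /andP[_].
have eE : e = RtoC (complex.Re e).
  by move: e0; rewrite ltcE => /andP[/eqP ei _]; apply: complex_ext.
have [d d0 Hd] := cg _ e0'.
rewrite near_withinE; apply/nbhs_ballP; exists (RtoC d).
  by rewrite /= /RtoC ltcR.
move=> w; rewrite /ball /= normE -opprB nrmN /RtoC ltcR => wd [w1 dw].
rewrite norm_le1 in w1.
rewrite H// mulfK// normE -opprB nrmN eE /RtoC lecR.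
by apply: Hd => //; exact: ltW.
Qed.
End DiscContinuity.

(** * Arrivals during a service *)

Section ArrivalsPgf.
Context {R : realType}.
Variables (f : R -> R) (l lp : R).
Hypotheses (f_pdf : is_pdf f) (f_mean : finite_mean f) (l_gt0 : 0 < l) (lp_gt0 : 0 < lp).
Implicit Types (z w s : C R) (t : R).
Local Notation leb := (@lebesgue_measure R).
Local Notation bl := (RtoC (lst f l)).
Local Notation L := (RtoC l).
Local Notation Lp := (RtoC lp).

Definition arg_of z : C R := Lp * (1 - z).

Lemma Re_arg_of z : nrm z <= 1 -> 0 <= complex.Re (arg_of z).
Proof.
move=> z1; rewrite /arg_of Re_RtoCM cReB /= mulr_ge0 ?(ltW lp_gt0)// subr_ge0.
by apply: le_trans (ler_norm _) _; exact: le_trans (nrm_Re z) z1.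
Qed.

(* The arrival count generating function of a service, given its duration t. *)
Definition arrivals_given z t : C R :=
  cexp (- L * RtoC t) + (L * z / (L - arg_of z)) *
    (cexp (- arg_of z * RtoC t) + (-1) * cexp (- L * RtoC t)).

(** Continuous form of the ratio. With [s = arg_of z], the quotient is, up to sign, the divided
    difference of the transform between [s] and [l]; at [s = l] it becomes minus the derivative,
    [cmean f l]. *)
Definition pgf z : C R :=
  bl + L * z * (if arg_of z == L then cmean f l
                else (clst f (arg_of z) - bl) / (L - arg_of z)).

(** A first arrival occurs with probability [1 - lst f l]; the others come at rate [lp] during what
    remains of the service, of mean [mean f - (1 - lst f l) / l]. The function [weight t] below is
    the same mean for a service of length [t]. *)
Definition mean_arrivals : R := (1 - lst f l) * (1 - lp / l) + lp * mean f.

Let L0 : L != 0. Proof. by rewrite RtoC_eq0 gt_eqF. Qed.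
Let Lp0 : Lp != 0. Proof. by rewrite RtoC_eq0 gt_eqF. Qed.

Lemma cintegrable_arrivals z : nrm z <= 1 ->
  cintegrable f (arrivals_given z).
Proof.
move=> z1; have i1 := cintegrable_cexp f_pdf (Re_arg_of z1).
have i2 : cintegrable f (fun t => cexp (- L * RtoC t)).
  by apply: (cintegrable_cexp f_pdf); exact: ltW.
by apply: cintegrableD => //; apply: cintegrableM; apply: cintegrableD => //;
  exact: cintegrableM.
Qed.

Lemma cint_arrivals z : nrm z <= 1 -> arg_of z != L ->
  cint f (arrivals_given z) = pgf z.
Proof.
move=> z1 sz; have i1 := cintegrable_cexp f_pdf (Re_arg_of z1).
have i2 : cintegrable f (fun t => cexp (- L * RtoC t)).
  by apply: (cintegrable_cexp f_pdf); exact: ltW.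
rewrite /arrivals_given cintD//; last first.
  by apply: cintegrableM; apply: cintegrableD => //; exact: cintegrableM.
rewrite cintM; last by apply: cintegrableD => //; exact: cintegrableM.
rewrite cintD//; last exact: cintegrableM.
rewrite cintM// -!clstE -lst_clst /pgf (negbTE sz); congr (_ + _); ring.
Qed.

Let weight t : R := (1 - expR (- (l * t))) * (1 - lp / l) + lp * t.

Lemma weight_integrable :
  leb.-integrable `[0, +oo[ (EFin \o (fun t => weight t * f t)) /\
  \int[leb]_(t in `[0, +oo[) (weight t * f t) = mean_arrivals.
Proof.
have ie : leb.-integrable `[0, +oo[ (EFin \o (fun t => expR (- l * t) * f t)).
  have [i _] := cintegrable_cexp f_pdf (s := L) (ltW l_gt0).
  rewrite (_ : (fun t => _) = fun t => complex.Re (cexp (- L * RtoC t)) * f t)//.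
  by apply/funext => t; rewrite -RtoCN -RtoCM cexp_RtoC.
have i1 := pdf_integrable f_pdf.
have im := meanM_integrable f_mean lp.
pose k := 1 - lp / l.
have E : (fun t => weight t * f t) = fun t =>
    (k * f t + (- k) * (expR (- l * t) * f t)) + lp * t * f t.
  by apply/funext => t; rewrite /weight [- l * t]mulNr -/k; ring.
have ia : leb.-integrable `[0, +oo[ (EFin \o (fun t => k * f t + (- k) * (expR (- l * t) * f t))).
  by apply: integrableD_fun; exact: integrableM_fun.
rewrite E; split; first exact: integrableD_fun.
rewrite RintegralD// RintegralD//; [|exact: integrableM_fun..].
rewrite !RintegralZl// (RintegralM_mean f_mean) (pdf_Rintegral f_pdf) /mean_arrivals /lst -/k.
by ring.
Qed.

(* e^{lt} times the difference has derivative
   l (z e^{(l - s(z)) t} - w e^{(l - s(w)) t}). *)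
Lemma arrivals_given_lipschitz z w t : nrm z <= 1 -> nrm w <= 1 ->
  arg_of z != L -> arg_of w != L -> 0 <= t ->
  nrm (arrivals_given z t - arrivals_given w t) <= nrm (z - w) * weight t.
Proof.
move=> z1 w1 sz sw t0.
pose G u v := L * u / (L - arg_of u) * cexp (0 + RtoC v * (L - arg_of u)).
have nz u : arg_of u != L -> L - arg_of u != 0 by rewrite subr_eq0 eq_sym.
have EG u v : arg_of u != L ->
    cexp (RtoC v * L) * arrivals_given u v = 1 + G u v - G u 0.
  move=> su; rewrite /G /arrivals_given RtoC0 mul0r addr0 cexp0 add0r.
  have e1 : cexp (RtoC v * L) * cexp (- L * RtoC v) = 1.
    by rewrite -cexpD (_ : _ + _ = 0) ?cexp0//; ring.
  have e2 : cexp (RtoC v * L) * cexp (- arg_of u * RtoC v) =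
      cexp (RtoC v * (L - arg_of u)).
    by rewrite -cexpD; congr cexp; ring.
  rewrite mulrDr e1 mulrCA mulrDr e2 [cexp (RtoC v * L) * (_ * _)]mulrCA e1.
  by ring.
have dG u : arg_of u != L ->
    cderive (G u) (fun v => L * u * cexp (0 + RtoC v * (L - arg_of u))).
  move=> su; have := cderiveM (L * u / (L - arg_of u)) (cderive_cexp 0 (L - arg_of u)).
  congr cderive; apply/funext => v; rewrite mulrA; congr (_ * _).
  by rewrite mulfVK// nz.
have dD : cderive (fun v => G z v + (-1) * G w v)
   (fun v => L * z * cexp (0 + RtoC v * (L - arg_of z)) +
     (-1) * (L * w * cexp (0 + RtoC v * (L - arg_of w)))).
  by apply: cderiveD; [exact: dG|apply: cderiveM; exact: dG].
pose kap := nrm (z - w).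
(* [g v - g 0] is [kap * expR (l * v) * weight v]. In [g'], the 1 will bound the change of the
   factor [z], and [lp * v] the change of the exponential, whose exponent moves by
   [lp * v * (z - w)]. *)
pose g v := kap * (expR (0 + v * l) * (1 - lp / l) + lp * (v * expR (0 + v * l))).
pose g' v := kap * (l * expR (0 + v * l) * (1 + lp * v)).
have dg (v : R) : is_derive v 1 g (g' v).
  have de : is_derive v 1 (fun u : R => expR (0 + u * l)) (expR (0 + v * l) * l).
    by apply: is_derive1_comp; exact: derive_affine.
  have d1 := deriveMl_fun (1 - lp / l) de.
  have di : is_derive v 1 (fun u : R => u) 1 by exact: is_derive_id.
  have d2 := deriveMl_fun lp (deriveM_fun di de).
  have d3 := deriveMl_fun kap (deriveD_fun d1 d2).
  rewrite (_ : g = (fun u => kap * ((1 - lp / l) * expR (0 + u * l) + lp * (u * expR (0 + u * l)))));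
    last by apply/funext => u; rewrite /g [expR _ * (1 - _)]mulrC.
  apply: (is_derive_eq d3); rewrite /g' /=; field; rewrite gt_eqF//.
have H := mean_value_le t0 dD dg.
have key : nrm (G z t + (-1) * G w t - (G z 0 + (-1) * G w 0)) <= g t - g 0.
  apply: H => v /andP[v0 vt].
  rewrite (_ : _ + _ = L * cexp (RtoC v * L) *
     (z * cexp (- arg_of z * RtoC v) - w * cexp (- arg_of w * RtoC v))); last first.
    have e2 u : cexp (0 + RtoC v * (L - arg_of u)) =
        cexp (RtoC v * L) * cexp (- arg_of u * RtoC v).
      by rewrite -cexpD; congr cexp; ring.
    by rewrite !e2; ring.
  rewrite nrmM nrmM nrm_RtoC (gtr0_norm l_gt0) nrm_cexp Re_RtoCM /= /g' add0r.
  rewrite mulrCA ler_wpM2l ?mulr_ge0 ?expR_ge0 ?(ltW l_gt0)//.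
  rewrite (_ : _ - _ = (z - w) * cexp (- arg_of z * RtoC v) +
     w * (cexp (- arg_of z * RtoC v) - cexp (- arg_of w * RtoC v))); last by ring.
  have az : complex.Re (- arg_of z * RtoC v) <= 0.
    by apply: Re_transform_arg; [exact: Re_arg_of|exact: ltW].
  have aw : complex.Re (- arg_of w * RtoC v) <= 0.
    by apply: Re_transform_arg; [exact: Re_arg_of|exact: ltW].
  apply: le_trans (nrmD _ _) _; rewrite !nrmM mulrDr mulr1 lerD//.
    by rewrite ler_piMr ?nrm_ge0// nrm_cexp_le1.
  apply: (@le_trans _ _ (1 * nrm (cexp (- arg_of z * RtoC v) - cexp (- arg_of w * RtoC v)))).
    by rewrite ler_wpM2r ?nrm_ge0.
  rewrite mul1r; apply: le_trans (cexp_lipschitz aw az) _.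
  rewrite (_ : _ - _ = (z - w) * (Lp * RtoC v)); last by rewrite /arg_of; ring.
  by rewrite !nrmM !nrm_RtoC (gtr0_norm lp_gt0) (gtr0_norm v0).
have e0 : 0 < expR (t * l) by exact: expR_gt0.
rewrite -(ler_pM2l e0).
rewrite (_ : expR (t * l) * nrm _ =
    nrm (cexp (RtoC t * L) * (arrivals_given z t - arrivals_given w t))); last first.
  by rewrite nrmM nrm_cexp Re_RtoCM.
rewrite mulrBr !EG//.
rewrite (_ : _ - _ = G z t + (-1) * G w t - (G z 0 + (-1) * G w 0)); last by ring.
apply: le_trans key _; rewrite /g /weight mul0r !add0r expR0 -/kap mul0r mulr0 addr0.
have ee : expR (t * l) * expR (- (l * t)) = 1.
  by rewrite -expRD [t * l]mulrC subrr expR0.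
rewrite le_eqVlt; apply/orP; left; apply/eqP; transitivity (kap * ((expR (t * l) - expR (t * l) * expR (- (l * t))) * (1 - lp / l)
   + lp * (t * expR (t * l)))); first by rewrite ee; ring.
by ring.
Qed.

Lemma pgf_lipschitz_regular z w : nrm z <= 1 -> nrm w <= 1 ->
  arg_of z != L -> arg_of w != L ->
  nrm (pgf z - pgf w) <= mean_arrivals * nrm (z - w).
Proof.
move=> z1 w1 sz sw; have [iw Ew] := weight_integrable.
rewrite -!cint_arrivals// -[X in _ - X]mul1r -mulNr -cintM; last exact: cintegrable_arrivals.
rewrite -cintD; [|exact: cintegrable_arrivals|
  by apply: cintegrableM; exact: cintegrable_arrivals].
rewrite -Ew mulrC -RintegralZl//.
have -> : \int[leb]_(t in `[0, +oo[) (nrm (z - w) * (weight t * f t)) =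
    \int[leb]_(t in `[0, +oo[) (nrm (z - w) * weight t * f t).
  by apply: eq_Rintegral => t _; rewrite mulrA.
apply: (cint_norm f_pdf).
- apply: cintegrableD; first exact: cintegrable_arrivals.
  by apply: cintegrableM; exact: cintegrable_arrivals.
- rewrite (_ : (fun t => _) = fun t => nrm (z - w) * (weight t * f t)).
    exact: integrableM_fun.
  by apply/funext => t; rewrite mulrA.
- by move=> t t0; rewrite mulN1r; exact: arrivals_given_lipschitz.
Qed.

Lemma arg_of_inj z w : arg_of z = arg_of w -> z = w.
Proof.
move=> /(mulfI Lp0) e; have : 1 - (1 - z) = 1 - (1 - w) by rewrite e.
by rewrite !opprB !addrA ![1 + _]addrC !addrK.
Qed.

Lemma arg_ofB z w : arg_of z - arg_of w = - Lp * (z - w).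
Proof. by rewrite /arg_of; ring. Qed.

Lemma pgf_approx z (e : R) : nrm z <= 1 -> 0 < e ->
  exists2 del, 0 < del & forall w, nrm w <= 1 -> arg_of w != L ->
    nrm (w - z) <= del -> nrm (pgf w - pgf z) <= e.
Proof.
move=> z1 e0; have [sz|sz] := eqVneq (arg_of z) L; last first.
  have cg : disc_cont (fun w => if arg_of w == L then pgf z else pgf w) z.
    apply: (disc_cont_lip (L := mean_arrivals)) => w w1; rewrite (negbTE sz).
    case: ifPn => sw; last exact: pgf_lipschitz_regular.
    (* Where [arg_of w = L] the surrogate equals [pgf z], and the bound there only needs
       [mean_arrivals >= 0]. The Lipschitz estimate between [z] and any other regular [w'] gives
       that. *)
    have [w' [w'1 w'z]] : exists w', nrm w' <= 1 /\ arg_of w' != L /\ w' != z.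
      have [del d0 iso] := isolated [:: w] z.
      have [w' [w'1 w'd w'z]] := disc_accumulation z1 d0.
      exists w'; split => //; split => //; apply/eqP => e1.
      have : w' = z by apply: iso => //; rewrite inE; apply/eqP/arg_of_inj; rewrite e1 (eqP sw).
      by move/eqP; apply/negP.
    rewrite subrr nrm0 mulr_ge0 ?nrm_ge0//.
    case: w'z => sw' w'z.
    have n0 : 0 < nrm (w' - z) by apply: nrm_gt0; rewrite subr_eq0.
    by rewrite -(pmulr_lge0 _ n0); apply: le_trans (pgf_lipschitz_regular w'1 z1 sw' sz);
      exact: nrm_ge0.
  have [del d0 H] := cg e e0; exists del => // w w1 sw wd.
  by have := H w w1 wd; rewrite (negbTE sw) (negbTE sz).
have e1 : 0 < e / (2 * l) by rewrite divr_gt0// mulr_gt0.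
have [del d0 H] := clst_quotient f_pdf f_mean (ltW l_gt0) e1.
(* The increment of [w] times the divided difference splits by the product rule into two terms, each
   kept below [e / (2 * l)]; [N] bounds the derivative in the second one. *)
pose N := nrm (cmean f l) + 1.
have N0 : 0 < N by rewrite ltr_wpDl ?nrm_ge0.
exists (Num.min (del / lp) (e / (2 * l * N))).
  by rewrite lt_min !divr_gt0// !mulr_gt0.
move=> w w1 sw; rewrite le_min => /andP[wd1 wd2].
have := H (arg_of w) (Re_arg_of w1) sw; rewrite -{1}sz arg_ofB nrmM nrmN nrm_RtoC.
rewrite (gtr0_norm lp_gt0) mulrC -ler_pdivlMr// => /(_ wd1).
set Q := _ / _ => HQ.
rewrite /pgf sz eqxx (negbTE sw).
rewrite (_ : _ - _ = L * (w * (Q - cmean f l) + (w - z) * cmean f l)); last first.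
  rewrite /Q -lst_clst; field.
  by rewrite !subr_eq0 sw eq_sym sw.
rewrite nrmM nrm_RtoC (gtr0_norm l_gt0).
have k1 : nrm (w * (Q - cmean f l)) <= e / (2 * l).
  by rewrite nrmM; apply: le_trans HQ; rewrite ler_piMl ?nrm_ge0.
have k2 : nrm ((w - z) * cmean f l) <= e / (2 * l * N) * N.
  by rewrite nrmM ler_pM ?nrm_ge0// /N lerDl.
have k3 : e / (2 * l * N) * N = e / (2 * l) by field; rewrite !gt_eqF.
have k4 : l * (e / (2 * l) + e / (2 * l)) = e by field; rewrite gt_eqF.
rewrite -[leRHS]k4 ler_wpM2l ?(ltW l_gt0)//; apply: le_trans (nrmD _ _) _.
by rewrite lerD// -k3.
Qed.

Lemma regular_near z (e : R) : nrm z <= 1 -> 0 < e ->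
  exists w, [/\ nrm w <= 1, nrm (w - z) <= e, arg_of w != L &
    nrm (pgf w - pgf z) <= e].
Proof.
move=> z1 e0; have [sz|sz] := eqVneq (arg_of z) L; last first.
  by exists z; rewrite !subrr !nrm0 (ltW e0).
have [del d0 H] := pgf_approx z1 e0.
have m0 : 0 < Num.min e del by rewrite lt_min e0.
have [w [w1 wd wz]] := disc_accumulation z1 m0.
move: wd; rewrite le_min => /andP[we wd].
have sw : arg_of w != L.
  by apply/eqP => e1; move: wz; rewrite (arg_of_inj (_ : arg_of w = arg_of z)) ?eqxx// e1 sz.
by exists w; split => //; exact: H.
Qed.

(** The Lipschitz inequality between two distinct regular points forces the sign of its own
    constant. The point 1 is regular since [arg_of 1 = 0]; of 0 and -1, at most one can be
    exceptional. *)
Lemma mean_arrivals_ge0 : 0 <= mean_arrivals.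
Proof.
have s1 : arg_of 1 != L by rewrite /arg_of subrr mulr0 eq_sym.
have n1 : nrm (1 : C R) <= 1 by rewrite nrm1.
have [w [w1 wz sw]] : exists w, [/\ nrm w <= 1, w != 1 & arg_of w != L].
  have [e|ne] := eqVneq (arg_of 0) L; last first.
    by exists 0; rewrite nrm0 ler01 eq_sym oner_neq0.
  exists (-1); split; first by rewrite nrmN nrm1.
    by rewrite -subr_eq0 -opprD oppr_eq0 -mulr2n pnatr_eq0.
  by apply/eqP; rewrite -e => /arg_of_inj/eqP; rewrite oppr_eq0 oner_eq0.
have n0 : 0 < nrm (w - 1) by apply: nrm_gt0; rewrite subr_eq0.
rewrite -(pmulr_lge0 _ n0); apply: le_trans (pgf_lipschitz_regular w1 n1 sw s1).
exact: nrm_ge0.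
Qed.

Lemma pgf_lipschitz z w : nrm z <= 1 -> nrm w <= 1 ->
  nrm (pgf z - pgf w) <= mean_arrivals * nrm (z - w).
Proof.
move=> z1 w1; apply/ler_addgt0Pr => e e0.
have m0 := mean_arrivals_ge0.
(* Two errors [e / k] in the values, and two in the arguments multiplied by [mean_arrivals], add up
   to [e]. *)
pose k := 2 * (1 + mean_arrivals).
have k0 : 0 < k by rewrite mulr_gt0// ltr_wpDr.
have ek : 0 < e / k by rewrite divr_gt0.
have [z' [z'1 z'z sz' pz]] := regular_near z1 ek.
have [w' [w'1 w'w sw' pw]] := regular_near w1 ek.
have H := pgf_lipschitz_regular z'1 w'1 sz' sw'.
rewrite (_ : pgf z - pgf w = (pgf z' - pgf w') - (pgf z' - pgf z) + (pgf w' - pgf w));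
  last by ring.
have t1 := nrmD ((pgf z' - pgf w') - (pgf z' - pgf z)) (pgf w' - pgf w).
have t2 := nrmB (pgf z' - pgf w') (pgf z' - pgf z).
have t3 : nrm (z' - w') <= nrm (z - w) + e / k + e / k.
  rewrite (_ : z' - w' = (z - w) + (z' - z) - (w' - w)); last by ring.
  have := nrmB ((z - w) + (z' - z)) (w' - w); have := nrmD (z - w) (z' - z).
  lra.
have t4 : mean_arrivals * nrm (z' - w') <= mean_arrivals * (nrm (z - w) + e / k + e / k).
  by rewrite ler_wpM2l.
have t5 : e / k * 2 * (1 + mean_arrivals) = e.
  by rewrite -mulrA -/k divfK// gt_eqF.
lra.
Qed.

Lemma pgf_cont z : nrm z <= 1 -> disc_cont pgf z.
Proof.
by move=> z1; apply: (disc_cont_lip (L := mean_arrivals)) => w w1; exact: pgf_lipschitz.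
Qed.

Lemma pgf1 : pgf 1 = 1.
Proof.
have i1 : cintegrable f (fun t => cexp (- L * RtoC t)).
  by apply: (cintegrable_cexp f_pdf); exact: ltW.
rewrite /pgf /arg_of subrr mulr0 eq_sym (negbTE L0) subr0.
have -> : clst f 0 = 1.
  rewrite clstE (_ : (fun t => _) = fun=> 1) ?(cint_cst f_pdf)//.
  by apply/funext => t; rewrite oppr0 mul0r cexp0.
by field.
Qed.

Lemma arrivals_pgfE z : nrm z <= 1 -> arrivals_pgf f l lp z = pgf z.
Proof.
move=> z1; apply: lim_ratioE => //; first exact: pgf_cont.
- move=> w w1 dw; have sw : arg_of w != L by rewrite -subr_eq0.
  rewrite /pgf (negbTE sw) -/(arg_of w) RtoCB.
  have : L - arg_of w != 0 by rewrite subr_eq0 eq_sym.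
  set c := clst f (arg_of w); rewrite /arg_of => d0; clearbody c.
  by field.
- move=> w w1 /eqP; rewrite subr_eq0 => /eqP e1 /eqP; rewrite subr_eq0 => /eqP e2.
  by apply: arg_of_inj; rewrite /arg_of e1 e2.
Qed.

(** [l] times the transform, at [arg_of z], of the tail of the service law; at [z = 1] the tail
    integrates to the mean. *)
Definition residual z : C R :=
  if z == 1 then RtoC (l * mean f) else L * (1 - clst f (arg_of z)) / arg_of z.

Lemma clst0 : clst f 0 = 1.
Proof.
rewrite clstE (_ : (fun t => _) = fun=> 1) ?(cint_cst f_pdf)//.
by apply/funext => t; rewrite oppr0 mul0r cexp0.
Qed.

Lemma arg_of_neq0 z : z != 1 -> arg_of z != 0.
Proof. by move=> z1; rewrite mulf_neq0// subr_eq0 eq_sym. Qed.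

Lemma arg_of_cont z : disc_cont arg_of z.
Proof.
apply: (disc_cont_lip (L := lp)) => w _.
by rewrite arg_ofB nrmM nrmN nrm_RtoC gtr0_norm.
Qed.

Lemma mean_ge0 : 0 <= mean f.
Proof.
rewrite /mean; apply: Rintegral_ge0 => t /=; rewrite in_itv/= andbT => t0.
by rewrite mulr_ge0// (pdf_ge0 f_pdf).
Qed.

Lemma clst_arg_cont z : nrm z <= 1 -> disc_cont (fun w => clst f (arg_of w)) z.
Proof.
move=> z1; apply: (disc_cont_lip (L := lp * mean f)) => w w1.
apply: le_trans (clst_lipschitz f_pdf f_mean _ _) _; [exact: Re_arg_of..|].
by rewrite arg_ofB nrmM nrmN nrm_RtoC gtr0_norm// mulrAC.
Qed.

Lemma residual_cont z : nrm z <= 1 -> disc_cont residual z.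
Proof.
move=> z1; have [->|z1'] := eqVneq z 1.
  move=> e e0; have el : 0 < e / l by rewrite divr_gt0.
  have [del d0 H] := clst_quotient f_pdf f_mean (lexx 0) el.
  exists (del / lp); first by rewrite divr_gt0.
  move=> w w1 wd; rewrite /residual eqxx.
  have [_|w1'] := eqVneq w 1; first by rewrite subrr nrm0 ltW.
  have := H (arg_of w) (Re_arg_of w1) (arg_of_neq0 w1').
  rewrite RtoC0 subr0 clst0 cmean0 /arg_of nrmM nrm_RtoC (gtr0_norm lp_gt0).
  rewrite -opprB nrmN mulrC -ler_pdivlMr// => /(_ wd) Hw.
  rewrite RtoCM -mulrA -mulrBr nrmM nrm_RtoC (gtr0_norm l_gt0) mulrC -ler_pdivlMr//.
have [del d0 iso] := isolated [:: 1] z.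
apply: (disc_cont_ext d0 (g := fun w => L * (1 - clst f (arg_of w)) / arg_of w)).
- by rewrite /residual (negbTE z1').
- move=> w w1 wd; rewrite /residual; case: eqVneq => // e1.
  by move: z1'; rewrite -(iso w wd) ?e1 ?eqxx// inE.
- apply: disc_contM; last by apply: disc_contV; [exact: arg_of_neq0|exact: arg_of_cont].
  apply: disc_contM; first exact: disc_cont_cst.
  by apply: disc_contB; [exact: disc_cont_cst|exact: clst_arg_cont].
Qed.

Lemma residualE z : nrm z <= 1 ->
  lim_ratio (fun v => L * (1 - clst f (Lp * (1 - v)))) (fun v => Lp * (1 - v)) z
  = residual z.
Proof.
move=> z1; apply: lim_ratioE => //; first exact: residual_cont.
- move=> w w1 dw; rewrite /residual; case: eqVneq => [e|w1']; last first.
    by rewrite -/(arg_of w) divfK.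
  by move: dw; rewrite e subrr mulr0 eqxx.
- move=> w w1; rewrite -!/(arg_of _) => e1 e2; apply: arg_of_inj.
  by rewrite e1 e2.
Qed.

(* The factor of P14 + P15 and of P16 + P17; the value at z = 1 is the limit. *)
Definition busy_factor z : C R :=
  if z == 1 then (1 - bl - RtoC (l * mean f)) / - L
  else ((1 - pgf z) / (1 - z) - (1 - bl)) / Lp.

(** [busy_factor] is written through [pgf], already regular at [arg_of z = L], so that [z = 1] is
    its only special point. The identity is free of the denominator [arg_of z - L], and both sides
    vanish together with it. *)
Lemma busy_factorE z : nrm z <= 1 ->
  z * (1 - bl - residual z) = busy_factor z * (arg_of z - L).
Proof.
move=> z1; rewrite /busy_factor /residual; case: eqVneq => [->|z1'].
  rewrite /arg_of subrr mulr0 sub0r mul1r divfK// oppr_eq0//.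
have s0 := arg_of_neq0 z1'; have z10 : 1 - z != 0 by rewrite subr_eq0 eq_sym.
rewrite /pgf; case: eqVneq => [e|sz].
  rewrite e -lst_clst subrr mulr0 [L * _]mulrC mulfK//.
  by rewrite subrr mulr0.
have d0 : L - arg_of z != 0 by rewrite subr_eq0 eq_sym.
set c := clst f _; rewrite /arg_of in d0 s0 *.
by field; rewrite z10 Lp0 d0.
Qed.

(** Exhibits the slope [(1 - pgf z) / (1 - z)] as a continuous function, equal to [mean_arrivals] at
    1 by [slope_pgf1]. Dividing the main equation by [1 - z] relies on it. *)
Lemma slope_pgf z : z != 1 ->
  (1 - pgf z) = (1 - z) * (1 - bl + Lp * busy_factor z).
Proof.
move=> z1; have z10 : 1 - z != 0 by rewrite subr_eq0 eq_sym.
by rewrite /busy_factor (negbTE z1); field; rewrite z10 Lp0.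
Qed.

Lemma slope_pgf1 : 1 - bl + Lp * busy_factor 1 = RtoC mean_arrivals.
Proof.
rewrite /busy_factor eqxx /mean_arrivals !(RtoCD, RtoCB, RtoCM, RtoCV, RtoC1, RtoCN).
by field.
Qed.

(** Two expressions cover the disc. Near 1 the one from [busy_factorE] is used, whose denominator is
    [- L] at 1; elsewhere the one through [pgf], singular only at 1. *)
Lemma busy_factor_cont z : nrm z <= 1 -> disc_cont busy_factor z.
Proof.
move=> z1; have [e1|z1'] := eqVneq z 1.
  have s1 : arg_of 1 - L != 0 by rewrite /arg_of subrr mulr0 sub0r oppr_eq0.
  have [del d0 H] : exists2 del : R, 0 < del & forall w, nrm (w - 1) <= del ->
      arg_of w - L != 0.
    (* Within this radius of 1, [arg_of w] has modulus at most [l / 2], so it stays away from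
       [l]. *)
    have k0 : 0 < l / (2 * lp) by rewrite divr_gt0// mulr_gt0.
    exists (l / (2 * lp)) => // w wd; apply/eqP => /eqP.
    rewrite subr_eq0 => /eqP /(congr1 nrm).
    rewrite /arg_of nrmM !nrm_RtoC !gtr0_norm// -opprB nrmN => e.
    have : lp * nrm (w - 1) <= lp * (l / (2 * lp)) by rewrite ler_wpM2l// ltW.
    rewrite e (_ : lp * (l / (2 * lp)) = l / 2); last by field; rewrite gt_eqF.
    by move=> hl; move: l_gt0; lra.
  rewrite e1; apply: (disc_cont_ext d0 (g := fun w => w * (1 - bl - residual w) / (arg_of w - L))).
  - by rewrite busy_factorE ?nrm1// mulfK.
  - by move=> w w1 wd; rewrite busy_factorE// mulfK// H.
  - rewrite -e1; apply: disc_contM.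
      apply: disc_contM; first exact: disc_cont_id.
      by apply: disc_contB; [exact: disc_cont_cst|exact: residual_cont].
    apply: disc_contV; first by rewrite e1.
    by apply: disc_contB; [exact: arg_of_cont|exact: disc_cont_cst].
have [del d0 iso] := isolated [:: 1] z.
apply: (disc_cont_ext d0 (g := fun w => ((1 - pgf w) / (1 - w) - (1 - bl)) / Lp)).
- by rewrite /busy_factor (negbTE z1').
- move=> w w1 wd; rewrite /busy_factor; case: eqVneq => // e1.
  by move: z1'; rewrite -(iso w wd) ?e1 ?eqxx// inE.
- apply: disc_contM; last exact: disc_cont_cst.
  apply: disc_contB; last exact: disc_cont_cst.
  apply: disc_contM.
    by apply: disc_contB; [exact: disc_cont_cst|exact: pgf_cont].
  apply: disc_contV; first by rewrite subr_eq0 eq_sym.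
  by apply: disc_contB; [exact: disc_cont_cst|exact: disc_cont_id].
Qed.

End ArrivalsPgf.

(** * Power series with summable coefficients on the closed disc *)

Section GeneratingFunctions.
Context {R : realType}.
Implicit Types (z w l : C R) (u : nat -> C R) (p : nat -> R).

Lemma complex_pos_eq (e : C R) : 0 < e -> 0 < complex.Re e /\ e = RtoC (complex.Re e).
Proof.
rewrite ltcE => /andP[/eqP ei e0]; split; first exact: e0.
exact: complex_ext.
Qed.

Lemma cvg_nrmP u l : u n @[n --> \oo] --> l <->
  (forall e : R, 0 < e -> exists N, forall n, (N <= n)%N -> nrm (u n - l) <= e).
Proof.
split.
  move=> /cvgrPdist_le H e e0.
  have e0' : 0 < RtoC e :> C R by rewrite /RtoC ltcR.
  have [N _ HN] := H _ e0'; exists N => n Nn.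
  by have := HN n Nn; rewrite /= normE -opprB nrmN /RtoC lecR.
move=> H; apply/cvgrPdist_le => e /complex_pos_eq[e0 ->].
have [N HN] := H _ e0; exists N => // n /= Nn.
by rewrite normE -opprB nrmN /RtoC lecR; exact: HN.
Qed.

Section Series.
Variable p : nat -> R.
Hypotheses (p_ge0 : forall j, 0 <= p j)
  (p_sum : forall N, \sum_(0 <= j < N) p j <= 1).

Lemma nondecreasing_partial_sums :
  {homo (fun N => \sum_(0 <= j < N) p j) : m n / (m <= n)%N >-> m <= n}.
Proof.
move=> m n mn; rewrite [leRHS](big_cat_nat (n := m))//= lerDl.
by apply: sumr_ge0 => j _; exact: p_ge0.
Qed.

Definition total : R := limn (fun N => \sum_(0 <= j < N) p j).

Lemma total_cvg : \sum_(0 <= j < N) p j @[N --> \oo] --> total.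
Proof.
apply: nondecreasing_is_cvgn; first exact: nondecreasing_partial_sums.
by exists 1 => _ [N _ <-].
Qed.

Lemma partial_sum_le_total N : \sum_(0 <= j < N) p j <= total.
Proof.
apply: nondecreasing_cvgn_le; first exact: nondecreasing_partial_sums.
exact: total_cvg.
Qed.

Lemma part_cvg (m : nat) (q : nat -> R) : (forall j, `|q j| <= p j) ->
  exists2 v : R, \sum_(m <= j < N) q j @[N --> \oo] --> v &
    forall N, (m <= N)%N ->
      `|v - \sum_(m <= j < N) q j| <= total - \sum_(0 <= j < N) p j.
Proof.
move=> qp.
pose q' j : R := if (m <= j)%N then q j else 0.
have E N : (m <= N)%N -> \sum_(m <= j < N) q j = series q' N.
  move=> mN; rewrite /series/= (big_cat_nat (n := m) (m := 0))//=.
  have -> : \sum_(0 <= i < m) q' i = 0.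
    rewrite big_nat_cond big1// => j; rewrite leq0n andbT /= => jm.
    by rewrite /q' leqNgt jm.
  rewrite add0r.
  by apply: eq_big_nat => j /andP[mj _]; rewrite /q' mj.
have cq : cvgn (series q').
  apply: normed_cvg; apply: (series_le_cvg (v_ := p)).
  - by move=> n /=; exact: normr_ge0.
  - exact: p_ge0.
  - by move=> n /=; rewrite /q'; case: ifP => // _; rewrite normr0.
  - by apply/cvg_ex; exists total; exact: total_cvg.
exists (limn (series q')).
  apply: cvg_trans cq; apply: near_eq_cvg.
  by near=> N; rewrite /= E//; near: N; exists m.
move=> N mN; rewrite E//.
have H : `|series q' n - series q' N| @[n --> \oo] --> `|limn (series q') - series q' N|.
  by apply: cvg_norm; apply: cvgB => //; exact: cvg_cst.
apply: (cvgr_to_le H).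
  near=> n.
  have Nn : (N <= n)%N by near: n; exists N.
  rewrite /series/= (big_cat_nat (n := N) (m := 0) (p := n))//= addrAC subrr add0r.
  apply: le_trans (ler_norm_sum _ _ _) _.
  apply: (@le_trans _ _ (\sum_(N <= j < n) p j)).
    by apply: ler_sum => j _; rewrite /q'; case: ifP => // _; rewrite normr0.
  have := partial_sum_le_total n.
  by rewrite (big_cat_nat (n := N) (m := 0) (p := n))//=; lra.
Unshelve. all: by end_near. Qed.

(** The tail bound does not depend on [z], which gives continuity up to the unit circle. The factor
    2 comes from the real and imaginary parts. *)
Lemma genfun_approx m z N : nrm z <= 1 -> (m <= N)%N ->
  nrm (genfun m p z - \sum_(m <= j < N) RtoC (p j) * z ^+ j) <=
  2 * (total - \sum_(0 <= j < N) p j) /\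
  \sum_(m <= j < n) RtoC (p j) * z ^+ j @[n --> \oo] --> genfun m p z.
Proof.
move=> z1 mN.
have zj j : nrm (RtoC (p j) * z ^+ j) <= p j.
  rewrite nrmM nrm_RtoC (ger0_norm (p_ge0 j)) nrmX.
  by rewrite ler_piMr// exprn_ile1// nrm_ge0.
have [x cx Hx] := @part_cvg m (fun j => complex.Re (RtoC (p j) * z ^+ j))
  (fun j => le_trans (nrm_Re _) (zj j)).
have [y cy Hy] := @part_cvg m (fun j => complex.Im (RtoC (p j) * z ^+ j))
  (fun j => le_trans (nrm_Im _) (zj j)).
pose v : C R := (x +i* y)%C.
have near_v n : (m <= n)%N ->
    nrm (v - \sum_(m <= j < n) RtoC (p j) * z ^+ j) <=
    2 * (total - \sum_(0 <= j < n) p j).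
  move=> mn; apply: le_trans (nrm_le _) _.
  rewrite cReB cImB Re_sum Im_sum /=; have := Hx n mn; have := Hy n mn; lra.
have cv : \sum_(m <= j < n) RtoC (p j) * z ^+ j @[n --> \oo] --> v.
  apply/cvg_nrmP => e e0.
  have e20 : 0 < e / 2 by rewrite divr_gt0.
  have /cvgrPdist_le/(_ _ e20)[M _ HM] := total_cvg.
  exists (maxn m M) => n; rewrite geq_max => /andP[mn Mn].
  rewrite -opprB nrmN; apply: le_trans (near_v n mn) _.
  have := HM n Mn; rewrite /= ger0_norm ?subr_ge0 ?partial_sum_le_total//; lra.
have -> : genfun m p z = v by apply: cvg_lim => //; exact: norm_hausdorff.
by split => //; exact: near_v.
Qed.

Lemma genfun_cvg m z : nrm z <= 1 ->
  \sum_(m <= j < n) RtoC (p j) * z ^+ j @[n --> \oo] --> genfun m p z.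
Proof. by move=> z1; have [] := @genfun_approx m z m z1 (leqnn m). Qed.

Lemma disc_cont_exp z n : disc_cont (fun w => w ^+ n) z.
Proof.
elim: n => [|n IH]; first exact: disc_cont_cst.
have -> : (fun w => w ^+ n.+1) = fun w => w * w ^+ n by apply/funext => w; rewrite exprS.
by apply: disc_contM => //; exact: disc_cont_id.
Qed.

Lemma genfun_cont m z : nrm z <= 1 -> disc_cont (genfun m p) z.
Proof.
move=> z1 e e0.
(* Each of the two truncations costs at most [2 * (e / 8)], and the polynomial in between
   [e / 2]. *)
have e80 : 0 < e / 8 by rewrite divr_gt0.
have /cvgrPdist_le/(_ _ e80)[M _ HM] := total_cvg.
pose N := maxn m M.
have tailN : total - \sum_(0 <= j < N) p j <= e / 8.
  have := HM N (leq_maxr _ _).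
  by rewrite /= ger0_norm// subr_ge0 partial_sum_le_total.
have cp : disc_cont (fun w => \sum_(m <= j < N) RtoC (p j) * w ^+ j) z.
  elim: (index_iota m N) => [|j s IH].
    have -> : (fun w => \sum_(j <- [::]) RtoC (p j) * w ^+ j) = fun=> 0.
      by apply/funext => w; rewrite big_nil.
    exact: disc_cont_cst.
  have -> : (fun w => \sum_(i <- j :: s) RtoC (p i) * w ^+ i) =
      fun w => RtoC (p j) * w ^+ j + \sum_(i <- s) RtoC (p i) * w ^+ i.
    by apply/funext => w; rewrite big_cons.
  apply: disc_contD => //; apply: disc_contM; first exact: disc_cont_cst.
  exact: disc_cont_exp.
have e20 : 0 < e / 2 by rewrite divr_gt0.
have [d d0 Hd] := cp _ e20; exists d => // w w1 wd.
have mN : (m <= N)%N := leq_maxl _ _.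
have [a1 _] := genfun_approx z1 mN; have [a2 _] := genfun_approx w1 mN.
have a3 := Hd w w1 wd.
set sw := \sum_(_ <= j < _) _ in a2 a3; set sz := \sum_(_ <= j < _) _ in a1 a3.
move: (genfun m p w) (genfun m p z) sw sz a1 a2 a3 => gw gz sw sz a1 a2 a3.
rewrite (_ : gw - gz = (gw - sw) + (sw - sz) - (gz - sz)); last by ring.
have := nrmB ((gw - sw) + (sw - sz)) (gz - sz); have := nrmD (gw - sw) (sw - sz).
lra.
Qed.

Lemma genfun_drop m z : nrm z <= 1 -> (forall j, (j < m)%N -> p j = 0) ->
  genfun m p z = genfun 0 p z.
Proof.
move=> z1 pm; have c1 := @genfun_cvg m _ z1; have c2 := @genfun_cvg 0 _ z1.
apply: (cvg_unique _ c1); first exact: norm_hausdorff.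
apply: cvg_trans c2; apply: near_eq_cvg; near=> n.
have mn : (m <= n)%N by near: n; exists m.
rewrite [LHS](big_cat_nat (n := m) (m := 0))//=.
have -> : \sum_(0 <= i < m) RtoC (p i) * z ^+ i = 0.
  rewrite big_nat_cond big1// => j; rewrite leq0n andbT /= => jm.
  by rewrite pm// RtoC0 mul0r.
by rewrite add0r.
Unshelve. all: by end_near. Qed.
End Series.

Lemma genfun_shift p z : (forall j, 0 <= p j) ->
  (forall N, \sum_(0 <= j < N) p j <= 1) -> nrm z <= 1 ->
  genfun 1 p z = z * genfun 0 (fun j => p j.+1) z.
Proof.
move=> p0 ps z1.
have p0' j : 0 <= p j.+1 by [].
have ps' N : \sum_(0 <= j < N) p j.+1 <= 1.
  have := ps N.+1; rewrite big_nat_recl//=; have := p0 0%N; lra.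
have c1 := @genfun_cvg _ p0 ps 1 _ z1; have c2 := @genfun_cvg _ p0' ps' 0 _ z1.
have c3 : z * \sum_(0 <= j < n) RtoC (p j.+1) * z ^+ j @[n --> \oo] -->
    genfun 1 p z.
  apply/cvg_nrmP => e e0; have /cvg_nrmP/(_ e e0)[N HN] := c1.
  exists N => n Nn; have := HN n.+1 (leqW Nn); rewrite big_add1 /= big_distrr/=.
  congr (nrm (_ - _) <= _); apply: eq_bigr => j _.
  by rewrite exprS mulrCA.
apply: (cvg_unique _ c3); first exact: norm_hausdorff.
apply/cvg_nrmP => e e0; have /cvg_nrmP/(_ e e0)[N HN] := c2.
exists N => n Nn; rewrite -mulrBr nrmM; apply: le_trans (HN n Nn).
by rewrite ler_piMl ?nrm_ge0.
Qed.
End GeneratingFunctions.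

(** * The stationary regime and its generator *)

Section Laws.
Context {R : realType} {d : measure_display} {T : measurableType d}.
Variable P : probability T R.

Lemma std_exp_neg (X : {RV P >-> R}) : has_std_exponential_law X ->
  P (X @^-1` `]-oo, 0[) = 0%E.
Proof.
move=> ->; last exact: measurable_itv.
rewrite /exponential_prob; under eq_integral.
  move=> x; rewrite inE/= in_itv/= => x0.
  by rewrite lt0_exponential_pdf//; over.
by rewrite integral0.
Qed.

Lemma std_exp_le (X : {RV P >-> R}) (h : R) : has_std_exponential_law X ->
  0 < h -> P (X @^-1` `]-oo, h]) = (1 - expR (- h))%:E.
Proof.
move=> lX h0.
have -> : X @^-1` `]-oo, h] = X @^-1` `]-oo, 0[ `|` X @^-1` `[0, h].
  rewrite -preimage_setU; congr (_ @^-1` _); apply/seteqP; split=> x /=.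
    rewrite !in_itv/= => xh; have [x0|x0] := ltP x 0; first by left.
    by right; rewrite xh.
  by rewrite !in_itv/= => -[x0|/andP[_ ->]//]; exact: le_trans (ltW x0) (ltW h0).
rewrite measureU//; first last.
- apply/seteqP; split=> w //= -[]; rewrite !in_itv/= => x0 /andP[].
  by rewrite leNgt x0.
- exact: measurable_funPTI.
- exact: measurable_funPTI.
rewrite [X in (X + _)%E](std_exp_neg lX) add0e [LHS]lX//.
by rewrite exponential_prob_itv0c// mulN1r EFinB.
Qed.

Lemma pdf_law_neg (X : {RV P >-> R}) f : has_pdf X f ->
  P (X @^-1` `]-oo, 0[) = 0%E.
Proof.
move=> ->; last exact: measurable_itv.
rewrite (_ : _ `&` _ = set0) ?integral_set0//.
apply/seteqP; split=> x //= -[]; rewrite !in_itv/= andbT => x0.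
by rewrite leNgt x0.
Qed.

(** A density gives no rate, only that []-oo, 0]] has probability 0; continuity from above does the
    rest. *)
Lemma pdf_law_small (X : {RV P >-> R}) f (e : R) : is_pdf f -> has_pdf X f ->
  0 < e -> exists2 h0, 0 < h0 & forall h, h <= h0 ->
    fine (P (X @^-1` `]-oo, h])) <= e.
Proof.
move=> fp lX e0.
pose F n := X @^-1` `]-oo, (n.+1%:R : R)^-1].
have mF n : measurable (F n) by exact: measurable_funPTI.
have P0 : P (X @^-1` `]-oo, 0]) = 0%E.
  rewrite lX//; rewrite (_ : _ `&` _ = [set 0]) ?integral_set1//.
  apply/seteqP; split=> x /=; rewrite !in_itv/= ?andbT.
    by move=> [x0 x1]; apply/le_anti; rewrite x0.
  by move=> ->; rewrite lexx.
have FE : \bigcap_n F n = X @^-1` `]-oo, 0].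
  apply/seteqP; split=> w /=; rewrite in_itv/=; last first.
    move=> Xw n _; rewrite /F/= in_itv/=; apply: le_trans Xw _.
    by rewrite invr_ge0.
  move=> H; rewrite leNgt; apply/negP => Xw.
  have := @near_infty_natSinv_lt R (PosNum Xw).
  move=> [N _ /(_ N (leqnn N))] /=.
  have := H N Logic.I; rewrite /F /= in_itv/= => /le_lt_trans h /h.
  by rewrite ltxx.
have cv : P (F n) @[n --> \oo] --> P (\bigcap_n F n).
  apply: nonincreasing_cvg_mu => //.
  - by rewrite -ge0_fin_numE// fin_num_measure.
  - by rewrite FE; exact: measurable_funPTI.
  - move=> m n mn; apply/subsetPset => w; rewrite /F/= !in_itv/= => /le_trans; apply.
    by rewrite lef_pV2 ?posrE// ler_nat ltnS.
move: cv; rewrite FE P0 => /fine_cvgP[_ /cvgrPdist_le /(_ e e0)] [N _ /(_ N (leqnn N))].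
rewrite /= sub0r normrN ger0_norm ?fine_ge0// => H.
exists (N.+1%:R)^-1; first by rewrite invr_gt0.
move=> h hN; apply: le_trans H; apply: fine_le; rewrite ?fin_num_measure//.
- by apply: measurable_funPTI.
- apply: le_measure; rewrite ?inE//; first exact: measurable_funPTI.
  by move=> w /=; rewrite !in_itv/= => /le_trans; apply.
Qed.
End Laws.

Section Regime.
Context {R : realType} {d : measure_display} {T : measurableType d}.
Variable P : probability T R.
Variables (r : rates R) (b a : R -> R) (S0 : T -> state R)
  (xi B A : nat -> {RV P >-> R}).
Hypotheses (r_gt0 : forall k, 0 < arrival_rate r k)
  (b_pdf : is_pdf b) (a_pdf : is_pdf a)
  (xi_law : forall n, has_std_exponential_law (xi n))
  (B_law : forall n, has_pdf (B n) b)
  (A_law : forall n, has_pdf (A n) a)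
  (S0_meas : state_measurable S0)
  (S0_valid : forall w, valid_state (S0 w))
  (indep : mutually_independent S0 xi B A)
  (stat : stationary r S0 xi B A).

Local Notation xif := (fun n => xi n : T -> R).
Local Notation Bf := (fun n => B n : T -> R).
Local Notation Af := (fun n => A n : T -> R).
Local Notation St t := (state_at r S0 xif Bf Af t).

Lemma RV_measurable (Y : {RV P >-> R}) (V : set R) : measurable V ->
  measurable (Y @^-1` V).
Proof. by move=> mV; exact: measurable_funPTI. Qed.

Lemma good_pathE : good_path xif Bf Af =
  ~` (\bigcup_n (xi n @^-1` `]-oo, 0[ `|` B n @^-1` `]-oo, 0[ `|` A n @^-1` `]-oo, 0[)).
Proof.
apply/seteqP; split=> w /=.
  move=> gw [n _] /=; have [x0 b0 a0] := gw n; rewrite !in_itv/=.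
  by move=> [[]|]; rewrite ltNge ?x0 ?b0 ?a0.
move=> H n; split; rewrite leNgt; apply/negP => h; apply: H; exists n => //=;
  rewrite !in_itv/=; tauto.
Qed.

Lemma bad_path_measurable : measurable
  (\bigcup_n (xi n @^-1` `]-oo, 0[ `|` B n @^-1` `]-oo, 0[ `|` A n @^-1` `]-oo, 0[)).
Proof.
apply: bigcupT_measurable => n; apply: measurableU; last exact: RV_measurable.
by apply: measurableU; exact: RV_measurable.
Qed.

Lemma good_path_measurable : measurable (good_path xif Bf Af).
Proof. by rewrite good_pathE; exact/measurableC/bad_path_measurable. Qed.

Lemma bad_path_null : P (~` good_path xif Bf Af) = 0%E.
Proof.
rewrite good_pathE setCK; apply: measure_negligible; first exact: bad_path_measurable.
apply: negligible_bigcup => n; apply: negligibleU; first apply: negligibleU;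
  (apply/negligibleP; first exact: RV_measurable).
- exact: std_exp_neg.
- exact: (pdf_law_neg (B_law n)).
- exact: (pdf_law_neg (A_law n)).
Qed.

Lemma P_good D : measurable D -> P (D `&` good_path xif Bf Af) = P D.
Proof.
move=> mD; rewrite -[in RHS](setIT D) -(setvU (good_path xif Bf Af)) setIUr.
rewrite measureU.
- rewrite [X in (X + _)%E](_ : _ = 0%E) ?add0e//.
  apply: measure_negligible; first by apply: measurableI => //; exact/measurableC/good_path_measurable.
  apply: (negligibleS (@subIsetr _ _ _)).
  apply/negligibleP; first exact/measurableC/good_path_measurable.
  exact: bad_path_null.
- by apply: measurableI => //; exact/measurableC/good_path_measurable.
- by apply: measurableI => //; exact/good_path_measurable.
- by rewrite setIACA setICl setI0.
Qed.

Lemma clock_ge0 s x : 0 <= x -> 0 <= clock r s x.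
Proof. by move=> x0; rewrite /clock divr_ge0// ltW. Qed.

Local Notation J := (jump_state r S0 xif Bf Af).
Local Notation JT := (jump_time r S0 xif Bf Af).

Lemma jump_state_valid w n : good_path xif Bf Af w ->
  0 <= res (J n w) /\ (empty_idle (J n w) -> res (J n w) = 0).
Proof.
move=> gw; elim: n => [|n [IH1 IH2]] /=.
  by have [] := S0_valid w.
have [x0 b0 a0] := gw n.
rewrite /next_state; case: ifPn => [af|naf].
  have h : ~~ empty_idle (J n w) -> 0 <= res (J n w) - clock r (J n w) (xi n w).
    move=> /negbTE ne; move: af; rewrite /arrival_first ne/= => /ltW.
    by rewrite subr_ge0.
  move: h; rewrite /empty_idle.
  by case: (ev (J n w)) => /= h; split=> //; exact: h.
case: (ev (J n w)) => //=; case: (orb (J n w)) => //=; by split.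
Qed.

Lemma duration_ge0 w n : good_path xif Bf Af w ->
  0 <= duration r (J n w) (xi n w).
Proof.
move=> gw; have [x0 _ _] := gw n; have [r0 _] := jump_state_valid n gw.
by rewrite /duration; case: ifP => // _; exact: clock_ge0.
Qed.

Lemma jump_time_le w m n : good_path xif Bf Af w -> (m <= n)%N ->
  JT m w <= JT n w.
Proof.
move=> gw; elim: n => [|n IH]; first by rewrite leqn0 => /eqP ->.
rewrite leq_eqVlt => /orP[/eqP ->//|]; rewrite ltnS => /IH /le_trans; apply.
by rewrite /= lerDl duration_ge0.
Qed.

Lemma current_uniq w t m n : good_path xif Bf Af w ->
  current r S0 xif Bf Af t m w -> current r S0 xif Bf Af t n w -> m = n.
Proof.
move=> gw /andP[m1 m2] /andP[n1 n2].
have [mn|nm|//] := ltngtP m n.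
- have := jump_time_le gw mn; rewrite leNgt => /negP[].
  exact: le_lt_trans n1 m2.
- have := jump_time_le gw nm; rewrite leNgt => /negP[].
  exact: le_lt_trans m1 n2.
Qed.

Lemma state_inE t Q : state_in r S0 xif Bf Af t Q `&` good_path xif Bf Af =
  survives r S0 xif Bf Af t `&` St t @^-1` Q `&` good_path xif Bf Af.
Proof.
apply/seteqP; split=> w [].
- move=> [n [cn Qn]] gw; split=> //; split; first by exists n.
  have fn : first_current r S0 xif Bf Af t n w.
    split=> // m mn; apply/negP => cm.
    by have := current_uniq gw cm cn => e; rewrite e ltnn in mn.
  by rewrite /preimage/= (state_atE fn).
- move=> [[n _ cn] Qw] gw; split=> //; exists n; split=> //.
  have fn : first_current r S0 xif Bf Af t n w.
    split=> // m mn; apply/negP => cm.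
    by have := current_uniq gw cm cn => e; rewrite e ltnn in mn.
  by move: Qw; rewrite /preimage/= (state_atE fn).
Qed.

Let mxi n : measurable_fun setT (xi n : T -> R).
Proof. exact: measurable_funP. Qed.
Let mB n : measurable_fun setT (B n : T -> R).
Proof. exact: measurable_funP. Qed.
Let mA n : measurable_fun setT (A n : T -> R).
Proof. exact: measurable_funP. Qed.

Lemma X_measurable t : state_measurable (St t).
Proof. exact: state_at_measurable. Qed.

Lemma state_in_measurable t k j V : measurable V ->
  measurable (state_in r S0 xif Bf Af t (cyl k j V)).
Proof.
move=> mV; rewrite (_ : state_in _ _ _ _ _ _ _ = \bigcup_n
  ([set w | current r S0 xif Bf Af t n w] `&`
   state_of r S0 xif Bf Af t n @^-1` cyl k j V)).
  apply: bigcupT_measurable => n; apply: measurableI; first exact: current_measurable.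
  exact: state_of_measurable.
by apply/seteqP; split=> w [n]; [move=> [? ?]; exists n|move=> _ [? ?]; exists n].
Qed.

Lemma P_survives_X t k j V : 0 <= t -> measurable V ->
  P (survives r S0 xif Bf Af t `&` St t @^-1` cyl k j V) = P (S0 @^-1` cyl k j V).
Proof.
move=> t0 mV; rewrite -(stat t0)//.
rewrite -P_good; last first.
  apply: measurableI; first exact: survives_measurable.
  exact: X_measurable.
by rewrite -state_inE P_good//; exact: state_in_measurable.
Qed.

(** Stationarity excludes explosion: [state_in] requires the path to survive until [t], and its
    probabilities over all labels add up to the total mass of [S0]. *)
Lemma P_survives t : 0 <= t -> Ex P \1_(survives r S0 xif Bf Af t) = 1.
Proof.
move=> t0; rewrite -[RHS](Ex_cst P 1).
apply: (Ex_eq_labels (X_measurable t) S0_meas); [|exact: bmeas_cst|].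
  by apply: bmeas_indic; exact: survives_measurable.
move=> k j.
transitivity (Ex P \1_(survives r S0 xif Bf Af t `&` St t @^-1` cyl k j setT)).
  congr Ex; apply/funext => w; rewrite indicI/= mulrC; congr (_ * _).
  by rewrite -label_cyl preimage_setT setIT.
rewrite Ex_indic; last first.
  by apply: measurableI; [exact: survives_measurable|exact: X_measurable].
rewrite P_survives_X// -Ex_indic; last exact: S0_meas.
by congr Ex; apply/funext => w; rewrite mulr1 -label_cyl preimage_setT setIT.
Qed.

Lemma P_X t k j V : 0 <= t -> measurable V ->
  P (St t @^-1` cyl k j V) = P (S0 @^-1` cyl k j V).
Proof.
move=> t0 mV; rewrite -(P_survives_X k j t0 mV).
have ms := survives_measurable r S0_meas mxi mB mA t.
have s0 : P (~` survives r S0 xif Bf Af t) = 0%E.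
  rewrite probability_setC//.
  have := P_survives t0; rewrite Ex_indic// => h.
  rewrite -[X in (1 - X)%E]fineK ?fin_num_measure//.
  by rewrite [X in (_ - X%:E)%E]h subee.
rewrite -[in LHS](setIT (St t @^-1` _)) -(setvU (survives r S0 xif Bf Af t)) setIUr.
rewrite measureU.
- rewrite [X in (X + _)%E](_ : _ = 0%E); first by rewrite add0e setIC.
  apply: measure_negligible.
    by apply: measurableI; [exact: X_measurable|exact: measurableC].
  apply: (negligibleS (@subIsetr _ _ _)).
  by apply/negligibleP => //; exact: measurableC.
- by apply: measurableI; [exact: X_measurable|exact: measurableC].
- by apply: measurableI => //; exact: X_measurable.
- by rewrite setIACA setICl setI0.
Qed.

Lemma Ex_stationary t F : 0 <= t -> bfun F ->
  Ex P (fun w => at_state F (St t w)) = Ex P (fun w => at_state F (S0 w)).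
Proof.
move=> t0 bF; apply: Ex_same_law => //; first exact: X_measurable.
by move=> k j V mV; exact: P_X.
Qed.

Lemma Ex_good f g : bmeas f -> bmeas g ->
  (forall w, good_path xif Bf Af w -> f w <= g w) -> Ex P f <= Ex P g.
Proof.
move=> bf bg H; pose D := good_path xif Bf Af.
have mD : measurable D := good_path_measurable.
have bD : bmeas (\1_D : T -> R) by exact: bmeas_indic.
have aux f1 : bmeas f1 -> Ex P f1 = Ex P (fun w => \1_D w * f1 w).
  move=> [mf1 [M fM]]; apply/eqP; rewrite -subr_eq0 -normr_le0.
  rewrite -ExB; [|by split => //; exists M|apply: bmeasM => //; by split => //; exists M].
  apply: (@le_trans _ _ (Ex P (fun w => M * \1_(~` D) w))).
    apply: Ex_norm_le.
    - by apply: bmeasB; [split => //; exists M|apply: bmeasM => //; split => //; exists M].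
    - by apply: bmeasZ; apply: bmeas_indic; exact: measurableC.
    - move=> w; have [Dw|nDw] := pselect (D w).
        by rewrite indicE mem_set//= mul1r subrr normr0 mulr_ge0// (le_trans (normr_ge0 _) (fM w)).
      by rewrite !indicE memNset//= mul0r subr0 mem_set//= mulr1.
  rewrite ExZ; last by apply: bmeas_indic; exact: measurableC.
  rewrite Ex_indic; last exact: measurableC.
  by rewrite bad_path_null/= mulr0.
rewrite aux// [leRHS]aux//; apply: Ex_le; [exact: bmeasM|exact: bmeasM|].
move=> w; rewrite indicE; have [|] := boolP (w \in D); last by rewrite !mul0r.
by rewrite inE !mul1r; exact: H.
Qed.

(** [xi 0], [B 0] and [A 0] decide the first jump and what starts there; [xi 1], with the duration
    just started, decides whether a second jump follows before [h]. *)
Lemma indep_first_steps k j (V X0 Vb Va X1 : set R) :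
  measurable V -> measurable X0 -> measurable Vb -> measurable Va ->
  measurable X1 ->
  P (S0 @^-1` cyl k j V `&` (xi 0%N @^-1` X0 `&` B 0%N @^-1` Vb `&`
      A 0%N @^-1` Va `&` xi 1%N @^-1` X1)) =
  (P (S0 @^-1` cyl k j V) * (P (xi 0%N @^-1` X0) * P (B 0%N @^-1` Vb) *
     P (A 0%N @^-1` Va) * P (xi 1%N @^-1` X1)))%E.
Proof.
move=> mV mX0 mVb mVa mX1.
pose Vx n : set R := if n is 0%N then X0 else X1.
pose Vb' n : set R := if n is 0%N then Vb else setT.
pose Va' n : set R := if n is 0%N then Va else setT.
have := @indep 2%N k j V Vx Vb' Va' mV.
rewrite (_ : \bigcap_(n in `I_2) _ = xi 0%N @^-1` X0 `&` B 0%N @^-1` Vb `&`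
      A 0%N @^-1` Va `&` xi 1%N @^-1` X1).
  move=> -> ; last by move=> [|n]; split => //=; exact: measurableT.
  rewrite !big_ord_recl big_ord0 /=; congr (_ * _)%E.
  rewrite mule1; congr (_ * _)%E.
  rewrite [X in (_ * X * _)%E](_ : _ = 1%E); last exact: probability_setT.
  rewrite [X in (_ * X)%E](_ : _ = 1%E); last exact: probability_setT.
  by rewrite !mule1.
apply/seteqP; split=> w.
  by move=> H; have [[? ?] ?] := H 0%N isT; have [[? ?] ?] := H 1%N isT.
by move=> [[[? ?] ?] ?] [|[|n]] //= _; split.
Qed.

Lemma state_at_before_jump w t : 0 <= t -> t < duration r (S0 w) (xi 0%N w) ->
  St t w = elapse t (S0 w).
Proof.
move=> t0 td; rewrite (@state_atE _ _ _ r S0 xif Bf Af t 0%N w).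
  by rewrite /state_of /= subr0.
by split => //; rewrite /current /= t0 add0r.
Qed.

Lemma state_at_one_jump w t :
  let s1 := next_state r (S0 w) (xi 0%N w) (B 0%N w) (A 0%N w) in
  let d0 := duration r (S0 w) (xi 0%N w) in
  d0 <= t -> t < d0 + duration r s1 (xi 1%N w) ->
  St t w = elapse (t - d0) s1.
Proof.
move=> s1 d0 dt td; rewrite (@state_atE _ _ _ r S0 xif Bf Af t 1%N w).
  by rewrite /state_of /= add0r.
split; first by rewrite /current /= add0r dt.
by case=> // _; rewrite /current /= add0r -/d0 [_ < d0]ltNge dt andbF.
Qed.

(** A common bound of the rates: [c * h < xi 1] excludes a second arrival before [h], whatever the
    state after the first jump. *)
Variable c : R.
Hypothesis c_ge : forall k, arrival_rate r k <= c.

Lemma clock_gt s x h : arrival_rate r (ev s) * h < x -> h < clock r s x.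
Proof. by move=> H; rewrite /clock ltr_pdivlMr// mulrC. Qed.

Lemma clock_le s x h : x <= arrival_rate r (ev s) * h -> clock r s x <= h.
Proof. by move=> H; rewrite /clock ler_pdivrMr// mulrC. Qed.

Lemma clock_gt_max s x h : 0 <= h -> c * h < x -> h < clock r s x.
Proof.
move=> h0 H; apply: clock_gt; apply: le_lt_trans H.
by rewrite ler_wpM2r.
Qed.

Definition arrival_event k : event :=
  match k with
  | E1 => E2 | E2 => E4 | E3 => E6 | E4 | E5 => E5 | E6 | E7 => E7
  end.

Lemma duration_gt s x h : 0 <= h -> (~~ empty_idle s -> h < res s) ->
  h < clock r s x -> h < duration r s x.
Proof.
move=> h0 hr hc; rewrite /duration; case: ifP => // /negbT.
by rewrite /arrival_first negb_or => /andP[ne _]; exact: hr.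
Qed.

Lemma path_idle w h : 0 <= h -> empty_idle (S0 w) ->
  arrival_rate r (ev (S0 w)) * h < xi 0%N w -> St h w = S0 w.
Proof.
move=> h0 e0 xh; rewrite state_at_before_jump ?/elapse ?e0//.
by apply: duration_gt => //; [rewrite e0|exact: clock_gt].
Qed.

Lemma path_no_jump w h : 0 <= h -> ~~ empty_idle (S0 w) -> h < res (S0 w) ->
  arrival_rate r (ev (S0 w)) * h < xi 0%N w ->
  St h w = State (ev (S0 w)) (orb (S0 w)) (res (S0 w) - h).
Proof.
move=> h0 e0 hr xh; rewrite state_at_before_jump ?/elapse ?(negbTE e0)//.
by apply: duration_gt => //; exact: clock_gt.
Qed.

Lemma path_arrival w h : 0 <= h -> good_path xif Bf Af w ->
  (~~ empty_idle (S0 w) -> h < res (S0 w)) ->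
  xi 0%N w <= arrival_rate r (ev (S0 w)) * h ->
  c * h < xi 1%N w -> h < B 0%N w ->
  if ev (S0 w) is E1 then
    exists2 e, 0 <= e <= h & St h w = State E2 (orb (S0 w)) (B 0%N w - e)
  else St h w = State (arrival_event (ev (S0 w))) (orb (S0 w)).+1 (res (S0 w) - h).
Proof.
move=> h0 gw hr xh x1h bh.
have [x0 _ _] := gw 0%N.
have ch := clock_le xh; have c0 := clock_ge0 (S0 w) x0.
have af : arrival_first r (S0 w) (xi 0%N w).
  rewrite /arrival_first; case: (boolP (empty_idle (S0 w))) => //= ne.
  by apply: le_lt_trans ch _; exact: hr.
have d0E : duration r (S0 w) (xi 0%N w) = clock r (S0 w) (xi 0%N w).
  by rewrite /duration af.
have := @state_at_one_jump w h; rewrite d0E /next_state af.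
move: hr; rewrite /empty_idle; case E : (ev (S0 w)) => /= hr.
- move=> ->//; last first.
    apply: (@lt_le_trans _ _ (duration r (State E2 (orb (S0 w)) (B 0%N w)) (xi 1%N w))).
      by apply: duration_gt => //; exact: clock_gt_max.
    by rewrite lerDr.
  exists (h - clock r (S0 w) (xi 0%N w)) => //.
  by rewrite subr_ge0 ch gerBl.
all: move=> ->//; first by rewrite /elapse /=; congr State; lra.
all: rewrite -ltrBlDl; apply: duration_gt; rewrite ?subr_ge0//=.
all: try by move=> _; rewrite ltrD2r; exact: hr.
all: by apply: le_lt_trans (clock_gt_max _ h0 x1h); rewrite gerBl.
Qed.

Definition end_state (s : state R) (b0 a0 : R) : state R :=
  if ev s is E1 then State E3 (orb s).-1 b0
  else State E1 (orb s) (if orb s is 0%N then 0 else a0).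

Lemma path_end w h : 0 <= h -> good_path xif Bf Af w ->
  ~~ empty_idle (S0 w) -> res (S0 w) <= h ->
  arrival_rate r (ev (S0 w)) * h < xi 0%N w ->
  c * h < xi 1%N w -> h < B 0%N w -> h < A 0%N w ->
  exists2 e, 0 <= e <= h &
    St h w = elapse e (end_state (S0 w) (B 0%N w) (A 0%N w)).
Proof.
move=> h0 gw ne rh xh x1h bh ah.
have [x0 _ _] := gw 0%N.
have r0 : 0 <= res (S0 w) by have [] := S0_valid w.
have ch := clock_gt xh.
have af : arrival_first r (S0 w) (xi 0%N w) = false.
  rewrite /arrival_first (negbTE ne) /=; apply/negbTE; rewrite -leNgt.
  exact: le_trans rh (ltW ch).
have d0E : duration r (S0 w) (xi 0%N w) = res (S0 w) by rewrite /duration af.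
have := @state_at_one_jump w h; rewrite d0E.
rewrite (_ : next_state _ _ _ _ _ = end_state (S0 w) (B 0%N w) (A 0%N w)); last first.
  by rewrite /next_state af /end_state; case: (ev (S0 w)).
move=> ->//; first by exists (h - res (S0 w)) => //; rewrite subr_ge0 rh gerBl.
apply: (@lt_le_trans _ _ (duration r (end_state (S0 w) (B 0%N w) (A 0%N w)) (xi 1%N w))).
  apply: duration_gt => //; last exact: clock_gt_max.
  rewrite /end_state /empty_idle; case: (ev (S0 w)) => //=; by case: (orb (S0 w)).
by rewrite lerDr.
Qed.

Definition pr (Y : {RV P >-> R}) (V : set R) : R := fine (P (Y @^-1` V)).

Lemma pr_ge0 (Y : {RV P >-> R}) V : 0 <= pr Y V.
Proof. exact: fine_ge0. Qed.

Lemma pr_le1 (Y : {RV P >-> R}) V : measurable V -> pr Y V <= 1.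
Proof.
move=> mV; rewrite -lee_fin /pr fineK; last by rewrite fin_num_measure//; exact: RV_measurable.
by apply: probability_le1; exact: RV_measurable.
Qed.

Lemma pr_itvoy (Y : {RV P >-> R}) (x : R) :
  pr Y `]x, +oo[ = 1 - pr Y `]-oo, x].
Proof.
rewrite /pr (_ : `]x, +oo[%classic = ~` `]-oo, x]%classic); last first.
  by apply/seteqP; split=> y /=; rewrite !in_itv/= andbT ltNge => /negP.
have mI : measurable (Y @^-1` `]-oo, x]) by exact: RV_measurable.
rewrite preimage_setC [X in fine X](probability_setC _ mI).
by rewrite fineB// fin_num_measure.
Qed.

Definition first_steps (X0 Vb Va X1 : set R) : set T :=
  xi 0%N @^-1` X0 `&` B 0%N @^-1` Vb `&` A 0%N @^-1` Va `&` xi 1%N @^-1` X1.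

Lemma first_steps_measurable X0 Vb Va X1 : measurable X0 -> measurable Vb ->
  measurable Va -> measurable X1 -> measurable (first_steps X0 Vb Va X1).
Proof.
move=> m0 mb ma m1; do ![apply: measurableI => //]; exact: RV_measurable.
Qed.

Lemma Ex_first_steps F X0 Vb Va X1 : bfun F -> measurable X0 ->
  measurable Vb -> measurable Va -> measurable X1 ->
  Ex P (fun w => \1_(first_steps X0 Vb Va X1) w * at_state F (S0 w)) =
  pr (xi 0%N) X0 * pr (B 0%N) Vb * pr (A 0%N) Va * pr (xi 1%N) X1 *
  Ex P (fun w => at_state F (S0 w)).
Proof.
move=> bF m0 mb ma m1.
set q := _ * pr (xi 1%N) X1.
rewrite (@Ex_indep_event _ _ _ P S0 F (fun=> first_steps X0 Vb Va X1) (fun=> q))//.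
- by rewrite ExZ//; exact: bmeas_at_state.
- by move=> _; exact: first_steps_measurable.
- move=> _; rewrite !mulr_ge0 ?pr_ge0//=.
  by do ![rewrite mulr_ile1 ?mulr_ge0 ?pr_ge0 ?pr_le1//].
- move=> k j V mV; rewrite indep_first_steps// muleC; congr (_ * _)%E.
  by rewrite /q /pr !EFinM !fineK// fin_num_measure//; exact: RV_measurable.
Qed.

Definition end_soon (h : R) k j (x : R) : R :=
  if empty_idle (State k j (0 : R)) then 0 else \1_(`]-oo, h]) x.

Lemma bfun_end_soon h : bfun (end_soon h).
Proof.
split=> [k j|].
  rewrite /end_soon; case: (empty_idle _); first exact: measurable_cst.
  exact: measurable_indic.
exists 1 => k j x; rewrite /end_soon; case: (empty_idle _); first by rewrite normr0.
by rewrite indicE ger0_norm// lern1 leq_b1.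
Qed.

(** An empty idle server, with no phase running, gets the maximal value, so that a service ending
    with an empty orbit also raises this function. *)
Definition clipped k j (x : R) : R :=
  if empty_idle (State k j (0 : R)) then 1 else Num.max 0 (Num.min x 1).

Lemma clipped01 k j x : 0 <= clipped k j x <= 1.
Proof.
rewrite /clipped; case: (empty_idle _); first by rewrite ler01 lexx.
by rewrite le_max lexx/= ge_max ler01/= ge_min lexx orbT.
Qed.

Lemma bfun_clipped : bfun clipped.
Proof.
split=> [k j|].
  rewrite /clipped; case: (empty_idle _); first exact: measurable_cst.
  apply: measurable_maxr; first exact: measurable_cst.
  by apply: measurable_minr => //; exact: measurable_cst.
exists 1 => k j x; have /andP[c0 c1] := clipped01 k j x.
by rewrite ger0_norm.
Qed.

Lemma empty_idleE (s : state R) : empty_idle (State (ev s) (orb s) (0 : R)) = empty_idle s.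
Proof. by case: s. Qed.

Lemma indic_preim (Y : T -> R) (V : set R) w : \1_(Y @^-1` V) w = \1_V (Y w) :> R.
Proof. by rewrite !indicE. Qed.

Lemma indic_itv_le (x y : R) : x <= y -> \1_(`]-oo, y]) x = 1 :> R.
Proof. by move=> xy; rewrite indicE mem_set//= in_itv. Qed.

Lemma indic_itv_gt (x y : R) : y < x -> \1_(`]-oo, y]) x = 0 :> R.
Proof. by move=> xy; rewrite indicE memNset//= in_itv/= leNgt xy. Qed.

Lemma clip_sub (x h : R) : 0 <= h ->
  Num.max 0 (Num.min x 1) - h <= Num.max 0 (Num.min (x - h) 1).
Proof.
move=> h0; rewrite lerBlDr ge_max addr_ge0 ?le_max ?lexx//=.
rewrite -lerBlDr le_max; apply/orP; right; rewrite le_min lerD2r ge_min lexx/=.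
by rewrite lerBlDr ge_min lerDl h0 orbT.
Qed.

(** The flow costs at most [h]. An early arrival may cost the whole range 1 and is charged to the
    indicator. A phase that ends by [h] starts from a value at most [h] and, on [first_steps],
    leaves one at least [del - h], which is the gain [del - 2 * h]. *)
Lemma clipped_path w h del : good_path xif Bf Af w -> 0 <= h -> 2 * h <= del ->
  del <= 1 ->
  at_state clipped (S0 w) - h - \1_(`]-oo, c * h]) (xi 0%N w)
  + (del - 2 * h) * (\1_(first_steps `]c * h, +oo[ `]del, +oo[ `]del, +oo[
       `]c * h, +oo[) w * at_state (end_soon h) (S0 w))
  <= at_state clipped (St h w).
Proof.
move=> gw h0 hd d1.
have [x0h|x0h] := leP (xi 0%N w) (c * h).
  rewrite (indic_itv_le x0h) indicE memNset; last first.
    by move=> [[[]]]; rewrite /= in_itv/= ltNge x0h.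
  rewrite mul0r mulr0 addr0.
  have /andP[s0 s1] := clipped01 (ev (St h w)) (orb (St h w)) (res (St h w)).
  have /andP[t0 t1] := clipped01 (ev (S0 w)) (orb (S0 w)) (res (S0 w)).
  rewrite /at_state; lra.
rewrite (indic_itv_gt x0h) subr0.
have x0h' : arrival_rate r (ev (S0 w)) * h < xi 0%N w.
  by apply: le_lt_trans x0h; rewrite ler_wpM2r.
have [e|ne] := boolP (empty_idle (S0 w)).
  rewrite path_idle// /at_state /end_soon empty_idleE e mulr0 mulr0 addr0.
  by rewrite gerBl.
have [rh|rh] := ltP h (res (S0 w)).
  rewrite path_no_jump// /at_state /end_soon /clipped /= empty_idleE (negbTE ne).
  by rewrite indic_itv_gt// !mulr0 addr0 clip_sub.
have cS : at_state clipped (S0 w) <= h.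
  rewrite /at_state /clipped empty_idleE (negbTE ne) ge_max h0/=.
  by rewrite ge_min rh.
have /andP[s0 s1] := clipped01 (ev (St h w)) (orb (St h w)) (res (St h w)).
have [fs|nfs] := pselect (first_steps `]c * h, +oo[ `]del, +oo[ `]del, +oo[
       `]c * h, +oo[ w); last first.
  by rewrite indicE memNset// mul0r mulr0 addr0 {2}/at_state; lra.
rewrite indicE mem_set// mul1r.
move: (fs) => [[[]]]; rewrite /= !in_itv/= !andbT => _ bd ad x1.
have hdel : h <= del by lra.
have [||e0 /andP[e00 e0h] ->] := path_end h0 gw ne rh x0h' x1.
- exact: le_lt_trans bd.
- exact: le_lt_trans ad.
rewrite {2}/at_state /end_soon empty_idleE (negbTE ne) indic_itv_le//.
suff : del - h <= at_state clipped (elapse e0 (end_state (S0 w) (B 0%N w) (A 0%N w))).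
  by move: cS; rewrite mulr1; lra.
rewrite /end_state /at_state /elapse /empty_idle /clipped.
case: (ev (S0 w)) => /=; (case: (orb (S0 w)) => [|j] /=);
  rewrite ?le_max ?le_min; try (apply/orP; right; apply/andP; split); lra.
Qed.

Lemma pr_xi_le n h : 0 < h -> pr (xi n) `]-oo, h] = 1 - expR (- h).
Proof. by move=> h0; rewrite /pr std_exp_le. Qed.

Lemma pr_xi_le_lin n h : 0 < h -> pr (xi n) `]-oo, h] <= h.
Proof.
move=> h0; rewrite pr_xi_le//; have := expR_ge1Dx (- h); lra.
Qed.

Lemma c_gt0 : 0 < c.
Proof. exact: lt_le_trans (r_gt0 E1) (c_ge E1). Qed.

(* A phase that ends before h is followed, with probability bounded below, by
   one that raises the clipped residual time by del - 2h; otherwise clipped loses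
   at most h. Its mean being constant, phases end before h with probability O(h). *)
Lemma end_soon_bound : exists C h1, [/\ 0 < h1, 0 <= C &
  forall h, 0 < h <= h1 ->
    Ex P (fun w => at_state (end_soon h) (S0 w)) <= C * h].
Proof.
have half0 : 0 < 2^-1 :> R by rewrite invr_gt0.
have [db db0 Hb] := pdf_law_small b_pdf (B_law 0%N) half0.
have [da da0 Ha] := pdf_law_small a_pdf (A_law 0%N) half0.
pose del := Num.min 1 (Num.min db da).
have del0 : 0 < del by rewrite /del !lt_min ltr01 db0 da0.
have del1 : del <= 1 by rewrite /del ge_min lexx.
have deldb : del <= db by rewrite /del !ge_min lexx orbT.
have delda : del <= da by rewrite /del !ge_min lexx !orbT.
have cgt0 := c_gt0.
(* The four factors of [q] are at least 1/2, and [h <= del / 4] gives [del - 2 * h >= del / 2].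
   Together [del / 32 * p <= (1 + c) * h]. *)
exists (32 / del * (1 + c)), (Num.min (del / 4) (c^-1 / 2)); split.
- by rewrite lt_min !divr_gt0// invr_gt0.
- by rewrite mulr_ge0 ?divr_ge0// ?ltW// addr_gt0.
move=> h /andP[h0]; rewrite le_min => /andP[hd hc].
have ch : c * h <= 2^-1 by rewrite mulrC -ler_pdivlMr// mulrC.
have ch0 : 0 < c * h by rewrite mulr_gt0.
set p := Ex P _.
have p0 : 0 <= p.
  apply: Ex_ge0 => w; rewrite /at_state /end_soon; case: (empty_idle _) => //.
set q := pr (xi 0%N) `]c * h, +oo[ * pr (B 0%N) `]del, +oo[ *
  pr (A 0%N) `]del, +oo[ * pr (xi 1%N) `]c * h, +oo[.
have Hq : 16^-1 <= q.
  have h1 : 2^-1 <= pr (xi 0%N) `]c * h, +oo[.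
    rewrite pr_itvoy; have := pr_xi_le_lin 0 ch0; lra.
  have h2 : 2^-1 <= pr (xi 1%N) `]c * h, +oo[.
    rewrite pr_itvoy; have := pr_xi_le_lin 1 ch0; lra.
  have h3 : 2^-1 <= pr (B 0%N) `]del, +oo[.
    rewrite pr_itvoy; have := Hb _ deldb; rewrite -/(pr _ _); lra.
  have h4 : 2^-1 <= pr (A 0%N) `]del, +oo[.
    rewrite pr_itvoy; have := Ha _ delda; rewrite -/(pr _ _); lra.
  rewrite (_ : 16^-1 = 2^-1 * 2^-1 * 2^-1 * 2^-1); last by field.
  by rewrite /q !ler_pM// ?mulr_ge0.
have mfs : measurable (first_steps `]c * h, +oo[ `]del, +oo[ `]del, +oo[ `]c * h, +oo[).
  exact: first_steps_measurable.
have key : - h - c * h + (del - 2 * h) * (q * p) <= 0.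
  have bc := bmeas_at_state S0_meas bfun_clipped.
  have bi : bmeas (fun w => \1_(`]-oo, c * h]) (xi 0%N w) : R).
    under eq_fun do rewrite -(indic_preim (xi 0%N)).
    by apply: bmeas_indic; exact: RV_measurable.
  have be := bmeas_at_state S0_meas (bfun_end_soon h).
  have bf := bmeas_indic (R := R) mfs.
  have bprod := bmeasM bf be.
  have bZ := bmeasZ (del - 2 * h) bprod.
  have bch : bmeas (fun w => at_state clipped (S0 w) - h).
    by apply: bmeasB => //; exact: bmeas_cst.
  have H1 := @Ex_good _ _ (bmeasD (bmeasB bch bi) bZ) (bmeas_at_state (X_measurable h) bfun_clipped)
    (fun w gw => @clipped_path w h del gw (ltW h0) _ del1).
  have {}H1 := H1 ltac:(lra).
  move: H1; rewrite ExD//; last exact: bmeasB.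
  rewrite ExB// ExB//; last exact: bmeas_cst.
  rewrite Ex_cst ExZ// (Ex_first_steps (bfun_end_soon h))//.
  rewrite (Ex_stationary (ltW h0) bfun_clipped) -/p -/q.
  have -> : Ex P (fun w => \1_(`]-oo, c * h]) (xi 0%N w)) = pr (xi 0%N) `]-oo, c * h].
    rewrite /pr -Ex_indic; last exact: RV_measurable.
    by congr Ex; apply/funext => w; rewrite indic_preim.
  have := pr_xi_le_lin 0 ch0; lra.
have h2 : del / 2 * (16^-1 * p) <= (del - 2 * h) * (q * p).
  apply: ler_pM; rewrite ?mulr_ge0 ?divr_ge0//; [exact: ltW|lra|].
  by rewrite ler_wpM2r.
have h3 : del / 32 * p <= h * (1 + c).
  by move: key h2; set x := _ * (q * p); move=> k1 k2; lra.
rewrite -[leRHS]mulrA [(1 + c) * h]mulrC mulrAC ler_pdivlMr//.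
by move: h3; lra.
Qed.

Lemma first_steps_indic X0 Vb Va X1 w :
  \1_(first_steps X0 Vb Va X1) w = \1_X0 (xi 0%N w) * \1_Vb (B 0%N w) *
    \1_Va (A 0%N w) * \1_X1 (xi 1%N w) :> R.
Proof. by rewrite /first_steps !indicI /= !indic_preim. Qed.

Lemma indic_setT (x : R) : \1_(setT : set R) x = 1 :> R.
Proof. by rewrite indicT. Qed.

Lemma indic_set0 (x : R) : \1_(set0 : set R) x = 0 :> R.
Proof. by rewrite indic0. Qed.

(** * First-order expansion of a test function along the path *)

Section Dynkin.
Variables (F F' : event -> nat -> R -> R) (M : R).
Hypotheses (mF : forall k j, measurable_fun setT (F k j))
  (mF' : forall k j, measurable_fun setT (F' k j))
  (FM : forall k j x, `|F k j x| <= M) (F'M : forall k j x, `|F' k j x| <= M)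
  (taylor : forall k j x h, 0 <= h -> h <= x ->
    `|F k j (x - h) - F k j x + h * F' k j x| <= M * h ^+ 2).
Hypotheses
  (service_end0 : forall k, k <> E1 -> F k 0%N 0 = F E1 0%N 0)
  (service_endS : forall k j, k <> E1 ->
    F k j.+1 0 =
    \int[@lebesgue_measure R]_(t in `[0, +oo[) (F E1 j.+1 t * a t))
  (seeking_end : forall j,
    F E1 j.+1 0 = \int[@lebesgue_measure R]_(t in `[0, +oo[) (F E3 j t * b t)).

Definition after_arrival k j (x : R) : R :=
  if k is E1 then \int[@lebesgue_measure R]_(t in `[0, +oo[) (F E2 j t * b t)
  else F (arrival_event k) j.+1 x.

Definition drift k j (x : R) : R :=
  if empty_idle (State k j (0 : R)) then 0 else F' k j x.

(** Endings of phases contribute no jump term, because of [service_end0], [service_endS] and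
    [seeking_end]. The residual time decreases at unit speed, hence the minus sign. *)
Definition generator k j (x : R) : R :=
  - drift k j x + arrival_rate r k * (after_arrival k j x - F k j x).

Lemma M_ge0 : 0 <= M.
Proof. by apply: le_trans (FM E1 0%N 0); exact: normr_ge0. Qed.

Lemma lipschitz k j x h : 0 <= h -> h <= 1 -> h <= x ->
  `|F k j (x - h) - F k j x| <= 2 * M * h.
Proof.
move=> h0 h1 hx.
rewrite -[X in `|X|](addrK (h * F' k j x)).
apply: le_trans (ler_normB _ _) _; rewrite normrM (ger0_norm h0).
have := taylor k j h0 hx; have := ler_wpM2l h0 (F'M k j x).
have : M * h ^+ 2 <= M * h by rewrite ler_wpM2l ?M_ge0// expr2 ler_piMl.
lra.
Qed.

Variable h : R.

(** The effect of an early arrival is split in two. With the server idle it starts a service, and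
    the new value depends on the random [B 0] ([U_arr], [psi_arr]); during a service it is
    determined by the state ([F_arr]). *)
Definition E_arr k : set T := xi 0%N @^-1` `]-oo, arrival_rate r k * h].
Definition U_arr (k : event) (j : nat) : set R := if k is E1 then setT else set0.
Definition psi_arr (k : event) j (x : R) : R := F E2 j x.
Definition F_arr k j (x : R) : R :=
  if k is E1 then - F E1 j x else F (arrival_event k) j.+1 x - F k j x.
Definition U_seek (k : event) (j : nat) : set R :=
  match k, j with E1, _.+1 => `]-oo, h] | _, _ => set0 end.
(** Subtracting the value at residual time 0 centres the term: by [seeking_end] its mean over the
    new service is 0, and likewise for [psi_serv] by [service_endS]. Endings of phases, although of
    probability of order [h], thus leave no first-order contribution. *)
Definition psi_seek (k : event) j (x : R) : R := F E3 j.-1 x - F E1 j 0.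
Definition U_serv (k : event) (j : nat) : set R :=
  match k, j with E1, _ => set0 | _, 0%N => set0 | _, _ => `]-oo, h] end.
Definition psi_serv (k : event) j (x : R) : R := F E1 j x - F k j 0.

(* First order part of F(S_h) - F(s): i tells whether an arrival occurs before
   h, and b0, a0 are the durations of the phases that may start. *)
Definition main_of (i : R) (s : state R) (b0 a0 : R) : R :=
  i * (\1_(U_arr (ev s) (orb s)) (res s) * psi_arr (ev s) (orb s) b0) +
  i * at_state F_arr s +
  \1_(U_seek (ev s) (orb s)) (res s) * psi_seek (ev s) (orb s) b0 +
  \1_(U_serv (ev s) (orb s)) (res s) * psi_serv (ev s) (orb s) a0 -
  h * at_state drift s.

Definition main_term w : R :=
  main_of (\1_(E_arr (ev (S0 w))) w) (S0 w) (B 0%N w) (A 0%N w).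

Lemma main_of_idle s b0 a0 : empty_idle s -> main_of 0 s b0 a0 = 0.
Proof.
case: s => [[] [|j] x] //= _; rewrite /main_of /at_state /drift /= !indic_set0.
by rewrite !mul0r mulr0 !addr0 subr0.
Qed.

Lemma main_of_flow s b0 a0 : h < res s -> ~~ empty_idle s ->
  main_of 0 s b0 a0 = - (h * F' (ev s) (orb s) (res s)).
Proof.
case: s => [[] [|j] x] //= hx _; rewrite /main_of /at_state /drift /=
  ?indic_set0 ?(indic_itv_gt hx) !mul0r !addr0 add0r//.
Qed.

Lemma main_of_arrival s b0 a0 : (~~ empty_idle s -> h < res s) ->
  main_of 1 s b0 a0 =
  (if ev s is E1 then F E2 (orb s) b0 else F (arrival_event (ev s)) (orb s).+1 (res s))
  - at_state F s - h * at_state drift s.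
Proof.
by case: s => [[] [|j] x] //= hx; rewrite /main_of /at_state /drift /F_arr /psi_arr /=
  ?indic_set0 ?indic_setT ?(indic_itv_gt (hx _))// ?mul0r ?mul1r ?mulr0 ?addr0 ?add0r ?subr0.
Qed.

Lemma main_of_end s b0 a0 : res s <= h -> ~~ empty_idle s ->
  main_of 0 s b0 a0 =
  at_state F (end_state s b0 a0) - F (ev s) (orb s) 0
  - h * F' (ev s) (orb s) (res s).
Proof.
by case: s => [[] [|j] x] //= hx _; rewrite /main_of /at_state /drift /F_arr
  /end_state /psi_seek /psi_serv /=
  ?indic_set0 ?indic_setT ?(indic_itv_le hx)// ?mul0r ?mul1r ?mulr0 ?addr0 ?add0r ?subr0
  ?service_end0// subrr add0r.
Qed.

Let ix0 w : R := \1_(`]-oo, c * h]) (xi 0%N w).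
Let ix1 w : R := \1_(`]-oo, c * h]) (xi 1%N w).
Let ib w : R := \1_(`]-oo, h]) (B 0%N w).
Let ia w : R := \1_(`]-oo, h]) (A 0%N w).
Let is0 w : R := at_state (end_soon h) (S0 w).

(* Dominates the paths on which two of the events of main_of happen before h. *)
Definition error_term w : R :=
  h ^+ 2 + h * ix0 w + h * is0 w + ix0 w * is0 w
  + (ix0 w + is0 w) * (ix1 w + ib w + ia w).

Lemma indic01 (V : set R) x : \1_V x = 0 :> R \/ \1_V x = 1 :> R.
Proof. by rewrite indicE; case: (x \in V); [right|left]. Qed.

Lemma norm_indicM (V : set R) (x y : R) : `|\1_V x * y| <= `|y|.
Proof. by have [->|->] := indic01 V x; rewrite ?mul0r ?mul1r ?normr0. Qed.

Lemma main_term_bound w : 0 <= h -> h <= 1 -> `|main_term w| <= 7 * M.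
Proof.
move=> h0 h1; have M0 := M_ge0.
have b2 k j x k' j' x' : `|F k j x - F k' j' x'| <= 2 * M.
  apply: le_trans (ler_normB _ _) _; have := FM k j x; have := FM k' j' x'; lra.
have hF' : `|h * at_state drift (S0 w)| <= M.
  rewrite /at_state /drift normrM (ger0_norm h0); case: (empty_idle _).
    by rewrite normr0 mulr0.
  by apply: le_trans (F'M (ev (S0 w)) (orb (S0 w)) (res (S0 w))); rewrite ler_piMl.
have h3 : `|\1_(U_seek (ev (S0 w)) (orb (S0 w))) (res (S0 w)) *
    psi_seek (ev (S0 w)) (orb (S0 w)) (B 0%N w)| <= 2 * M.
  by apply: le_trans (norm_indicM _ _ _) _; exact: b2.
have h4 : `|\1_(U_serv (ev (S0 w)) (orb (S0 w))) (res (S0 w)) *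
    psi_serv (ev (S0 w)) (orb (S0 w)) (A 0%N w)| <= 2 * M.
  by apply: le_trans (norm_indicM _ _ _) _; exact: b2.
have h12 : `|\1_(E_arr (ev (S0 w))) w * (\1_(U_arr (ev (S0 w)) (orb (S0 w))) (res (S0 w)) *
    psi_arr (ev (S0 w)) (orb (S0 w)) (B 0%N w)) +
  \1_(E_arr (ev (S0 w))) w * at_state F_arr (S0 w)| <= 2 * M.
  rewrite -mulrDr /E_arr indic_preim; apply: le_trans (norm_indicM _ _ _) _.
  rewrite /at_state /U_arr /F_arr /psi_arr.
  by case: (ev (S0 w)); rewrite ?indic_setT ?indic_set0 ?mul1r ?mul0r ?add0r; exact: b2.
rewrite /main_term /main_of.
apply: le_trans (ler_normB _ _) _.
have := ler_normD (\1_(E_arr (ev (S0 w))) w * (\1_(U_arr (ev (S0 w)) (orb (S0 w))) (res (S0 w)) *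
    psi_arr (ev (S0 w)) (orb (S0 w)) (B 0%N w)) +
  \1_(E_arr (ev (S0 w))) w * at_state F_arr (S0 w) +
  \1_(U_seek (ev (S0 w)) (orb (S0 w))) (res (S0 w)) *
    psi_seek (ev (S0 w)) (orb (S0 w)) (B 0%N w))
  (\1_(U_serv (ev (S0 w)) (orb (S0 w))) (res (S0 w)) *
    psi_serv (ev (S0 w)) (orb (S0 w)) (A 0%N w)).
have := ler_normD (\1_(E_arr (ev (S0 w))) w * (\1_(U_arr (ev (S0 w)) (orb (S0 w))) (res (S0 w)) *
    psi_arr (ev (S0 w)) (orb (S0 w)) (B 0%N w)) +
  \1_(E_arr (ev (S0 w))) w * at_state F_arr (S0 w))
  (\1_(U_seek (ev (S0 w)) (orb (S0 w))) (res (S0 w)) *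
    psi_seek (ev (S0 w)) (orb (S0 w)) (B 0%N w)).
lra.
Qed.

(** With no event before [h] the error is at most the Taylor remainder [M * h ^ 2]. With one event,
    residual times are displaced by at most [h], and the error is of order [h] times its indicator.
    With two, the trivial bound is charged to the product of their indicators. The factor 10 covers
    all cases. *)
Lemma path_estimate w : good_path xif Bf Af w -> 0 <= h -> h <= 1 ->
  `|at_state F (St h w) - at_state F (S0 w) - main_term w| <= 10 * M * error_term w.
Proof.
move=> gw h0 h1; have M0 := M_ge0.
have mt := main_term_bound w h0 h1.
(* [7 * M] for the main term and [M] for each of the two values of [F]. *)
have triv : `|at_state F (St h w) - at_state F (S0 w) - main_term w| <= 9 * M.
  apply: le_trans (ler_normB _ _) _; have := ler_normB (at_state F (St h w)) (at_state F (S0 w)).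
  have := FM (ev (St h w)) (orb (St h w)) (res (St h w)).
  have := FM (ev (S0 w)) (orb (S0 w)) (res (S0 w)).
  by rewrite /at_state; lra.
have i01 : ix0 w = 0 \/ ix0 w = 1 by exact: indic01.
have l01 : ix1 w = 0 \/ ix1 w = 1 by exact: indic01.
have m01 : ib w = 0 \/ ib w = 1 by exact: indic01.
have n01 : ia w = 0 \/ ia w = 1 by exact: indic01.
have j01 : is0 w = 0 \/ is0 w = 1.
  rewrite /is0 /at_state /end_soon; case: (empty_idle _); first by left.
  exact: indic01.
have i0 : 0 <= ix0 w by case: i01 => ->.
have j0 : 0 <= is0 w by case: j01 => ->.
have l0 : 0 <= ix1 w by case: l01 => ->.
have m0 : 0 <= ib w by case: m01 => ->.
have n0 : 0 <= ia w by case: n01 => ->.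
have q0 : 0 <= ix0 w * is0 w by rewrite mulr_ge0.
have q1 : 0 <= (ix0 w + is0 w) * (ix1 w + ib w + ia w) by rewrite mulr_ge0 ?addr_ge0.
have q2 : 0 <= h ^+ 2 by rewrite exprn_ge0.
have q3 : 0 <= h * ix0 w by rewrite mulr_ge0.
have q4 : 0 <= h * is0 w by rewrite mulr_ge0.
have two : 1 <= ix0 w * is0 w \/ 1 <= (ix0 w + is0 w) * (ix1 w + ib w + ia w) ->
    `|at_state F (St h w) - at_state F (S0 w) - main_term w| <= 10 * M * error_term w.
  move=> H; apply: (le_trans triv).
  apply: (@le_trans _ _ (10 * M * 1)); first lra.
  by rewrite ler_wpM2l ?mulr_ge0// /error_term; case: H => H; lra.
have small y : `|at_state F (St h w) - at_state F (S0 w) - main_term w| <= M * y ->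
    y <= 10 * (h ^+ 2 + h * ix0 w + h * is0 w) ->
    `|at_state F (St h w) - at_state F (S0 w) - main_term w| <= 10 * M * error_term w.
  move=> H1 H2; apply: (le_trans H1); rewrite -mulrA mulrCA ler_wpM2l//.
  by apply: (le_trans H2); rewrite ler_wpM2l// /error_term; lra.
have [x0h|x0h] := leP (xi 0%N w) (arrival_rate r (ev (S0 w)) * h).
  have e1 : ix0 w = 1.
    by apply: indic_itv_le; apply: le_trans x0h _; rewrite ler_wpM2r.
  case: j01 => ej; last by apply: two; left; rewrite e1 ej mulr1.
  have [x1h|x1h] := leP (xi 1%N w) (c * h).
    apply: two; right; rewrite ej e1 [ix1 w]indic_itv_le//; lra.
  have [bh|bh] := leP (B 0%N w) h.
    apply: two; right; rewrite ej e1 [ib w]indic_itv_le//; lra.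
  have hr : ~~ empty_idle (S0 w) -> h < res (S0 w).
    move=> /negbTE ne; rewrite ltNge; apply/negP => rh.
    move: ej; rewrite /is0 /at_state /end_soon empty_idleE ne indic_itv_le//.
    by move/eqP; rewrite oner_eq0.
  (* [2 * M * h] for the displaced residual time and [M * h] for the drift. *)
  apply: (small (3 * h)); last by rewrite e1 ej; lra.
  rewrite /main_term /E_arr indic_preim (indic_itv_le x0h) main_of_arrival//.
  have hd : `|h * at_state drift (S0 w)| <= M * h.
    rewrite normrM (ger0_norm h0) mulrC ler_wpM2r// /at_state /drift.
    by case: (empty_idle _); rewrite ?normr0.
  suff hl : `|at_state F (St h w) -
      (if ev (S0 w) is E1 then F E2 (orb (S0 w)) (B 0%N w)
       else F (arrival_event (ev (S0 w))) (orb (S0 w)).+1 (res (S0 w)))| <= 2 * M * h.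
    move: hl hd; set y := (if _ is E1 then _ else _); set u := _ * at_state _ _.
    rewrite !ler_norml => /andP[? ?] /andP[? ?]; apply/andP; split; lra.
  have := path_arrival h0 gw hr x0h x1h bh.
  move: hr; rewrite /empty_idle; case E : (ev (S0 w)) => /= hr.
    move=> [e /andP[e0 eh] ->]; rewrite /at_state /=.
    apply: le_trans (lipschitz _ _ _ _ _) _ => //; try lra.
    by rewrite ler_wpM2l// mulr_ge0.
  1-6: move=> ->; rewrite /at_state /=; apply: lipschitz => //; exact/ltW/hr.
have e0 : \1_(E_arr (ev (S0 w))) w = 0 :> R.
  by rewrite /E_arr indic_preim; exact: indic_itv_gt.
rewrite /main_term e0.
have [e|ne] := boolP (empty_idle (S0 w)).
  rewrite main_of_idle// path_idle// subrr subr0 normr0 !mulr_ge0//.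
  by rewrite /error_term; lra.
have [rh|rh] := ltP h (res (S0 w)).
  move: small; rewrite /main_term e0 => small; apply: (small (h ^+ 2)); last by lra.
  rewrite main_of_flow// path_no_jump// /at_state /= opprK; apply: taylor => //; exact: ltW.
have ej : is0 w = 1.
  by rewrite /is0 /at_state /end_soon empty_idleE (negbTE ne) indic_itv_le.
move: small two; rewrite /main_term e0 => small two.
have q5 : 0 <= ix0 w * ix1 w by rewrite mulr_ge0.
have q6 : 0 <= ix0 w * ib w by rewrite mulr_ge0.
have q7 : 0 <= ix0 w * ia w by rewrite mulr_ge0.
have [x1h|x1h] := leP (xi 1%N w) (c * h).
  apply: two; right; rewrite ej [ix1 w]indic_itv_le//; lra.
have [bh|bh] := leP (B 0%N w) h.
  apply: two; right; rewrite ej [ib w]indic_itv_le//; lra.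
have [ah|ah] := leP (A 0%N w) h.
  apply: two; right; rewrite ej [ia w]indic_itv_le//; lra.
(* [2 * M * h] for the flow before the end of the phase, as much for the flow after it, and [M * h]
   for the drift. *)
apply: (small (5 * h)); last by rewrite ej; lra.
rewrite main_of_end//.
have [e /andP[e00 eh] ->] := path_end h0 gw ne rh x0h x1h bh ah.
have r0 : 0 <= res (S0 w) by have [] := S0_valid w.
have hd : `|h * F' (ev (S0 w)) (orb (S0 w)) (res (S0 w))| <= M * h.
  by rewrite normrM (ger0_norm h0) mulrC ler_wpM2r.
have hl : `|F (ev (S0 w)) (orb (S0 w)) 0 - F (ev (S0 w)) (orb (S0 w)) (res (S0 w))| <= 2 * M * h.
  rewrite -{1}(subrr (res (S0 w))); apply: le_trans (lipschitz _ _ _ _ _) _ => //; try lra.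
  by rewrite ler_wpM2l// mulr_ge0.
suff he : `|at_state F (elapse e (end_state (S0 w) (B 0%N w) (A 0%N w))) -
    at_state F (end_state (S0 w) (B 0%N w) (A 0%N w))| <= 2 * M * h.
  move: he hl hd.
  rewrite (_ : at_state F (S0 w) = F (ev (S0 w)) (orb (S0 w)) (res (S0 w)))//.
  set y1 := at_state _ _; set y2 := at_state _ _; set y3 := F _ _ 0; set y4 := F _ _ _.
  set u := h * _.
  rewrite !ler_norml => /andP[? ?] /andP[? ?] /andP[? ?]; apply/andP; split; lra.
rewrite /end_state /elapse /empty_idle.
have L k j x : h < x -> `|F k j (x - e) - F k j x| <= 2 * M * h.
  move=> hx; apply: le_trans (lipschitz _ _ _ _ _) _ => //; try lra.
  by rewrite ler_wpM2l// mulr_ge0.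
case: (ev (S0 w)) => /=; case: (orb (S0 w)) => [|j] /=; rewrite /at_state /=;
  try exact: L; by rewrite subrr normr0 !mulr_ge0.
Qed.

Let c_arr k : R := 1 - expR (- (arrival_rate r k * h)).

Lemma pdf_centered (f psi : R -> R) (y : R) : is_pdf f ->
  measurable_fun setT psi -> (forall t, 0 <= t -> `|psi t| <= M) ->
  \int[@lebesgue_measure R]_(t in `[0, +oo[) ((psi t - y) * f t) =
  \int[@lebesgue_measure R]_(t in `[0, +oo[) (psi t * f t) - y.
Proof.
move=> fp mpsi psiM.
transitivity (\int[@lebesgue_measure R]_(t in `[0, +oo[) (psi t * f t - y * f t)).
  by apply: eq_Rintegral => t _; rewrite mulrBl.
rewrite RintegralB//.
- by rewrite RintegralZl ?(pdf_Rintegral fp) ?mulr1//; exact: (pdf_integrable fp).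
- exact: (pdfM_integrable fp (M := M)).
- apply: (pdfM_integrable fp (M := `|y|)) => //; exact: measurable_cst.
Qed.

Lemma after_arrival_bound k j x : `|after_arrival k j x| <= M.
Proof. by case: k => //=; apply: pdf_bound => // t _; exact: FM. Qed.

Lemma bfun_F : bfun F. Proof. by split => //; exists M. Qed.

Lemma bfun_drift : bfun drift.
Proof.
split=> [k j|]; first by rewrite /drift; case: (empty_idle _) => //; exact: measurable_cst.
exists M => k j x; rewrite /drift; case: (empty_idle _) => //.
by rewrite normr0 M_ge0.
Qed.

Lemma bfun_after : bfun after_arrival.
Proof.
split; last by exists M; exact: after_arrival_bound.
by move=> [] j; [exact: measurable_cst|exact: mF..].
Qed.

Lemma bfun_F_arr : bfun F_arr.
Proof.
split=> [k j|].
  case: k => /=; do ?apply: measurable_funB => //.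
  exact: measurableT_comp.
exists (2 * M) => k j x; have M0 := M_ge0.
have b2 k' j' x' : `|F k' j' x' - F k j x| <= 2 * M.
  apply: le_trans (ler_normB _ _) _; have := FM k j x; have := FM k' j' x'; lra.
case: k b2 => /= b2; try exact: b2.
by rewrite normrN; have := FM E1 j x; lra.
Qed.

Lemma bfun_psi_seek : bfun psi_seek.
Proof.
split=> [k j|]; first by apply: measurable_funB => //; exact: measurable_cst.
exists (2 * M) => k j x; apply: le_trans (ler_normB _ _) _.
have := FM E3 j.-1 x; have := FM E1 j 0; lra.
Qed.

Lemma bfun_psi_serv : bfun psi_serv.
Proof.
split=> [k j|]; first by apply: measurable_funB => //; exact: measurable_cst.
exists (2 * M) => k j x; apply: le_trans (ler_normB _ _) _.
have := FM E1 j x; have := FM k j 0; lra.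
Qed.

Lemma U_arr_measurable k j : measurable (U_arr k j).
Proof. by case: k; rewrite /U_arr; [exact: measurableT|exact: measurable0..]. Qed.

Lemma U_seek_measurable k j : measurable (U_seek k j).
Proof.
by case: k; case: j => [|j]; rewrite /U_seek;
  (exact: measurable0 || exact: measurable_itv).
Qed.

Lemma U_serv_measurable k j : measurable (U_serv k j).
Proof.
by case: k; case: j => [|j]; rewrite /U_serv;
  (exact: measurable0 || exact: measurable_itv).
Qed.

Lemma E_arr_measurable k : measurable (E_arr k).
Proof. exact: RV_measurable. Qed.

Lemma bmeas_U (U : event -> nat -> set R) : (forall k j, measurable (U k j)) ->
  bmeas (fun w => \1_(U (ev (S0 w)) (orb (S0 w))) (res (S0 w)) : R).
Proof.
move=> mU; apply: (@bmeas_at_state _ _ _ S0 (fun k j x => \1_(U k j) x)) => //; split.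
  by move=> k j; exact: measurable_indic.
by exists 1 => k j x; rewrite indicE ger0_norm// lern1 leq_b1.
Qed.

Lemma bmeas_psi psi (Y : {RV P >-> R}) : bfun psi ->
  bmeas (fun w => psi (ev (S0 w)) (orb (S0 w)) (Y w)).
Proof.
move=> [mpsi [N psiN]]; split; last by exists N.
apply: (@measurable_label_fun _ _ _ _ _ S0 (fun k j w => psi k j (Y w))) => // k j.
by apply: measurableT_comp.
Qed.

Lemma bmeas_main_term : bmeas main_term.
Proof.
rewrite /main_term /main_of.
have bE : bmeas (fun w => \1_(E_arr (ev (S0 w))) w : R).
  by apply: bmeas_label => //; exact: E_arr_measurable.
apply: bmeasB; last by apply: bmeasZ; apply: bmeas_at_state => //; exact: bfun_drift.
apply: bmeasD; first apply: bmeasD; first apply: bmeasD.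
- apply: bmeasM => //; apply: bmeasM; first by apply: bmeas_U; exact: U_arr_measurable.
  by apply: (@bmeas_psi psi_arr (B 0%N)); split => //; [move=> *; exact: mF|exists M => k j x; exact: FM].
- by apply: bmeasM => //; apply: bmeas_at_state => //; exact: bfun_F_arr.
- apply: bmeasM; first by apply: bmeas_U; exact: U_seek_measurable.
  by apply: (@bmeas_psi psi_seek (B 0%N)); exact: bfun_psi_seek.
- apply: bmeasM; first by apply: bmeas_U; exact: U_serv_measurable.
  by apply: (@bmeas_psi psi_serv (A 0%N)); exact: bfun_psi_serv.
Qed.

(** Independence replaces [B 0] and [A 0] by integrals against their densities: the centred ending
    terms vanish, and the arrival terms get as factor the probability [c_arr] of an arrival before
    [h]. *)
Lemma Ex_main_term : 0 < h -> Ex P main_term =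
  Ex P (fun w => c_arr (ev (S0 w)) *
     (at_state after_arrival (S0 w) - at_state F (S0 w))) -
  h * Ex P (fun w => at_state drift (S0 w)).
Proof.
move=> h0.
have bE : bmeas (fun w => \1_(E_arr (ev (S0 w))) w : R).
  by apply: bmeas_label => //; exact: E_arr_measurable.
have bpa : bfun psi_arr.
  by split => //; [move=> *; exact: mF|exists M => k j x; exact: FM].
have bc : bmeas (fun w => c_arr (ev (S0 w))).
  by apply: (@bmeas_at_state _ _ _ S0 (fun k _ _ => c_arr k)) => //; exact: bfun_event.
have b1 : bmeas (fun w => \1_(U_arr (ev (S0 w)) (orb (S0 w))) (res (S0 w)) *
    psi_arr (ev (S0 w)) (orb (S0 w)) (B 0%N w)).
  apply: bmeasM; first by apply: bmeas_U; exact: U_arr_measurable.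
  exact: (@bmeas_psi psi_arr (B 0%N)).
have b2 : bmeas (fun w => at_state F_arr (S0 w)).
  by apply: bmeas_at_state => //; exact: bfun_F_arr.
have b3 : bmeas (fun w => \1_(U_seek (ev (S0 w)) (orb (S0 w))) (res (S0 w)) *
    psi_seek (ev (S0 w)) (orb (S0 w)) (B 0%N w)).
  apply: bmeasM; first by apply: bmeas_U; exact: U_seek_measurable.
  by apply: (@bmeas_psi psi_seek (B 0%N)); exact: bfun_psi_seek.
have b4 : bmeas (fun w => \1_(U_serv (ev (S0 w)) (orb (S0 w))) (res (S0 w)) *
    psi_serv (ev (S0 w)) (orb (S0 w)) (A 0%N w)).
  apply: bmeasM; first by apply: bmeas_U; exact: U_serv_measurable.
  by apply: (@bmeas_psi psi_serv (A 0%N)); exact: bfun_psi_serv.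
have bd : bmeas (fun w => at_state drift (S0 w)).
  by apply: bmeas_at_state => //; exact: bfun_drift.
have ba : bmeas (fun w => at_state after_arrival (S0 w)).
  by apply: bmeas_at_state => //; exact: bfun_after.
have bF : bmeas (fun w => at_state F (S0 w)).
  by apply: bmeas_at_state => //; exact: bfun_F.
have c01 k : 0 <= c_arr k <= 1.
  rewrite /c_arr subr_ge0 lerBlDr lerDl expR_ge0 andbT -expR0 ler_expR oppr_le0.
  by rewrite mulr_ge0// ltW.
have PE k : P (E_arr k) = (c_arr k)%:E.
  by rewrite /E_arr std_exp_le// mulr_gt0.
have PT (Y : {RV P >-> R}) : P (Y @^-1` setT) = 1%E by exact: probability_setT.
rewrite /main_term /main_of ExB; last 2 first.
- by apply: bmeasD => //; apply: bmeasD => //; apply: bmeasD; exact: bmeasM.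
- exact: bmeasZ.
rewrite ExZ//; congr (_ - _).
rewrite ExD//; last by apply: bmeasD => //; apply: bmeasD; exact: bmeasM.
rewrite ExD//; last by apply: bmeasD; exact: bmeasM.
rewrite ExD; [|exact: bmeasM|exact: bmeasM].
have -> : Ex P (fun w => \1_(U_seek (ev (S0 w)) (orb (S0 w))) (res (S0 w)) *
    psi_seek (ev (S0 w)) (orb (S0 w)) (B 0%N w)) = 0.
  have := @Ex_indep_density _ _ _ P S0 (fun=> setT) (fun=> 1) U_seek (B 0%N) b psi_seek
    S0_meas (fun=> measurableT) _ U_seek_measurable (mB 0%N) b_pdf bfun_psi_seek _.
  move=> H; transitivity (Ex P (fun w => \1_(setT : set T) w *
      (\1_(U_seek (ev (S0 w)) (orb (S0 w))) (res (S0 w)) *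
       psi_seek (ev (S0 w)) (orb (S0 w)) (B 0%N w)))).
    by congr Ex; apply/funext => w; rewrite indicT mul1r.
  rewrite H.
  - rewrite -[RHS](Ex_cst P 0); congr Ex; apply/funext => w; rewrite mul1r.
    have [->|[j [-> ->]]] : U_seek (ev (S0 w)) (orb (S0 w)) = set0 \/
        exists j, ev (S0 w) = E1 /\ orb (S0 w) = j.+1.
      by case: (ev (S0 w)); case: (orb (S0 w)) => [|j]; try (by left); right; exists j.
      by rewrite indic_set0 mul0r.
    rewrite /psi_seek pdf_centered//.
    by rewrite /= seeking_end subrr mulr0.
  - by move=> k; rewrite ler01 lexx.
  - move=> k j V W mV mW; rewrite setIT mul1e -(B_law 0%N mW).
    have := @indep_first_steps k j V setT W setT setT mV measurableT mW measurableT measurableT.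
    by rewrite !PT !mule1 mul1e !preimage_setT setTI !setIT.
have -> : Ex P (fun w => \1_(U_serv (ev (S0 w)) (orb (S0 w))) (res (S0 w)) *
    psi_serv (ev (S0 w)) (orb (S0 w)) (A 0%N w)) = 0.
  have := @Ex_indep_density _ _ _ P S0 (fun=> setT) (fun=> 1) U_serv (A 0%N) a psi_serv
    S0_meas (fun=> measurableT) _ U_serv_measurable (mA 0%N) a_pdf bfun_psi_serv _.
  move=> H; transitivity (Ex P (fun w => \1_(setT : set T) w *
      (\1_(U_serv (ev (S0 w)) (orb (S0 w))) (res (S0 w)) *
       psi_serv (ev (S0 w)) (orb (S0 w)) (A 0%N w)))).
    by congr Ex; apply/funext => w; rewrite indicT mul1r.
  rewrite H.
  - rewrite -[RHS](Ex_cst P 0); congr Ex; apply/funext => w; rewrite mul1r.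
    have [->|[kE [j ->]]] : U_serv (ev (S0 w)) (orb (S0 w)) = set0 \/
        ev (S0 w) <> E1 /\ exists j, orb (S0 w) = j.+1.
      case: (ev (S0 w)); case: (orb (S0 w)) => [|j]; try (by left); right;
        by split => //; exists j.
      by rewrite indic_set0 mul0r.
    rewrite /psi_serv pdf_centered//.
    by rewrite service_endS// subrr mulr0.
  - by move=> k; rewrite ler01 lexx.
  - move=> k j V W mV mW; rewrite setIT mul1e -(A_law 0%N mW).
    have := @indep_first_steps k j V setT setT W setT mV measurableT measurableT mW measurableT.
    by rewrite !PT !mule1 !mul1e !preimage_setT !setTI !setIT.
rewrite !addr0.
rewrite (@Ex_indep_density _ _ _ P S0 E_arr c_arr U_arr (B 0%N) b psi_arr)//; first last.
- move=> k j V W mV mW; rewrite -(B_law 0%N mW) -PE.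
  have := @indep_first_steps k j V `]-oo, arrival_rate r k * h] W setT setT mV _ mW measurableT measurableT.
  rewrite !PT !mule1 !preimage_setT !setIT setIA => -> //.
  by rewrite muleA [in LHS](muleC (P (S0 @^-1` _))).
- exact: U_arr_measurable.
- exact: E_arr_measurable.
rewrite (@Ex_indep_event _ _ _ P S0 F_arr E_arr c_arr)//; first last.
- move=> k j V mV; rewrite -PE.
  have := @indep_first_steps k j V `]-oo, arrival_rate r k * h] setT setT setT mV _ measurableT measurableT measurableT.
  by rewrite !PT !mule1 !preimage_setT !setIT => -> //; rewrite muleC.
- exact: E_arr_measurable.
- exact: bfun_F_arr.
rewrite -ExD; last 2 first.
- apply: bmeasM => //; apply: bmeasM; first by apply: bmeas_U; exact: U_arr_measurable.
  apply: (@bmeas_at_state _ _ _ S0 (fun k j x => \int[@lebesgue_measure R]_(t in `[0, +oo[) (psi_arr k j t * b t))) => //.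
  split; first by move=> *; exact: measurable_cst.
  exists M => k j x; apply: pdf_bound => //; first exact: mF.
  by move=> t _; exact: FM.
- exact: bmeasM.
congr Ex; apply/funext => w; rewrite -mulrDr; congr (_ * _).
rewrite /at_state /after_arrival /F_arr /U_arr /psi_arr.
by case: (ev (S0 w)); rewrite ?indic_setT ?indic_set0 ?mul1r ?mul0r ?add0r.
Qed.

Lemma bmeas_RV (Y : {RV P >-> R}) (V : set R) : measurable V ->
  bmeas (fun w => \1_V (Y w) : R).
Proof.
move=> mV; under eq_fun do rewrite -(indic_preim Y).
by apply: bmeas_indic; exact: RV_measurable.
Qed.

Lemma bmeas_is0 : bmeas is0.
Proof. by apply: bmeas_at_state => //; exact: bfun_end_soon. Qed.

Lemma bmeas_error_term : bmeas error_term.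
Proof.
have b1 : bmeas ix0 by exact: bmeas_RV.
have b2 : bmeas ix1 by exact: bmeas_RV.
have b3 : bmeas ib by exact: bmeas_RV.
have b4 : bmeas ia by exact: bmeas_RV.
have b5 := bmeas_is0.
apply: bmeasD; last by apply: bmeasM; [exact: bmeasD|apply: bmeasD => //; exact: bmeasD].
apply: bmeasD; last exact: bmeasM.
apply: bmeasD; last exact: bmeasZ.
by apply: bmeasD; [exact: bmeas_cst|exact: bmeasZ].
Qed.

(** Once [p] is O(h) by [end_soon_bound], the first four terms are of order [h ^ 2]. In the last one
    an O(h) multiplies a quantity that tends to 0, at an unknown rate because of the two
    densities. *)
Lemma Ex_error_term p : 0 < h ->
  p = Ex P (fun w => at_state (end_soon h) (S0 w)) ->
  Ex P error_term <= h ^+ 2 + h * (c * h) + h * p + c * h * p +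
    (c * h + p) * (c * h + pr (B 0%N) `]-oo, h] + pr (A 0%N) `]-oo, h]).
Proof.
move=> h0 pE.
have ch0 : 0 < c * h by rewrite mulr_gt0// c_gt0.
have p0 : 0 <= p.
  by rewrite pE; apply: Ex_ge0 => w; rewrite /at_state /end_soon; case: (empty_idle _).
pose I : set R := `]-oo, c * h]%classic.
pose Hh : set R := `]-oo, h]%classic.
have mI : measurable I by exact: measurable_itv.
have mH : measurable Hh by exact: measurable_itv.
have mT : measurable (setT : set R) by [].
have PT (Y : {RV P >-> R}) : pr Y setT = 1.
  by rewrite /pr preimage_setT; have -> : P setT = 1%E by exact: probability_setT.
have G1 X0 Vb Va X1 : measurable X0 -> measurable Vb -> measurable Va -> measurable X1 ->
  Ex P (fun w => \1_(first_steps X0 Vb Va X1) w) =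
  pr (xi 0%N) X0 * pr (B 0%N) Vb * pr (A 0%N) Va * pr (xi 1%N) X1.
  move=> m0 mb ma m1; have := Ex_first_steps (bfun_event (fun=> 1 : R)) m0 mb ma m1.
  rewrite /at_state Ex_cst mulr1 => <-.
  by congr Ex; apply/funext => w; rewrite mulr1.
have Gs X0 Vb Va X1 := @Ex_first_steps (end_soon h) X0 Vb Va X1 (bfun_end_soon h).
have bG X0 Vb Va X1 : measurable X0 -> measurable Vb -> measurable Va -> measurable X1 ->
  bmeas (fun w => \1_(first_steps X0 Vb Va X1) w : R).
  by move=> *; apply: bmeas_indic; exact: first_steps_measurable.
have bs := bmeas_is0.
have bGs X0 Vb Va X1 : measurable X0 -> measurable Vb -> measurable Va -> measurable X1 ->
  bmeas (fun w => \1_(first_steps X0 Vb Va X1) w * is0 w).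
  by move=> *; apply: bmeasM => //; exact: bG.
(* Products of indicators are regrouped into single events of [first_steps], with [setT] for an
   unconstrained variable, so that independence applies to each. *)
have -> : error_term = fun w =>
   h ^+ 2 + h * \1_(first_steps I setT setT setT) w + h * is0 w
   + \1_(first_steps I setT setT setT) w * is0 w
   + (\1_(first_steps I setT setT I) w + \1_(first_steps I Hh setT setT) w
      + \1_(first_steps I setT Hh setT) w)
   + (\1_(first_steps setT setT setT I) w * is0 w +
      \1_(first_steps setT Hh setT setT) w * is0 w +
      \1_(first_steps setT setT Hh setT) w * is0 w).
  apply/funext => w; rewrite /error_term !first_steps_indic !indic_setT.
  by rewrite /ix0 /ix1 /ib /ia /I /Hh; ring.
rewrite ExD; last 2 first.
- apply: bmeasD; last by apply: bmeasD; [apply: bmeasD; exact: bG|exact: bG].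
  apply: bmeasD; last exact: bGs.
  apply: bmeasD; last exact: bmeasZ.
  by apply: bmeasD; [exact: bmeas_cst|apply: bmeasZ; exact: bG].
- by apply: bmeasD; [apply: bmeasD; exact: bGs|exact: bGs].
rewrite ExD; last 2 first.
- apply: bmeasD; last exact: bGs.
  apply: bmeasD; last exact: bmeasZ.
  by apply: bmeasD; [exact: bmeas_cst|apply: bmeasZ; exact: bG].
- by apply: bmeasD; [apply: bmeasD; exact: bG|exact: bG].
rewrite ExD; last 2 first.
- apply: bmeasD; last exact: bmeasZ.
  by apply: bmeasD; [exact: bmeas_cst|apply: bmeasZ; exact: bG].
- exact: bGs.
rewrite ExD; last 2 first.
- by apply: bmeasD; [exact: bmeas_cst|apply: bmeasZ; exact: bG].
- exact: bmeasZ.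
rewrite ExD; last 2 first.
- exact: bmeas_cst.
- by apply: bmeasZ; exact: bG.
rewrite Ex_cst !ExZ//; last exact: bG.
rewrite ExD; last 2 first.
- by apply: bmeasD; exact: bG.
- exact: bG.
rewrite ExD; last 2 first.
- exact: bG.
- exact: bG.
rewrite ExD; last 2 first.
- by apply: bmeasD; exact: bGs.
- exact: bGs.
rewrite ExD; last 2 first.
- exact: bGs.
- exact: bGs.
rewrite /is0 !Gs// !G1// !PT !mulr1 !mul1r -pE; clear pE.
have x0 := pr_xi_le_lin 0 ch0; have x1 := pr_xi_le_lin 1 ch0.
rewrite -/I in x0 x1 *; rewrite -/Hh.
have y0 := pr_ge0 (xi 0%N) I; have y1 := pr_ge0 (xi 1%N) I.
have yb := pr_ge0 (B 0%N) Hh; have ya := pr_ge0 (A 0%N) Hh.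
set q0 := pr (xi 0%N) I in x0 y0 *; set q1 := pr (xi 1%N) I in x1 y1 *.
set qb := pr (B 0%N) Hh in yb *; set qa := pr (A 0%N) Hh in ya *.
have e1 : h * q0 <= h * (c * h) by rewrite ler_wpM2l// ltW.
have e2 : q0 * p <= c * h * p by rewrite ler_wpM2r.
have e3 : q0 * q1 <= c * h * (c * h) by rewrite ler_pM.
have e4 : q0 * qb <= c * h * qb by rewrite ler_wpM2r.
have e5 : q0 * qa <= c * h * qa by rewrite ler_wpM2r.
have e6 : q1 * p <= c * h * p by rewrite ler_wpM2r.
clearbody q0 q1 qa qb; lra.
Qed.

Lemma main_term_le : 0 < h -> h <= 1 ->
  `|Ex P main_term| <= 10 * M * Ex P error_term.
Proof.
move=> h0 h1; have hge := ltW h0.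
have bF : bmeas (fun w => at_state F (S0 w)) by apply: bmeas_at_state => //; exact: bfun_F.
have bFh : bmeas (fun w => at_state F (St h w)).
  by apply: bmeas_at_state; [exact: X_measurable|exact: bfun_F].
have bm := bmeas_main_term; have be := bmeas_error_term.
have bd : bmeas (fun w => at_state F (St h w) - at_state F (S0 w) - main_term w).
  by apply: bmeasB => //; exact: bmeasB.
have eq : Ex P (fun w => at_state F (St h w) - at_state F (S0 w) - main_term w) =
    - Ex P main_term.
  rewrite ExB//; last exact: bmeasB.
  by rewrite ExB// (Ex_stationary hge bfun_F) subrr sub0r.
rewrite -[`|Ex P _|]normrN -eq -ExZ//.
rewrite ler_norml; apply/andP; split.
  rewrite -[leLHS]mulN1r -ExZ; last exact: bmeasZ.
  apply: Ex_good => //; first by do 2 apply: bmeasZ.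
  move=> w gw; have := path_estimate gw hge h1.
  by rewrite ler_norml mulN1r => /andP[].
apply: Ex_good => //; first exact: bmeasZ.
by move=> w gw; have := path_estimate gw hge h1; rewrite ler_norml => /andP[].
Qed.

Lemma bfun_generator : bfun generator.
Proof.
apply: bfunD; first by apply: bfunN; exact: bfun_drift.
apply: bfunM; first exact: bfun_event.
by apply: bfunD; [exact: bfun_after|apply: bfunN; exact: bfun_F].
Qed.

Lemma expR_second_order (y : R) : 0 <= y -> `|1 - expR (- y) - y| <= y ^+ 2.
Proof.
move=> y0; have e1 := expR_ge1Dx (- y).
have e2 : expR (- y) * (1 + y) <= 1.
  apply: (@le_trans _ _ (expR (- y) * expR y)).
    by rewrite ler_wpM2l ?expR_ge0//; exact: expR_ge1Dx.
  by rewrite -expRD addNr expR0.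
have e3 : expR (- y) <= 1 - y + y ^+ 2.
  have y1 : 0 < 1 + y by lra.
  rewrite -(ler_pM2r y1); apply: (le_trans e2).
  have : 0 <= y ^+ 3 by rewrite exprn_ge0.
  by rewrite exprS expr2; lra.
rewrite ler_norml; apply/andP; split; lra.
Qed.

(** By [expR_second_order], replacing the arrival probability [c_arr] by rate times [h] costs at
    most [(c * h) ^ 2]; what is left of the main term is [h] times the generator. *)
Lemma generator_estimate : 0 < h -> h <= 1 ->
  h * `|Ex P (fun w => at_state generator (S0 w))| <=
  10 * M * Ex P error_term + 2 * M * c ^+ 2 * h ^+ 2.
Proof.
move=> h0 h1; have M0 := M_ge0.
have ml := main_term_le h0 h1.
pose G w := at_state after_arrival (S0 w) - at_state F (S0 w).
have bG : bmeas G.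
  apply: bmeasB; apply: bmeas_at_state => //; [exact: bfun_after|exact: bfun_F].
have GM w : `|G w| <= 2 * M.
  apply: le_trans (ler_normB _ _) _.
  have := after_arrival_bound (ev (S0 w)) (orb (S0 w)) (res (S0 w)).
  have := FM (ev (S0 w)) (orb (S0 w)) (res (S0 w)).
  by rewrite /at_state; lra.
have bev (u : event -> R) : bmeas (fun w => u (ev (S0 w))).
  by apply: (@bmeas_at_state _ _ _ S0 (fun k _ _ => u k)) => //; exact: bfun_event.
have bd : bmeas (fun w => at_state drift (S0 w)).
  by apply: bmeas_at_state => //; exact: bfun_drift.
have bca : bmeas (fun w => c_arr (ev (S0 w)) * G w) by apply: bmeasM.
have bra : bmeas (fun w => arrival_rate r (ev (S0 w)) * G w) by apply: bmeasM.
have gE : Ex P (fun w => at_state generator (S0 w)) =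
   Ex P (fun w => arrival_rate r (ev (S0 w)) * G w) - Ex P (fun w => at_state drift (S0 w)).
  by rewrite -ExB//; congr Ex; apply/funext => w; rewrite addrC.
have dE : `|Ex P (fun w => c_arr (ev (S0 w)) * G w) -
    h * Ex P (fun w => arrival_rate r (ev (S0 w)) * G w)| <= 2 * M * c ^+ 2 * h ^+ 2.
  rewrite -ExZ// -ExB//; last exact: bmeasZ.
  rewrite -[leRHS](Ex_cst P); apply: Ex_norm_le.
  - by apply: bmeasB => //; exact: bmeasZ.
  - exact: bmeas_cst.
  - move=> w; rewrite mulrA -mulrBl normrM mulrC -!mulrA mulrA.
    apply: ler_pM => //; rewrite /c_arr [h * _]mulrC.
    apply: le_trans (expR_second_order _) _; first by rewrite mulr_ge0 ?ltW.
    rewrite exprMn mulrA ler_wpM2r ?sqr_ge0// -expr2.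
    by rewrite ler_pXn2r ?nnegrE ?(ltW c_gt0)// ltW.
rewrite gE -(ger0_norm (ltW h0)) -normrM mulrBr.
move: ml; rewrite Ex_main_term// -/G => ml.
set u := h * Ex P (fun w => arrival_rate r (ev (S0 w)) * G w) in dE *.
set v := h * Ex P (fun w => at_state drift (S0 w)) in ml *.
set z := Ex P (fun w => c_arr (ev (S0 w)) * G w) in dE.
have ml' : `|z - v| <= 10 * M * Ex P error_term by exact: ml.
rewrite (ger0_norm (ltW h0)).
move: dE ml'; rewrite !ler_norml => /andP[? ?] /andP[? ?]; apply/andP; split; lra.
Qed.

End Dynkin.

(* The last three conditions say that F is preserved on average when a phase
   ends, which happens at residual time 0. *)
Definition dynkin_domain (F F' : event -> nat -> R -> R) : Prop :=
  [/\ bfun F, bfun F',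
      exists N, forall k j x h, 0 <= h -> h <= x ->
        `|F k j (x - h) - F k j x + h * F' k j x| <= N * h ^+ 2
    & [/\ (forall k, k <> E1 -> F k 0%N 0 = F E1 0%N 0),
          (forall k j, k <> E1 -> F k j.+1 0 =
             \int[@lebesgue_measure R]_(t in `[0, +oo[) (F E1 j.+1 t * a t))
        & (forall j, F E1 j.+1 0 =
             \int[@lebesgue_measure R]_(t in `[0, +oo[) (F E3 j t * b t))]].

Lemma Ex_generator F F' : dynkin_domain F F' ->
  Ex P (fun w => at_state (generator F F') (S0 w)) = 0.
Proof.
move=> [[mF [M1 FM1]] [mF' [M2 FM2]] [N tay] [se0 seS ske]].
pose M := Num.max M1 (Num.max M2 N).
have FM k j x : `|F k j x| <= M by apply: le_trans (FM1 k j x) _; rewrite le_max lexx.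
have F'M k j x : `|F' k j x| <= M.
  by apply: le_trans (FM2 k j x) _; rewrite !le_max lexx orbT.
have taylor k j x h : 0 <= h -> h <= x ->
    `|F k j (x - h) - F k j x + h * F' k j x| <= M * h ^+ 2.
  move=> h0 hx; apply: le_trans (tay k j x h h0 hx) _.
  by rewrite ler_wpM2r ?sqr_ge0// !le_max lexx !orbT.
have M0 : 0 <= M by apply: le_trans (FM E1 0%N 0).
have [C [h1 [h10 C0 HC]]] := end_soon_bound.
have c0 := c_gt0.
set Y := Ex P _; apply/eqP; rewrite -normr_eq0; apply/eqP/le_anti.
rewrite normr_ge0 andbT; apply/ler_addgt0Pr => e e0; rewrite add0r.
(* [D] collects the coefficients of [h * (e / D)] in the two error bounds; the final 1 makes it
   positive. Below, [h] and the two small probabilities are all kept under [e / D]. *)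
pose D := 10 * M * (1 + c + C + c * C + (c + C) * c + (c + C) * 2) + 2 * M * c ^+ 2 + 1.
have D0 : 0 < D.
  by rewrite ltr_pwDr// addr_ge0// !mulr_ge0 ?addr_ge0 ?mulr_ge0 ?sqr_ge0// ?addr_ge0// ltW.
have eD0 : 0 < e / D by rewrite divr_gt0.
have [hb hb0 Hb] := pdf_law_small b_pdf (B_law 0%N) eD0.
have [ha ha0 Ha] := pdf_law_small a_pdf (A_law 0%N) eD0.
pose h := Num.min (Num.min 1 h1) (Num.min (e / D) (Num.min hb ha)).
have h0 : 0 < h by rewrite /h !lt_min ltr01 h10 eD0 hb0 ha0.
have hle1 : h <= 1 by rewrite /h !ge_min lexx.
have hh1 : h <= h1 by rewrite /h !ge_min lexx !orbT.
have heD : h <= e / D by rewrite /h !ge_min lexx !orbT.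
have hhb : h <= hb by rewrite /h !ge_min lexx !orbT.
have hha : h <= ha by rewrite /h !ge_min lexx !orbT.
have := generator_estimate mF mF' FM F'M taylor se0 seS ske h0 hle1.
have := @Ex_error_term h _ h0 erefl.
have pC := HC h; rewrite h0 hh1 in pC; have {}pC := pC isT.
set p := Ex P (fun w => at_state (end_soon h) (S0 w)) in pC *.
have p0 : 0 <= p.
  apply: Ex_ge0 => w; rewrite /at_state /end_soon; case: (empty_idle _) => //.
rewrite -/Y; set err := Ex P _ => He HY.
have qb := Hb _ hhb; have qa := Ha _ hha.
rewrite -/(pr _ _) in qb qa; rewrite -/p in He.
set b0 := pr (B 0%N) _ in qb He; set a0 := pr (A 0%N) _ in qa He.
have b00 : 0 <= b0 by exact: pr_ge0.
have a00 : 0 <= a0 by exact: pr_ge0.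
have err_le : err <= h * ((1 + c + C + c * C + (c + C) * c + (c + C) * 2) * (e / D)).
  have s1 : h ^+ 2 <= h * (e / D) by rewrite expr2 ler_wpM2l// ltW.
  have s2 : h * (c * h) <= h * (c * (e / D)).
    by rewrite ler_wpM2l ?(ltW h0)// ler_wpM2l// ltW.
  have s3 : h * p <= h * (C * (e / D)).
    rewrite ler_wpM2l ?(ltW h0)//; apply: (le_trans pC).
    by rewrite ler_wpM2l.
  have s4 : c * h * p <= c * h * (C * (e / D)).
    rewrite ler_wpM2l ?(mulr_ge0 (ltW c0) (ltW h0))//; apply: (le_trans pC).
    by rewrite ler_wpM2l.
  have s5 : (c * h + p) * (c * h + b0 + a0) <= h * (c + C) * (c * (e / D) + e / D + e / D).
    apply: ler_pM.
    - by rewrite addr_ge0// mulr_ge0 ?ltW.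
    - by rewrite !addr_ge0// mulr_ge0 ?ltW.
    - by lra.
    - by rewrite !lerD// ler_wpM2l// ltW.
  apply: (le_trans He); move: s1 s2 s3 s4 s5.
  move: (e / D) => y; clearbody b0 a0 p h; lra.
have HY2 : h * `|Y| <= h * (D * (e / D)).
  apply: (le_trans HY).
  have k1 : 10 * M * err <= 10 * M *
     (h * ((1 + c + C + c * C + (c + C) * c + (c + C) * 2) * (e / D))).
    by rewrite ler_wpM2l// mulr_ge0.
  have k2 : 2 * M * c ^+ 2 * h ^+ 2 <= 2 * M * c ^+ 2 * (h * (e / D)).
    rewrite ler_wpM2l//; first by rewrite mulr_ge0 ?sqr_ge0 ?mulr_ge0.
    by rewrite expr2 ler_wpM2l// ltW.
  have k3 : 0 <= h * (e / D) by rewrite mulr_ge0 ?ltW.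
  apply: (le_trans (lerD k1 k2)).
  move: k3; move: (e / D) => y k3; rewrite /D; clearbody h; lra.
move: HY2; rewrite ler_pM2l// => /le_trans; apply.
by rewrite mulrCA divff ?mulr1// gt_eqF.
Qed.

End Regime.

(** * Complex test functions *)

Section SmoothCurves.
Context {R : realType}.
Implicit Types (z w c s : C R) (g h : R -> C R) (i : bool).

(** A boolean index lets the real invariance identity be applied to both parts of a complex test
    function by one argument. *)
Definition part i z : R := if i then complex.Re z else complex.Im z.

Lemma partD i z w : part i (z + w) = part i z + part i w.
Proof. by case: i; rewrite /part ?cReD ?cImD. Qed.
Lemma partN i z : part i (- z) = - part i z.
Proof. by case: i; rewrite /part ?cReN ?cImN. Qed.
Lemma partB i z w : part i (z - w) = part i z - part i w.
Proof. by rewrite partD partN. Qed.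
Lemma partZ i x z : part i (RtoC x * z) = x * part i z.
Proof. by case: i; rewrite /part ?Re_RtoCM ?Im_RtoCM. Qed.
Lemma part_sum i (I : Type) (s : seq I) (f : I -> C R) :
  part i (\sum_(j <- s) f j) = \sum_(j <- s) part i (f j).
Proof. by case: i; rewrite /part ?Re_sum ?Im_sum. Qed.
Lemma part_nrm i z : `|part i z| <= nrm z.
Proof. by case: i; [exact: nrm_Re|exact: nrm_Im]. Qed.

Lemma partM i z w : part i (z * w) =
  complex.Re z * part i w + (if i then - complex.Im z else complex.Im z) * part (~~ i) w.
Proof. by case: i; rewrite /part /= ?cReM ?cImM ?mulNr. Qed.

Lemma part_cint i f g :
  part i (cint f g) = \int[@lebesgue_measure R]_(t in `[0, +oo[) (part i (g t) * f t).
Proof. by case: i. Qed.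

Definition cmeasurable g := forall i, measurable_fun setT (fun t => part i (g t)).

Lemma cmeasurableD g h : cmeasurable g -> cmeasurable h ->
  cmeasurable (fun t => g t + h t).
Proof.
move=> mg mh i; under eq_fun do rewrite partD.
exact: measurable_funD.
Qed.

Lemma cmeasurableM c g : cmeasurable g -> cmeasurable (fun t => c * g t).
Proof.
move=> mg i; under eq_fun do rewrite partM.
by apply: measurable_funD; apply: measurable_funM => //; exact: measurable_cst.
Qed.

(** The bounds are on nonnegative times only, as exponentials [cexp (- s * t)] may blow up at
    negative ones. The expansion is backward because residual time decreases. *)
Definition csmooth g g' :=
  [/\ cmeasurable g, cmeasurable g' & exists2 N, 0 <= N & forall t, 0 <= t ->
    [/\ nrm (g t) <= N, nrm (g' t) <= N & forall e : R, 0 <= e -> e <= t ->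
      nrm (g (t - e) - g t + RtoC e * g' t) <= N * e ^+ 2]].

Lemma csmoothD g g' h h' : csmooth g g' -> csmooth h h' ->
  csmooth (fun t => g t + h t) (fun t => g' t + h' t).
Proof.
move=> [mg mg' [N N0 gN]] [mh mh' [M M0 hM]]; split; [exact: cmeasurableD..|].
exists (N + M); first exact: addr_ge0.
move=> t t0; have [g1 g2 g3] := gN t t0; have [h1 h2 h3] := hM t t0; split.
- by apply: le_trans (nrmD _ _) _; exact: lerD.
- by apply: le_trans (nrmD _ _) _; exact: lerD.
- move=> e e0 et; rewrite mulrDl.
  rewrite (_ : _ + _ = (g (t - e) - g t + RtoC e * g' t) +
     (h (t - e) - h t + RtoC e * h' t)); last by ring.
  by apply: le_trans (nrmD _ _) _; rewrite lerD ?g3 ?h3.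
Qed.

Lemma csmoothM c g g' : csmooth g g' ->
  csmooth (fun t => c * g t) (fun t => c * g' t).
Proof.
move=> [mg mg' [N N0 gN]]; split; [exact: cmeasurableM..|].
exists (nrm c * N); first by rewrite mulr_ge0 ?nrm_ge0.
move=> t t0; have [g1 g2 g3] := gN t t0; split.
- by rewrite nrmM ler_wpM2l ?nrm_ge0.
- by rewrite nrmM ler_wpM2l ?nrm_ge0.
- move=> e e0 et.
  rewrite (_ : _ + _ = c * (g (t - e) - g t + RtoC e * g' t)); last by ring.
  by rewrite nrmM -mulrA ler_wpM2l ?nrm_ge0 ?g3.
Qed.

Lemma csmooth_cst c : csmooth (fun=> c) (fun=> 0).
Proof.
split; [by move=> i; exact: measurable_cst..|].
exists (nrm c); first exact: nrm_ge0.
move=> t t0; split; rewrite ?nrm0 ?nrm_ge0// => e e0 et.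
by rewrite subrr mulr0 addr0 nrm0 mulr_ge0 ?nrm_ge0 ?sqr_ge0.
Qed.

Lemma csmooth_cexp s : 0 <= complex.Re s ->
  csmooth (fun t => cexp (- s * RtoC t)) (fun t => - s * cexp (- s * RtoC t)).
Proof.
move=> s0; have [m1 m2] := cderive_measurable (cderive_cexp_neg s).
have mg : cmeasurable (fun t => cexp (- s * RtoC t)) by case.
split => //; first exact: cmeasurableM.
pose N := 1 + nrm s + nrm s ^+ 2.
have ns := nrm_ge0 s; have ns2 : 0 <= nrm s ^+ 2 by rewrite exprn_ge0.
exists N; first by rewrite !addr_ge0.
move=> t t0; have p0 := Re_transform_arg s0 t0.
have c1 := nrm_cexp_le1 p0; split.
- by apply: (le_trans c1); rewrite /N; lra.
- rewrite nrmM nrmN; apply: (@le_trans _ _ (nrm s * 1)); first by rewrite ler_wpM2l.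
  by rewrite /N; lra.
- move=> e e0 et; have q0 : complex.Re (- s * RtoC (t - e)) <= 0.
    by apply: Re_transform_arg => //; rewrite subr_ge0.
  have := cexp_taylor p0 q0.
  rewrite (_ : - s * RtoC (t - e) - - s * RtoC t = s * RtoC e); last by rewrite RtoCB; ring.
  rewrite (_ : _ - _ - _ = cexp (- s * RtoC (t - e)) - cexp (- s * RtoC t)
     + RtoC e * (- s * cexp (- s * RtoC t))); last by ring.
  move=> /le_trans; apply; rewrite nrmM nrm_RtoC (ger0_norm e0) exprMn.
  by rewrite ler_wpM2r ?sqr_ge0// /N; lra.
Qed.

Lemma csmooth_cintegrable f g g' : is_pdf f -> csmooth g g' -> cintegrable f g.
Proof.
move=> fp [mg _ [N _ gN]]; apply: (cintegrable_bounded fp (N := N)).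
- exact: (mg true).
- exact: (mg false).
- by move=> t /gN[].
Qed.
End SmoothCurves.

Section ComplexSequences.
Context {R : realType}.
Implicit Types (u v : nat -> C R) (l m c : C R).

Lemma ccvg_cst c : (fun=> c) n @[n --> \oo] --> c.
Proof. exact: cvg_cst. Qed.

Lemma ccvgD u v l m : u n @[n --> \oo] --> l -> v n @[n --> \oo] --> m ->
  (u n + v n) @[n --> \oo] --> l + m.
Proof.
move=> /cvg_nrmP ul /cvg_nrmP vm; apply/cvg_nrmP => e e0.
have e20 : 0 < e / 2 by rewrite divr_gt0.
have [N1 H1] := ul _ e20; have [N2 H2] := vm _ e20.
exists (maxn N1 N2) => n; rewrite geq_max => /andP[/H1 a1 /H2 a2].
rewrite opprD addrACA; apply: le_trans (nrmD _ _) _; lra.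
Qed.

Lemma ccvgM c u l : u n @[n --> \oo] --> l -> (c * u n) @[n --> \oo] --> c * l.
Proof.
move=> /cvg_nrmP ul; apply/cvg_nrmP => e e0.
have c1 : 0 < nrm c + 1 by rewrite ltr_pwDr ?nrm_ge0.
have [N HN] := ul _ (divr_gt0 e0 c1); exists N => n /HN Hn.
rewrite -mulrBr nrmM; apply: (@le_trans _ _ ((nrm c + 1) * (e / (nrm c + 1)))).
  by apply: ler_pM => //; rewrite ?nrm_ge0// lerDl.
by rewrite mulrC divfK// gt_eqF.
Qed.

Lemma ccvg_shift u l : u n @[n --> \oo] --> l -> u n.+1 @[n --> \oo] --> l.
Proof.
move=> /cvg_nrmP H; apply/cvg_nrmP => e /H[N HN]; exists N => n Nn.
exact/HN/leqW.
Qed.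
End ComplexSequences.

Section ComplexDynkin.
Context {R : realType} {d : measure_display} {T : measurableType d}.
Variable P : probability T R.
Variables (r : rates R) (b a : R -> R) (S0 : T -> state R).
Hypotheses (b_pdf : is_pdf b) (a_pdf : is_pdf a)
  (S0_meas : state_measurable S0) (S0_valid : forall w, valid_state (S0 w))
  (invariant : forall F F', dynkin_domain b a F F' ->
     Ex P (fun w => at_state (generator r b F F') (S0 w)) = 0).

Definition state_prob k j : R := fine (P (label S0 k j)).

Lemma state_prob_ge0 k j : 0 <= state_prob k j.
Proof. exact: fine_ge0. Qed.

Lemma state_probE k j : state_prob k j = Ex P \1_(label S0 k j).
Proof. by rewrite Ex_indic//; exact: label_measurable. Qed.

Lemma state_prob_cvg :
  \sum_(0 <= j < N) \sum_(k <- events) state_prob k j @[N --> \oo] --> (1 : R).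
Proof.
have := Ex_labels (P := P) S0_meas (bmeas_cst (T := T) (1 : R)); rewrite Ex_cst.
apply: cvg_trans; apply: near_eq_cvg; near=> N.
apply: eq_bigr => j _; apply: eq_bigr => k _; rewrite state_probE.
by congr Ex; apply/funext => w; rewrite mulr1.
Unshelve. all: by end_near. Qed.

Lemma state_prob_sum k N : \sum_(0 <= j < N) state_prob k j <= 1.
Proof.
have nd : {homo (fun N => \sum_(0 <= j < N) \sum_(k <- events) state_prob k j) :
    m n / (m <= n)%N >-> m <= n}.
  move=> m n mn; rewrite [leRHS](big_cat_nat (n := m))//= lerDl.
  by do 2 (apply: sumr_ge0 => ? _); exact: state_prob_ge0.
have c : cvgn (fun N => \sum_(0 <= j < N) \sum_(k <- events) state_prob k j).
  by apply/cvg_ex; exists 1; exact: state_prob_cvg.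
have := nondecreasing_cvgn_le nd c N; rewrite (cvg_lim _ state_prob_cvg)//.
apply: le_trans; apply: ler_sum => j _; rewrite /events !big_cons big_nil addr0.
have p l := state_prob_ge0 l j.
move: (p E1) (p E2) (p E3) (p E4) (p E5) (p E6) (p E7).
by case: k; lra.
Qed.

Section CurveTest.
Variables (z y : C R) (gs gs' : event -> R -> C R) (gam : event -> C R).
Hypotheses (z1 : nrm z <= 1) (gs_smooth : forall k, csmooth (gs k) (gs' k))
  (gs_end : forall k, k <> E1 -> gs k 0 = y)
  (gs_seek : cint a (gs E1) = z * y) (gs_retrial : gs E1 0 = cint b (gs E3))
  (gs_gam : forall k x, 0 <= x -> - gs' k x + RtoC (arrival_rate r k) *
     (z * (if k is E1 then cint b (gs E2) else gs (arrival_event k) x) - gs k x)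
     = gam k).

(* With k = E1, a factor z is removed so that the seeking curve needs no
   division by z. *)
Definition expo k j : nat := if k is E1 then j.-1 else j.

Definition test (g : event -> R -> C R) (y0 : C R) k j x : C R :=
  match k, j with E1, 0%N => y0 | _, _ => z ^+ expo k j * g k x end.

(** The value of the generator on the test function. By [gs_gam] it does not depend on the residual
    time, so its mean is a series in the probabilities of event and orbit size alone. An empty idle
    server is left only by an external arrival. *)
Definition test_gen k j : C R :=
  match k, j with
  | E1, 0%N => RtoC (rate_idle r) * (cint b (gs E2) - y)
  | _, _ => z ^+ expo k j * gam k
  end.

(* A curve may be unbounded at negative times, hence the truncation. *)
Definition real_test g y0 i k j x : R := part i (test g y0 k j (Num.max 0 x)).

Lemma testE k j : (k = E1 /\ j = 0%N) \/
  forall g y0 x, test g y0 k j x = z ^+ expo k j * g k x.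
Proof. by case: k; case: j => [|j] /=; [left|right..]. Qed.

Lemma bfun_real_test g y0 i N : (forall k, cmeasurable (g k)) ->
  (forall k t, 0 <= t -> nrm (g k t) <= N) -> bfun (real_test g y0 i).
Proof.
move=> mg gN; split.
- move=> k j; rewrite /real_test.
  have mm : measurable_fun setT (Num.max (0 : R)).
    by apply: (@measurable_maxr _ _ _ _ (fun=> 0) id).
  have [[-> ->]|E] := testE k j; first by apply: (measurable_cst (part i y0)).
  under eq_fun do rewrite E.
  have m1 := cmeasurableM (z ^+ expo k j) (mg k).
  exact: (measurableT_comp (m1 i) mm).
- exists (nrm y0 + N) => k j x; apply: le_trans (part_nrm _ _) _.
  have x0 : 0 <= Num.max 0 x by rewrite le_max lexx.
  have N0 : 0 <= N by apply: le_trans (gN E1 0 _) => //; exact: nrm_ge0.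
  have [[-> ->]|->] := testE k j; first by rewrite lerDl.
  rewrite nrmM nrmX; apply: ler_wpDl; first exact: nrm_ge0.
  apply: (@le_trans _ _ (1 * nrm (g k (Num.max 0 x)))); last by rewrite mul1r gN.
  by rewrite ler_wpM2r ?nrm_ge0// exprn_ile1// nrm_ge0.
Qed.

Lemma uniform_smooth : exists2 N, 0 <= N & forall k t, 0 <= t ->
  [/\ nrm (gs k t) <= N, nrm (gs' k t) <= N & forall e : R, 0 <= e -> e <= t ->
    nrm (gs k (t - e) - gs k t + RtoC e * gs' k t) <= N * e ^+ 2].
Proof.
have /boolp.choice[M HM] : forall k, exists M, 0 <= M /\ forall t, 0 <= t ->
    [/\ nrm (gs k t) <= M, nrm (gs' k t) <= M & forall e : R, 0 <= e -> e <= t ->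
    nrm (gs k (t - e) - gs k t + RtoC e * gs' k t) <= M * e ^+ 2].
  by move=> k; have [_ _ [N N0 HN]] := gs_smooth k; exists N.
pose N := \sum_(k <- events) M k.
have MN k : M k <= N.
  rewrite /N /events !big_cons big_nil addr0; have p l := (HM l).1.
  move: (p E1) (p E2) (p E3) (p E4) (p E5) (p E6) (p E7).
  by case: k; lra.
have N0 : 0 <= N := le_trans (HM E1).1 (MN E1).
exists N => // k t t0; have [h1 h2 h3] := (HM k).2 t t0; split.
- exact: le_trans h1 (MN k).
- exact: le_trans h2 (MN k).
- move=> e e0 et; apply: le_trans (h3 e e0 et) _.
  by rewrite ler_wpM2r ?sqr_ge0.
Qed.

(** The powers of [z] match at each end of phase: a service leaving [j.+1] customers has value
    [z ^+ j.+1 * y], and [gs_seek] supplies the factor missing from the seeking curve; a retrial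
    then removes one customer, in agreement with [gs_retrial]. *)
Lemma dynkin_real_test i : dynkin_domain b a (real_test gs y i) (real_test gs' 0 i).
Proof.
have [N N0 HN] := uniform_smooth.
have [mg mg'] : (forall k, cmeasurable (gs k)) /\ (forall k, cmeasurable (gs' k)).
  by split => k; have [] := gs_smooth k.
have icint k f : is_pdf f -> cintegrable f (gs k).
  by move=> fp; exact: csmooth_cintegrable fp (gs_smooth k).
split.
- by apply: (@bfun_real_test _ _ _ N) => // k t /(HN k)[].
- by apply: (@bfun_real_test _ _ _ N) => // k t /(HN k)[].
- exists N => k j x h h0 hx; rewrite /real_test.
  have x0 := le_trans h0 hx; rewrite !max_r ?subr_ge0//.
  rewrite -partB -partZ -partD; apply: le_trans (part_nrm _ _) _.
  have [[-> ->]|E] := testE k j.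
    by rewrite /= subrr mulr0 addr0 nrm0 mulr_ge0// sqr_ge0.
  rewrite !E (_ : _ + _ = z ^+ expo k j *
    (gs k (x - h) - gs k x + RtoC h * gs' k x)); last by ring.
  have [_ _ /(_ h h0 hx) H] := HN k x x0; apply: le_trans H.
  by rewrite nrmM ler_piMl ?nrm_ge0// nrmX exprn_ile1// nrm_ge0.
- split.
  + move=> k k1; rewrite /real_test maxxx; have := gs_end k1.
    by case: k k1 => //= _ ->; rewrite expr0 mul1r.
  + move=> k j k1; rewrite /real_test maxxx.
    transitivity (part i (cint a (fun t => z ^+ j * gs E1 t))).
      rewrite cintM ?gs_seek; last exact: icint.
      rewrite mulrA -exprSr; congr part; have := gs_end k1.
      by case: k k1 => //= _ ->.
    rewrite part_cint; apply: eq_Rintegral => t.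
    by rewrite inE/= in_itv/= andbT => t0; rewrite max_r.
  + move=> j; rewrite /real_test maxxx /= gs_retrial -cintM ?part_cint; last exact: icint.
    apply: eq_Rintegral => t.
    by rewrite inE/= in_itv/= andbT => t0; rewrite max_r.
Qed.

Lemma generator_real_test i k j x : 0 <= x ->
  generator r b (real_test gs y i) (real_test gs' 0 i) k j x = part i (test_gen k j).
Proof.
move=> x0.
have EV n : \int[@lebesgue_measure R]_(t in `[0, +oo[) (real_test gs y i E2 n t * b t)
    = part i (z ^+ n * cint b (gs E2)).
  rewrite -cintM; last exact: csmooth_cintegrable b_pdf (gs_smooth E2).
  rewrite part_cint; apply: eq_Rintegral => t.
  by rewrite inE/= in_itv/= andbT => t0; rewrite /real_test max_r.
have ED : drift (real_test gs' 0 i) k j x = real_test gs' 0 i k j x.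
  by rewrite /drift; case: (k); case: (j) => //=; case: (i).
rewrite /generator ED {ED}.
have main j' : (k = E1 -> j = j'.+1) -> (k <> E1 -> j = j') ->
    after_arrival b (real_test gs y i) k j x = part i (z ^+ j'.+1 *
     (if k is E1 then cint b (gs E2) else gs (arrival_event k) x)) ->
    - real_test gs' 0 i k j x + arrival_rate r k *
       (after_arrival b (real_test gs y i) k j x - real_test gs y i k j x) =
    part i (z ^+ j' * gam k).
  move=> jE1 jE2 ->; rewrite /real_test max_r//.
  have E w g : test g w k j x = z ^+ j' * g k x.
    clear -jE1 jE2; case: k jE1 jE2 => [/(_ erefl)->|_ ->|_ ->|_ ->|_ ->|_ ->|_ ->] //.
  rewrite !E -partB -partZ -partN -partD; congr part.
  by rewrite -(gs_gam k x0) exprS; ring.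
move: main; case: k => main.
- case: j main => [_|j main].
    rewrite /= EV expr0 mul1r /real_test /= partZ partB.
    by rewrite (_ : part i 0 = 0) ?oppr0 ?add0r//; case: (i).
  by rewrite (main j)// /after_arrival EV.
all: by rewrite (main j)// /after_arrival /real_test max_r.
Qed.

Lemma complex_dynkin :
  RtoC (rate_idle r) * (cint b (gs E2) - y) * RtoC (state_prob E1 0)
  + gam E1 * genfun 0 (fun j => state_prob E1 j.+1) z
  + (gam E2 * genfun 0 (state_prob E2) z + gam E3 * genfun 0 (state_prob E3) z
  + gam E4 * genfun 0 (state_prob E4) z + gam E5 * genfun 0 (state_prob E5) z
  + gam E6 * genfun 0 (state_prob E6) z + gam E7 * genfun 0 (state_prob E7) z) = 0.
Proof.
pose s N : C R := \sum_(0 <= j < N) \sum_(k <- events) RtoC (state_prob k j) * test_gen k j.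
have s_part i : part i (s N) @[N --> \oo] --> (0 : R).
  have b1 : bfun (generator r b (real_test gs y i) (real_test gs' 0 i)).
    have [[mF [M1 FM1]] [mF' [M2 FM2]] _ _] := dynkin_real_test i.
    apply: (@bfun_generator _ r b b_pdf _ _ (Num.max M1 M2)) => //.
    - by move=> k j x; apply: le_trans (FM1 k j x) _; rewrite le_max lexx.
    - by move=> k j x; apply: le_trans (FM2 k j x) _; rewrite le_max lexx orbT.
  have := Ex_labels (P := P) S0_meas (bmeas_at_state S0_meas b1).
  rewrite invariant; last exact: dynkin_real_test.
  apply: cvg_trans; apply: near_eq_cvg; near=> N.
  rewrite /s part_sum; apply: eq_bigr => j _; rewrite part_sum; apply: eq_bigr => k _.
  rewrite partZ state_probE mulrC -ExZ; last first.
    by apply: bmeas_indic; exact: label_measurable.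
  congr Ex; apply/funext => w; rewrite indicE.
  have [/set_mem[ek ej]|_] := boolP (w \in label S0 k j); last by rewrite mulr0 mul0r.
  rewrite mulr1 mul1r /at_state ek ej generator_real_test//.
  by have [] := S0_valid w.
have s0 : s N @[N --> \oo] --> (0 : C R).
  apply/cvg_nrmP => e e0; have e20 : 0 < e / 2 by rewrite divr_gt0.
  have /cvgrPdist_le/(_ _ e20)[N1 _ H1] := s_part true.
  have /cvgrPdist_le/(_ _ e20)[N2 _ H2] := s_part false.
  exists (maxn N1 N2) => n; rewrite geq_max => /andP[n1 n2]; rewrite subr0.
  apply: le_trans (nrm_le _) _.
  have := H1 n n1; have := H2 n n2; rewrite /= !sub0r !normrN /part; lra.
have cE k : \sum_(0 <= j < N) RtoC (state_prob k j) * z ^+ j @[N --> \oo] -->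
    genfun 0 (state_prob k) z.
  by apply: genfun_cvg => //; [exact: state_prob_ge0|exact: state_prob_sum].
have cQ : \sum_(0 <= j < N) RtoC (state_prob E1 j.+1) * z ^+ j @[N --> \oo] -->
    genfun 0 (fun j => state_prob E1 j.+1) z.
  apply: genfun_cvg => //; first by move=> j; exact: state_prob_ge0.
  move=> N; have := state_prob_sum E1 N.+1; rewrite big_nat_recl//=.
  by have := state_prob_ge0 E1 0; lra.
have cS k := ccvg_shift (cE k).
have sS := ccvg_shift s0.
(* Seeking states with [j.+1] customers carry [z ^+ j]: the first [N.+1] terms for [E1] are the
   empty state followed by [N] terms of the shifted series. *)
pose t N : C R := RtoC (rate_idle r) * (cint b (gs E2) - y) * RtoC (state_prob E1 0)
  + gam E1 * (\sum_(0 <= j < N) RtoC (state_prob E1 j.+1) * z ^+ j)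
  + (gam E2 * (\sum_(0 <= j < N.+1) RtoC (state_prob E2 j) * z ^+ j)
  + gam E3 * (\sum_(0 <= j < N.+1) RtoC (state_prob E3 j) * z ^+ j)
  + gam E4 * (\sum_(0 <= j < N.+1) RtoC (state_prob E4 j) * z ^+ j)
  + gam E5 * (\sum_(0 <= j < N.+1) RtoC (state_prob E5 j) * z ^+ j)
  + gam E6 * (\sum_(0 <= j < N.+1) RtoC (state_prob E6 j) * z ^+ j)
  + gam E7 * (\sum_(0 <= j < N.+1) RtoC (state_prob E7 j) * z ^+ j)).
have ek k M : k <> E1 -> \sum_(0 <= j < M) RtoC (state_prob k j) * test_gen k j =
    gam k * \sum_(0 <= j < M) RtoC (state_prob k j) * z ^+ j.
  move=> k1; rewrite big_distrr; apply: eq_bigr => j _ /=.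
  rewrite (_ : test_gen k j = z ^+ j * gam k); first by ring.
  by case: (k) k1.
have st N : s N.+1 = t N.
  have sumE (f : event -> C R) : \sum_(k <- events) f k =
      f E1 + (f E2 + (f E3 + (f E4 + (f E5 + (f E6 + f E7))))).
    by rewrite /events !big_cons big_nil addr0.
  transitivity (\sum_(k <- events) \sum_(0 <= j < N.+1) RtoC (state_prob k j) * test_gen k j).
    exact: exchange_big.
  rewrite sumE (ek E2)// (ek E3)// (ek E4)// (ek E5)// (ek E6)// (ek E7)// /t.
  rewrite big_nat_recl// [test_gen E1 0]/=.
  rewrite (_ : \sum_(0 <= i < N) _ =
      gam E1 * (\sum_(0 <= j < N) RtoC (state_prob E1 j.+1) * z ^+ j)); first by ring.
  by rewrite big_distrr; apply: eq_bigr => j _ /=; ring.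
have ct : t N @[N --> \oo] --> RtoC (rate_idle r) * (cint b (gs E2) - y) * RtoC (state_prob E1 0)
  + gam E1 * genfun 0 (fun j => state_prob E1 j.+1) z
  + (gam E2 * genfun 0 (state_prob E2) z + gam E3 * genfun 0 (state_prob E3) z
  + gam E4 * genfun 0 (state_prob E4) z + gam E5 * genfun 0 (state_prob E5) z
  + gam E6 * genfun 0 (state_prob E6) z + gam E7 * genfun 0 (state_prob E7) z).
  have cg k := ccvgM (c := gam k) (cS k).
  have c0 := ccvgD (@ccvg_cst _ (RtoC (rate_idle r) * (cint b (gs E2) - y) *
    RtoC (state_prob E1 0))) (ccvgM (c := gam E1) cQ).
  exact: (ccvgD c0 (ccvgD (ccvgD (ccvgD (ccvgD (ccvgD
    (cg E2) (cg E3)) (cg E4)) (cg E5)) (cg E6)) (cg E7))).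
apply: (cvg_unique _ ct); first exact: norm_hausdorff.
by apply: cvg_trans sS; apply: near_eq_cvg; apply: nearW => N; rewrite /= st.
Unshelve. all: by end_near. Qed.
End CurveTest.
End ComplexDynkin.

(** * Equations for the generating functions *)

Section TransformBounds.
Context {R : realType}.
Variable f : R -> R.
Hypothesis f_pdf : is_pdf f.
Local Notation leb := (@lebesgue_measure R).

Lemma lst_ge0 x : 0 <= lst f x.
Proof.
apply: Rintegral_ge0 => t /=; rewrite in_itv/= andbT => t0.
by rewrite mulr_ge0 ?expR_ge0// (pdf_ge0 f_pdf).
Qed.

(** In case of equality [(1 - expR (- x * t)) * f t] vanishes almost everywhere. The first factor is
    positive for [t > 0], so [f] vanishes almost everywhere, against its mass 1. *)
Lemma lst_lt1 x : 0 < x -> lst f x < 1.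
Proof.
move=> x0; have [mf f0 f1] := f_pdf.
pose g t := 1 - expR (- x * t).
have mg : measurable_fun setT g.
  apply: measurable_funB; first exact: measurable_cst.
  by apply: measurableT_comp => //; apply: measurable_funM => //; exact: measurable_cst.
have g0 t : 0 <= t -> 0 <= g t.
  by move=> t0; rewrite subr_ge0 -expR0 ler_expR mulNr oppr_le0 mulr_ge0// ltW.
have g1 t : 0 <= t -> `|g t| <= 1.
  by move=> t0; rewrite ger0_norm ?g0// lerBlDr lerDl expR_ge0.
have ig := pdfM_integrable f_pdf mg g1.
have ie : leb.-integrable `[0, +oo[ (EFin \o (fun t => expR (- x * t) * f t)).
  apply: (pdfM_integrable f_pdf (M := 1)).
    by apply: measurableT_comp => //; apply: measurable_funM => //; exact: measurable_cst.
  by move=> t t0; rewrite ger0_norm ?expR_ge0//; have := g0 t t0; rewrite subr_ge0.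
have E : \int[leb]_(t in `[0, +oo[) (g t * f t) = 1 - lst f x.
  rewrite -(pdf_Rintegral f_pdf) /lst -RintegralB//; last exact: (pdf_integrable f_pdf).
  by apply: eq_Rintegral => t _; rewrite /g; ring.
rewrite -subr_gt0 -E lt_neqAle; apply/andP; split; last first.
  by apply: Rintegral_ge0 => t /=; rewrite in_itv/= andbT => t0; rewrite mulr_ge0 ?g0 ?f0.
apply/eqP => /esym E0.
have mgf : measurable_fun (`[0, +oo[ : set R) (fun t => (g t * f t)%:E).
  by apply/measurable_EFinP; apply: measurable_funM => //; exact: measurable_funTS.
have H0 : (\int[leb]_(t in `[0%R, +oo[) `|(g t * f t)%:E| = 0)%E.
  have <- : (\int[leb]_(t in `[0, +oo[) (g t * f t))%:E = 0%E by rewrite E0.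
  rewrite /Rintegral fineK; last exact: integrable_fin_num.
  apply: eq_integral => t; rewrite inE/= in_itv/= andbT => t0.
  by rewrite ger0_norm// mulr_ge0 ?g0 ?f0.
have [N [mN N0 subN]] := (ae_eq_integral_abs leb (measurable_itv _) mgf).1 H0.
have : (\int[leb]_(t in `[0%R, +oo[) (f t)%:E = 0)%E.
  rewrite (@ge0_ae_eq_integral _ _ _ leb _ _ (cst 0%E)) ?integral0//.
  - exact/measurable_EFinP.
  - by move=> t /=; rewrite in_itv/= andbT => t0; rewrite lee_fin f0.
  (* The point 0 joins the null set because [g] vanishes there. *)
  - exists (N `|` [set 0]); split.
    + exact: measurableU.
    + by apply: null_set_setU => //; exact: lebesgue_measure_set1.
    + move=> t /=; have [->|t0] := eqVneq t 0; first by right.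
      move=> /not_implyP[Dt ft]; left; apply: subN => /= /(_ Dt) /eqP.
      rewrite eqe mulf_eq0 => /orP[|/eqP ft0]; last by apply: ft; rewrite ft0.
      rewrite /g subr_eq0 eq_sym -expR0 => /eqP/expR_inj/eqP.
      by rewrite mulf_eq0 oppr_eq0 gt_eqF// (negbTE t0).
by rewrite f1 => /eqP; rewrite onee_eq0.
Qed.

End TransformBounds.

(** * Test curves for one type of service *)

Section ServiceCurves.
Context {R : realType}.
Variables (f : R -> R) (l lp : R).
Hypotheses (f_pdf : is_pdf f) (f_mean : finite_mean f) (l_gt0 : 0 < l) (lp_gt0 : 0 < lp).
Implicit Types (z y : C R) (u v : R -> C R).
Local Notation L := (RtoC l).
Local Notation bl := (RtoC (lst f l)).

(* A test curve for one type of service, as a function of the residual time: v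
   while no arrival has occurred, u afterwards. *)
Definition service_curve z y (dv du : C R) v u := exists v' u',
  [/\ csmooth v v', csmooth u u', v 0 = y, u 0 = y &
   (forall x, 0 <= x -> - v' x + L * (z * u x - v x) = dv) /\
   (forall x, 0 <= x -> - u' x + RtoC lp * (z * u x - u x) = du)].

Let L0 : L != 0. Proof. by rewrite RtoC_eq0 gt_eqF. Qed.
Let first_smooth : csmooth (fun t => cexp (- L * RtoC t)) (fun t => - L * cexp (- L * RtoC t)).
Proof. by apply: csmooth_cexp; exact: ltW. Qed.
Let next_smooth z : nrm z <= 1 -> csmooth (fun t => cexp (- arg_of lp z * RtoC t))
  (fun t => - arg_of lp z * cexp (- arg_of lp z * RtoC t)).
Proof. by move=> z1; apply: csmooth_cexp; exact: Re_arg_of. Qed.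

Lemma curve_zero z : service_curve z 0 0 0 (fun=> 0) (fun=> 0).
Proof.
exists (fun=> 0), (fun=> 0); split=> //; try exact: csmooth_cst.
by split=> x _; rewrite !mulr0 subrr mulr0 addr0 oppr0.
Qed.

(** Both curves are generating functions of the arrivals still to come in a residual service: they
    are 1 at residual time 0, and the equations are homogeneous. *)
Lemma curve_pgf z : nrm z <= 1 -> arg_of lp z != L ->
  service_curve z 1 0 0 (arrivals_given l lp z) (fun t => cexp (- arg_of lp z * RtoC t)).
Proof.
move=> z1 sz; have d0 : L - arg_of lp z != 0 by rewrite subr_eq0 eq_sym.
have s2 := next_smooth z1.
have s1 := csmoothD first_smooth (csmoothM (L * z / (L - arg_of lp z))
  (csmoothD s2 (csmoothM (-1) first_smooth))).
do 2 eexists; split; [exact: s1|exact: s2|..].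
- by rewrite /arrivals_given !mulr0 cexp0; ring.
- by rewrite mulr0 cexp0.
split=> x _; last by rewrite /arg_of; ring.
by rewrite /arrivals_given; field.
Qed.

(** The solution [(1 - expR (- l * x)) / l] is the mean time spent before the first arrival in a
    residual service of length [x]. *)
Lemma curve_first z : exists2 v, service_curve z 0 (-1) 0 v (fun=> 0) &
  cint f v = (1 - bl) / L.
Proof.
have s1 := csmoothM L^-1 (csmoothD (csmooth_cst 1) (csmoothM (-1) first_smooth)).
eexists.
  do 2 eexists; split; [exact: s1|exact: csmooth_cst|..] => //.
  - by rewrite /= mulr0 cexp0; ring.
  - by split=> x _; field.
have ie := csmooth_cintegrable f_pdf first_smooth.
have ie1 := cintegrableM (-1) ie.
have i1 := cintegrable_cst f_pdf 1.
rewrite cintM; last exact: cintegrableD.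
by rewrite cintD// cint_cst// cintM// -clstE -lst_clst//; field.
Qed.

(** [u x] integrates, over a residual service of length [x] after the first arrival, the mean of [z]
    to the number of further arrivals, [cexp (- s * t)] with [s = arg_of lp z]; [v] averages [z * u]
    over the instant of the first arrival. Dividing by [s] and by [L - s] excludes the degenerate
    points. *)
Lemma curve_next z : nrm z <= 1 -> z != 1 -> arg_of lp z != L ->
  exists v u, service_curve z 0 0 (-1) v u /\ cint f v = busy_factor f l lp z.
Proof.
move=> z1 zn1 sz; have d0 : L - arg_of lp z != 0 by rewrite subr_eq0 eq_sym.
have s0 : arg_of lp z != 0 by exact: arg_of_neq0.
have s2 := next_smooth z1.
have su := csmoothM (arg_of lp z)^-1 (csmoothD (csmooth_cst 1) (csmoothM (-1) s2)).
have s1 := csmoothM (L * z / arg_of lp z) (csmoothD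
  (csmoothM L^-1 (csmoothD (csmooth_cst 1) (csmoothM (-1) first_smooth)))
  (csmoothM (L - arg_of lp z)^-1 (csmoothD (csmoothM (-1) s2) first_smooth))).
do 2 eexists; split.
  do 2 eexists; split; [exact: s1|exact: su|..].
  - by rewrite /= !mulr0 cexp0; ring.
  - by rewrite /= !mulr0 cexp0; ring.
  split=> x _; last first.
    set U := (X in _ + RtoC lp * (_ * X - _)) => /=.
    rewrite (_ : RtoC lp * (z * U - U) = - arg_of lp z * U); last by rewrite /arg_of; ring.
    by rewrite /U /=; field.
  by field; rewrite s0 d0 L0.
(* Multiplying by this nonzero factor brings the claim to the left side of [busy_factorE], which
   involves only the transform. *)
apply: (mulIf (x := arg_of lp z - L)); first by rewrite subr_eq0.
rewrite -busy_factorE//.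
have i1 := csmooth_cintegrable f_pdf first_smooth.
have i2 := csmooth_cintegrable f_pdf s2.
have j1 := cintegrableM (-1) i1.
have j2 := cintegrableM (-1) i2.
have i0 := cintegrable_cst f_pdf 1.
have k1 := cintegrableD i0 j1; have k2 := cintegrableD j2 i1.
have k1' := cintegrableM L^-1 k1; have k2' := cintegrableM (L - arg_of lp z)^-1 k2.
rewrite cintM; last exact: cintegrableD.
rewrite cintD// [cint f (fun t => L^-1 * _)]cintM// [cint f (fun t => _^-1 * _)]cintM//.
rewrite !cintD// !cintM// cint_cst// -!clstE -lst_clst// /residual (negbTE zn1).
by field; rewrite s0 d0 L0.
Qed.
End ServiceCurves.

(** * Linear equations between the generating functions *)

Section Balance.
Context {R : realType} {d : measure_display} {T : measurableType d}.
Variable P : probability T R.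
Variables (lm le lep lr lrp : R) (b a : R -> R) (S0 : T -> state R).
Local Notation r := (Rates lm le lep lr lrp).
Hypotheses (lm_gt0 : 0 < lm) (le_gt0 : 0 < le) (lep_gt0 : 0 < lep)
  (lr_gt0 : 0 < lr) (lrp_gt0 : 0 < lrp).
Hypotheses (b_pdf : is_pdf b) (b_mean : finite_mean b) (a_pdf : is_pdf a)
  (S0_meas : state_measurable S0) (S0_valid : forall w, valid_state (S0 w))
  (invariant : forall F F', dynkin_domain b a F F' ->
     Ex P (fun w => at_state (generator r b F F') (S0 w)) = 0).
Implicit Types (z y : C R) (u v : R -> C R).
Local Notation p := (state_prob P S0).
Local Notation al := (RtoC (lst a lm)).
Local Notation p00 := (RtoC (p E1 0)).

Definition marginal k z : C R := genfun 0 (p k) z.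
Definition seeking z : C R := genfun 0 (fun j => p E1 j.+1) z.

Let al1 : 1 - al != 0.
Proof. by rewrite -RtoC1 -RtoCB RtoC_eq0 subr_eq0 gt_eqF// lst_lt1. Qed.

(** One service curve of each type, with a common end value [y], determines the seeking curve; the
    equation is then multiplied by [1 - al] to clear its denominator. Each later identity is an
    instance for a suitable pair of curves. *)
Lemma balance z y de ge dr gr ve ue vr ur : nrm z <= 1 ->
  service_curve le lep z y de ge ve ue -> service_curve lr lrp z y dr gr vr ur ->
  RtoC lm * (1 - al) * (cint b ve - y) * p00 +
  RtoC lm * ((1 - al) * z * cint b ve - z * y + al * cint b vr) * seeking z +
  (1 - al) * (de * marginal E2 z + ge * (marginal E4 z + marginal E5 z) +
              dr * marginal E3 z + gr * (marginal E6 z + marginal E7 z)) = 0.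
Proof.
move=> z1 [ve' [ue' [sve sue ve0 ue0 [gve gue]]]] [vr' [ur' [svr sur vr0 ur0 [gvr gur]]]].
(* A seeking curve with constant generator has the form [A + c * ex]. Its value at 0 must be
   [cint b vr] and its mean [A + c * al] must be [z * y]; these two equations give [A] and [c]. *)
pose A := (z * y - al * cint b vr) / (1 - al).
pose ex t : C R := cexp (- RtoC lm * RtoC t).
pose c := cint b vr - A.
pose gs k : R -> C R := match k with
  | E1 => fun t => A + c * ex t | E2 => ve | E3 => vr | E4 | E5 => ue | E6 | E7 => ur end.
pose gs' k : R -> C R := match k with
  | E1 => fun t => 0 + c * (- RtoC lm * ex t)
  | E2 => ve' | E3 => vr' | E4 | E5 => ue' | E6 | E7 => ur' end.
pose gam k := match k with
  | E1 => RtoC lm * (z * cint b ve - A) | E2 => de | E3 => dr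
  | E4 | E5 => ge | E6 | E7 => gr end.
have sex : csmooth ex (fun t => - RtoC lm * ex t) by apply: csmooth_cexp; exact: ltW.
have iex := csmooth_cintegrable a_pdf sex.
have smooth k : csmooth (gs k) (gs' k).
  by case: k => //=; apply: csmoothD; [exact: csmooth_cst|exact: csmoothM].
have := complex_dynkin b_pdf a_pdf S0_meas S0_valid invariant z1 (y := y)
  (gs := gs) (gs' := gs') (gam := gam) smooth.
rewrite -/(seeking z) -!/(marginal _ z) /gs /gam /= => H.
have gend k : k <> E1 -> gs k 0 = y by case: k.
have giA : cint a (gs E1) = z * y.
  rewrite cintD ?cint_cst ?cintM//; [|exact: cintegrable_cst|exact: cintegrableM].
  by rewrite -clstE -lst_clst// /c /A; field.
have gE1 : gs E1 0 = cint b (gs E3).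
  by rewrite /= /ex mulr0 cexp0 mulr1 /c addrC subrK.
have gg k x : 0 <= x -> - gs' k x + RtoC (arrival_rate r k) *
     (z * (if k is E1 then cint b (gs E2) else gs (arrival_event k) x) - gs k x)
     = gam k.
  move=> x0; case: k => /=; rewrite ?(gve _ x0) ?(gue _ x0) ?(gvr _ x0) ?(gur _ x0)//.
  by rewrite /c; ring.
have {}H := H gend giA gE1 gg.
transitivity ((1 - al) * (0 : C R)); last exact: mulr0.
by rewrite -H /A; field.
Qed.

Local Notation Ae := (pgf b le lep).
Local Notation Ar := (pgf b lr lrp).
Local Notation Be := (busy_factor b le lep).
Local Notation Br := (busy_factor b lr lrp).

Lemma pgf_equation z : nrm z <= 1 -> arg_of lep z != RtoC le -> arg_of lrp z != RtoC lr ->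
  ((1 - al) * z * Ae z - z + al * Ar z) * seeking z = (1 - al) * (1 - Ae z) * p00.
Proof.
move=> z1 se sr; have ce := curve_pgf le_gt0 lep_gt0 z1 se.
have cr := curve_pgf lr_gt0 lrp_gt0 z1 sr.
have := balance z1 ce cr; rewrite !cint_arrivals// => H.
have lm0 : RtoC lm != 0 by rewrite RtoC_eq0 gt_eqF.
apply: (mulfI lm0); apply/eqP; rewrite -subr_eq0; apply/eqP; rewrite -[RHS]H.
move: (Ae z) (Ar z) (seeking z) (marginal E2 z) (marginal E3 z) (marginal E4 z)
  (marginal E5 z) (marginal E6 z) (marginal E7 z) => *; ring.
Qed.

(** Pairing [curve_first] with the zero retrial curve leaves [marginal E2] as the only busy term.
    The three other busy identities come from the analogous pairs. *)
Lemma marginal_E2 z : nrm z <= 1 ->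
  marginal E2 z = RtoC lm * ((1 - RtoC (lst b le)) / RtoC le) * (p00 + z * seeking z).
Proof.
move=> z1; have [v ce Ev] := curve_first lep b_pdf le_gt0 z.
have := balance z1 ce (curve_zero lr lrp z); rewrite Ev cint_cst// => H.
apply: (mulfI al1); apply/eqP; rewrite -subr_eq0; apply/eqP.
by rewrite -[RHS]oppr0 -H; ring.
Qed.

Lemma marginal_E3 z : nrm z <= 1 ->
  marginal E3 z = (1 - RtoC (lst b lr)) / RtoC lr * (RtoC lm * al / (1 - al) * seeking z).
Proof.
move=> z1; have [v cr Ev] := curve_first lrp b_pdf lr_gt0 z.
have := balance z1 (curve_zero le lep z) cr; rewrite Ev cint_cst// => H.
apply: (mulfI al1); apply/eqP; rewrite -subr_eq0; apply/eqP.
have lr0 : RtoC lr != 0 by rewrite RtoC_eq0 gt_eqF.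
by rewrite -[RHS]oppr0 -H; field; rewrite lr0.
Qed.

Let seeking_cont z : nrm z <= 1 -> disc_cont seeking z.
Proof.
apply: genfun_cont; first by move=> j; exact: state_prob_ge0.
move=> N; have := state_prob_sum P S0_meas E1 N.+1; rewrite big_nat_recl//=.
by have := state_prob_ge0 P S0 E1 0; lra.
Qed.

Let marginal_cont k z : nrm z <= 1 -> disc_cont (marginal k) z.
Proof.
by apply: genfun_cont => //; [move=> j; exact: state_prob_ge0|exact: state_prob_sum].
Qed.

(* The points at which a test curve degenerates. *)
Definition exceptional : seq (C R) :=
  [:: 1; 1 - RtoC (le / lep); 1 - RtoC (lr / lrp)].

Lemma regular_point z : z \notin exceptional ->
  [/\ z != 1, arg_of lep z != RtoC le & arg_of lrp z != RtoC lr].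
Proof.
rewrite !inE !negb_or => /and3P[h1 h2 h3].
have H l lp : 0 < lp -> z != 1 - RtoC (l / lp) -> arg_of lp z != RtoC l.
  move=> lp0; apply: contraNN => /eqP e.
  have lp1 : RtoC lp != 0 by rewrite RtoC_eq0 gt_eqF.
  by rewrite RtoCM RtoCV -e /arg_of mulrAC divff// mul1r opprB addrC subrK.
by split => //; exact: H.
Qed.

Lemma marginal_E45 z : nrm z <= 1 ->
  marginal E4 z + marginal E5 z = RtoC lm * Be z * (p00 + z * seeking z).
Proof.
move=> z1; apply: (@disc_cont_eq _ (fun w => marginal E4 w + marginal E5 w)
  (fun w => RtoC lm * Be w * (p00 + w * seeking w)) exceptional) => //.
- by apply: disc_contD; exact: marginal_cont.
- apply: disc_contM.
    by apply: disc_contM; [exact: disc_cont_cst|exact: busy_factor_cont].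
  apply: disc_contD; first exact: disc_cont_cst.
  by apply: disc_contM; [exact: disc_cont_id|exact: seeking_cont].
- move=> w w1 /regular_point[wn1 se sr].
  have [v [u [ce Ev]]] := curve_next b_pdf le_gt0 lep_gt0 w1 wn1 se.
  have := balance w1 ce (curve_zero lr lrp w); rewrite Ev cint_cst// => H.
  apply: (mulfI al1); apply/eqP; rewrite -subr_eq0; apply/eqP.
  by rewrite -[RHS]oppr0 -H; ring.
Qed.

Lemma marginal_E67 z : nrm z <= 1 ->
  marginal E6 z + marginal E7 z = Br z * (RtoC lm * al / (1 - al) * seeking z).
Proof.
move=> z1; apply: (@disc_cont_eq _ (fun w => marginal E6 w + marginal E7 w)
  (fun w => Br w * (RtoC lm * al / (1 - al) * seeking w)) exceptional) => //.
- by apply: disc_contD; exact: marginal_cont.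
- apply: disc_contM; first exact: busy_factor_cont.
  by apply: disc_contM; [exact: disc_cont_cst|exact: seeking_cont].
- move=> w w1 /regular_point[wn1 se sr].
  have [v [u [cr Ev]]] := curve_next b_pdf lr_gt0 lrp_gt0 w1 wn1 sr.
  have := balance w1 (curve_zero le lep w) cr; rewrite Ev cint_cst// => H.
  apply: (mulfI al1); apply/eqP; rewrite -subr_eq0; apply/eqP.
  by rewrite -[RHS]oppr0 -H; field.
Qed.

Lemma marginal_E1 z : nrm z <= 1 -> marginal E1 z = p00 + z * seeking z.
Proof.
move=> z1; have p0 := state_prob_ge0 P S0 E1; have ps := state_prob_sum P S0_meas E1.
rewrite -(genfun_shift p0 ps z1); have c1 := @genfun_cvg _ _ p0 ps 1 _ z1.
have c2 := @genfun_cvg _ _ p0 ps 0 _ z1.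
apply: (cvg_unique _ c2); first exact: norm_hausdorff.
apply: cvg_trans (ccvgD (@ccvg_cst _ p00) c1); apply: near_eq_cvg; near=> N.
rewrite [RHS]big_ltn; last by near: N; exists 1%N.
by rewrite expr0 mulr1.
Unshelve. all: by end_near. Qed.

Lemma total_mass : marginal E1 1 + marginal E2 1 + marginal E3 1 +
  (marginal E4 1 + marginal E5 1) + (marginal E6 1 + marginal E7 1) = 1.
Proof.
have n1 : nrm (1 : C R) <= 1 by rewrite nrm1.
have c k : \sum_(0 <= j < N) RtoC (p k j) @[N --> \oo] --> marginal k 1.
  have := @genfun_cvg _ _ (state_prob_ge0 P S0 k) (state_prob_sum P S0_meas k) 0 _ n1.
  apply: cvg_trans; apply: near_eq_cvg; apply: nearW => N; apply: eq_bigr => j _.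
  by rewrite expr1n mulr1.
have H := ccvgD (ccvgD (ccvgD (ccvgD (c E1) (c E2)) (c E3)) (ccvgD (c E4) (c E5)))
  (ccvgD (c E6) (c E7)).
apply: (cvg_unique _ H); first exact: norm_hausdorff.
apply/cvg_nrmP => e e0; have /cvgrPdist_le/(_ e e0)[N _ HN] := state_prob_cvg P S0_meas.
exists N => n /HN /=; rewrite distrC -nrm_RtoC RtoCB.
congr (nrm (_ - _) <= _).
rewrite -!RtoC_sum -!RtoCD -!big_split; congr RtoC; apply: eq_bigr => j _ /=.
by rewrite /events !big_cons big_nil addr0 !addrA.
Qed.

Local Notation mE := (mean_arrivals b le lep).
Local Notation mR := (mean_arrivals b lr lrp).
Hypothesis stable : 0 < lst a lm * (1 - mR) - (1 - lst a lm) * mE.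

Let mE_ge0 : 0 <= mE. Proof. exact: mean_arrivals_ge0. Qed.

Lemma al_gt0 : 0 < lst a lm.
Proof.
rewrite lt_neqAle lst_ge0// andbT eq_sym; apply/eqP => a0.
by move: stable; rewrite a0; have := mE_ge0; lra.
Qed.

Lemma mR_lt1 : mR < 1.
Proof.
have h1 : 0 <= (1 - lst a lm) * mE by rewrite mulr_ge0// subr_ge0 ltW// lst_lt1.
have : 0 < lst a lm * (1 - mR) by have := stable; lra.
by rewrite pmulr_rgt0 ?al_gt0// subr_gt0.
Qed.

Lemma pgf_equation_disc z : nrm z <= 1 ->
  ((1 - al) * z * Ae z - z + al * Ar z) * seeking z = (1 - al) * (1 - Ae z) * p00.
Proof.
move=> z1; apply: (@disc_cont_eq _
  (fun z => ((1 - al) * z * Ae z - z + al * Ar z) * seeking z)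
  (fun z => (1 - al) * (1 - Ae z) * p00) exceptional) => //.
- apply: disc_contM; last exact: seeking_cont.
  apply: disc_contD; last by apply: disc_contM; [exact: disc_cont_cst|exact: pgf_cont].
  apply: disc_contB; last exact: disc_cont_id.
  apply: disc_contM; last exact: pgf_cont.
  by apply: disc_contM; [exact: disc_cont_cst|exact: disc_cont_id].
- apply: disc_contM; last exact: disc_cont_cst.
  apply: disc_contM; first exact: disc_cont_cst.
  by apply: disc_contB; [exact: disc_cont_cst|exact: pgf_cont].
- by move=> w w1 /regular_point[_ se sr]; exact: pgf_equation.
Qed.

Lemma seeking1 :
  RtoC (lst a lm * (1 - mR) - (1 - lst a lm) * mE) * seeking 1 = (1 - al) * RtoC mE * p00.
Proof.
(* [sE] and [sR] are the slopes of the two generating functions between [z] and 1. They are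
   continuous at 1 with values [mE] and [mR], whereas the equation itself is trivial there. *)
pose sE z := 1 - RtoC (lst b le) + RtoC lep * Be z.
pose sR z := 1 - RtoC (lst b lr) + RtoC lrp * Br z.
have n1 : nrm (1 : C R) <= 1 by rewrite nrm1.
have cE : disc_cont sE 1.
  apply: disc_contD; first exact: disc_cont_cst.
  by apply: disc_contM; [exact: disc_cont_cst|exact: busy_factor_cont].
have cR : disc_cont sR 1.
  apply: disc_contD; first exact: disc_cont_cst.
  by apply: disc_contM; [exact: disc_cont_cst|exact: busy_factor_cont].
have : (al - (1 - al) * 1 * sE 1 - al * sR 1) * seeking 1 = (1 - al) * sE 1 * p00.
  apply: (@disc_cont_eq _ (fun z => (al - (1 - al) * z * sE z - al * sR z) * seeking z)
    (fun z => (1 - al) * sE z * p00) [:: 1]) => //.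
  - apply: disc_contM; last exact: seeking_cont.
    apply: disc_contB; last by apply: disc_contM cR; exact: disc_cont_cst.
    apply: disc_contB; first exact: disc_cont_cst.
    apply: disc_contM cE.
    by apply: disc_contM; [exact: disc_cont_cst|exact: disc_cont_id].
  - apply: disc_contM; last exact: disc_cont_cst.
    by apply: disc_contM cE; exact: disc_cont_cst.
  - move=> w w1; rewrite inE => wn1.
    have w10 : 1 - w != 0 by rewrite subr_eq0 eq_sym.
    have eE : Ae w = 1 - (1 - w) * sE w by rewrite -slope_pgf// opprB addrC subrK.
    have eR : Ar w = 1 - (1 - w) * sR w by rewrite -slope_pgf// opprB addrC subrK.
    apply: (mulfI w10); have := pgf_equation_disc w1; rewrite eE eR => H.
    transitivity ((1 - al) * (1 - (1 - (1 - w) * sE w)) * p00); last by ring.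
    by rewrite -H; ring.
rewrite /sE /sR !slope_pgf1// => H; rewrite -H !(RtoCB, RtoCM, RtoC1); ring.
Qed.

(** At [z = 1] the powers of [z] disappear: the mean time before the first arrival and the mean time
    after it make up the whole service. *)
Lemma mean_busy l lp : 0 < l -> 0 < lp ->
  (1 - RtoC (lst b l)) / RtoC l + busy_factor b l lp 1 = RtoC (mean b).
Proof.
move=> l0 lp0; have lp1 : RtoC lp != 0 by rewrite RtoC_eq0 gt_eqF.
have l1 : RtoC l != 0 by rewrite RtoC_eq0 gt_eqF.
apply: (mulfI lp1); have := slope_pgf1 b lp l0.
rewrite /mean_arrivals !(RtoCB, RtoCD, RtoCM, RtoCV, RtoC1) => H.
apply/eqP; rewrite -subr_eq0; apply/eqP.
transitivity ((1 - RtoC (lst b l) + RtoC lp * busy_factor b l lp 1) -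
  ((1 - RtoC (lst b l)) * (1 - RtoC lp * (RtoC l)^-1) + RtoC lp * RtoC (mean b))).
  by field.
by rewrite H subrr.
Qed.

Lemma idle_prob : p E1 0 * (lst a lm * ((1 - mR) * (1 + lm * mean b) + lm * mean b * mE)) =
  lst a lm * (1 - mR) - (1 - lst a lm) * mE.
Proof.
have n1 : nrm (1 : C R) <= 1 by rewrite nrm1.
have := total_mass; rewrite marginal_E1// marginal_E2// marginal_E3// marginal_E45// marginal_E67//.
have := seeking1; set Q := seeking 1; set D := lst a lm * _ - _ => EQ mass.
have D0 : RtoC D != 0 by rewrite RtoC_eq0 gt_eqF// stable.
(* External services begin at rate [lm * (p00 + Q)] and retrial ones at rate
   [lm * al / (1 - al) * Q]; each keeps the server busy for [mean b] on average. The mass is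
   multiplied by [1 - al]. *)
have {}mass : (p00 + Q) * (1 + RtoC lm * RtoC (mean b)) * (1 - al) +
    RtoC (mean b) * RtoC lm * al * Q = 1 - al.
  rewrite -[RHS]mulr1 -[X in _ = _ * X]mass.
  rewrite [in RHS](_ : Be 1 = RtoC (mean b) - (1 - RtoC (lst b le)) / RtoC le); last first.
    by rewrite -(mean_busy le_gt0 lep_gt0) addrC addKr.
  rewrite [in RHS](_ : Br 1 = RtoC (mean b) - (1 - RtoC (lst b lr)) / RtoC lr); last first.
    by rewrite -(mean_busy lr_gt0 lrp_gt0) addrC addKr.
  have le0 : RtoC le != 0 by rewrite RtoC_eq0 gt_eqF.
  have lr0 : RtoC lr != 0 by rewrite RtoC_eq0 gt_eqF.
  by field; apply/and3P; split.
apply: RtoC_inj; apply: (mulIf al1).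
(* After multiplication by [D], [seeking1] expresses [D * Q] through [p00], which eliminates [Q]. *)
have : RtoC D * ((p00 + Q) * (1 + RtoC lm * RtoC (mean b)) * (1 - al) +
    RtoC (mean b) * RtoC lm * al * Q) = RtoC D * (1 - al) by rewrite mass.
rewrite (_ : _ * _ = (RtoC D * p00 + RtoC D * Q) * (1 + RtoC lm * RtoC (mean b)) * (1 - al) +
    RtoC (mean b) * RtoC lm * al * (RtoC D * Q)); last by ring.
rewrite EQ => <-; rewrite /D !(RtoCB, RtoCD, RtoCM, RtoC1).
by move: (RtoC mE) (RtoC mR) p00 al (RtoC (mean b)) => *; ring.
Qed.

End Balance.

(** * Zeros of the denominators and identification of the ratios *)

Section LimRatios.
Context {R : realType} {d : measure_display} {T : measurableType d}.
Variable P : probability T R.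
Variables (lm le lep lr lrp : R) (b a : R -> R) (S0 : T -> state R).
Local Notation r := (Rates lm le lep lr lrp).
Hypotheses (lm_gt0 : 0 < lm) (le_gt0 : 0 < le) (lep_gt0 : 0 < lep)
  (lr_gt0 : 0 < lr) (lrp_gt0 : 0 < lrp).
Hypotheses (b_pdf : is_pdf b) (b_mean : finite_mean b) (a_pdf : is_pdf a)
  (S0_meas : state_measurable S0) (S0_valid : forall w, valid_state (S0 w))
  (invariant : forall F F', dynkin_domain b a F F' ->
     Ex P (fun w => at_state (generator r b F F') (S0 w)) = 0).
Implicit Types (z w : C R).
Local Notation p := (state_prob P S0).
Local Notation al := (RtoC (lst a lm)).
Local Notation p00 := (RtoC (p E1 0)).
Local Notation Ae := (arrivals_pgf b le lep).
Local Notation Ar := (arrivals_pgf b lr lrp).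
Local Notation mE := (mean_arrivals b le lep).
Local Notation mR := (mean_arrivals b lr lrp).
Hypothesis stable : 0 < lst a lm * (1 - mR) - (1 - lst a lm) * mE.

Let AeE z : nrm z <= 1 -> Ae z = pgf b le lep z.
Proof. exact: arrivals_pgfE. Qed.
Let ArE z : nrm z <= 1 -> Ar z = pgf b lr lrp z.
Proof. exact: arrivals_pgfE. Qed.
Let al_neq1 : 1 - al != 0.
Proof. by rewrite -RtoC1 -RtoCB RtoC_eq0 subr_eq0 gt_eqF// lst_lt1. Qed.
Let p0 k j : 0 <= p k j. Proof. exact: state_prob_ge0. Qed.
Let ps k N : \sum_(0 <= j < N) p k j <= 1. Proof. exact: state_prob_sum. Qed.
Let nrm1' : nrm (1 : C R) <= 1. Proof. by rewrite nrm1. Qed.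
Let al0 : 0 < lst a lm.
Proof. by apply: al_gt0 stable. Qed.
Let mR1 : mR < 1.
Proof. by apply: mR_lt1 stable. Qed.

Lemma denominator_zero w : nrm w <= 1 ->
  al * (w * Ae w - Ar w) + w * (1 - Ae w) = 0 -> w = 1.
Proof.
move=> w1; rewrite AeE// ArE// => D0; have a1 := lst_lt1 a_pdf lm_gt0.
have lE := pgf_lipschitz b_pdf b_mean le_gt0 lep_gt0 w1 nrm1'.
have lR := pgf_lipschitz b_pdf b_mean lr_gt0 lrp_gt0 w1 nrm1'.
rewrite !pgf1// in lE lR.
(* The fixed point equation minus its instance at 1, where both generating functions are 1. The
   factor [w] in front of the external one adds 1 to its constant; with al for [lst a lm], [stable]
   says exactly that [(1 - al) * (1 + mE) + al * mR] is less than 1. *)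
have E : w - 1 = (1 - al) * (w * (pgf b le lep w - 1) + (w - 1)) +
    al * (pgf b lr lrp w - 1).
  apply/eqP; rewrite -subr_eq0; apply/eqP.
  rewrite -[RHS]D0.
  by move: (pgf b le lep w) (pgf b lr lrp w) => *; ring.
have a1' : 0 <= 1 - lst a lm by rewrite subr_ge0 ltW.
have H : nrm (w - 1) <= ((1 - lst a lm) * (1 + mE) + lst a lm * mR) * nrm (w - 1).
  rewrite {1}E; apply: le_trans (nrmD _ _) _; rewrite [leRHS]mulrDl; apply: lerD.
    rewrite nrmM -RtoC1 -RtoCB nrm_RtoC ger0_norm// -mulrA ler_wpM2l//.
    apply: le_trans (nrmD _ _) _; rewrite RtoC1 [leRHS]mulrDl mul1r addrC lerD2l nrmM.
    apply: le_trans lE; rewrite ler_piMl ?nrm_ge0//.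
  by rewrite nrmM nrm_RtoC ger0_norm ?(ltW al0)// -mulrA ler_wpM2l// ltW.
apply/eqP; rewrite -subr_eq0; apply/eqP/nrm_eq0; have := nrm_ge0 (w - 1).
rewrite le_eqVlt => /orP[/eqP//|n0]; exfalso.
have := mulr_gt0 stable n0; move: H.
by move: mE mR (lst a lm) (nrm _) => *; lra.
Qed.

(** [al * Ar] contracts the disc with constant [lst a lm * mR < 1], so it has at most one fixed
    point. Unlike the zero of the other denominator its location stays unknown, but uniqueness is
    what [lim_ratioE] asks for. *)
Lemma seeking_denominator_zero w z : nrm w <= 1 -> nrm z <= 1 ->
  z - al * Ar z = 0 -> w - al * Ar w = 0 -> w = z.
Proof.
move=> w1 z1; rewrite !ArE// => Dz Dw; have a1 := lst_lt1 a_pdf lm_gt0.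
have lR := pgf_lipschitz b_pdf b_mean lr_gt0 lrp_gt0 w1 z1.
have E : w - z = al * (pgf b lr lrp w - pgf b lr lrp z).
  by apply/eqP; rewrite -subr_eq0 -(subrr (0 : C R)) -{1}Dw -Dz; apply/eqP; ring.
have H : nrm (w - z) <= lst a lm * (mR * nrm (w - z)).
  by rewrite {1}E nrmM nrm_RtoC ger0_norm ?(ltW al0)// ler_wpM2l// ltW.
apply/eqP; rewrite -subr_eq0; apply/eqP/nrm_eq0; have := nrm_ge0 (w - z).
rewrite le_eqVlt => /orP[/eqP//|n0]; exfalso.
have m1 : 0 <= (1 - lst a lm) * mE.
  by rewrite mulr_ge0 ?subr_ge0 ?(ltW a1)//; exact: mean_arrivals_ge0.
have : 0 < (1 - lst a lm * mR) * nrm (w - z).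
  by rewrite mulr_gt0//; have := stable; lra.
lra.
Qed.

Let Q := seeking P S0.

Let Q_cont z : nrm z <= 1 -> disc_cont Q z.
Proof.
apply: genfun_cont; first by move=> j; exact: p0.
by move=> N; have := ps E1 N.+1; rewrite big_nat_recl//=; have := p0 E1 0; lra.
Qed.

Lemma seeking_genfun z : nrm z <= 1 -> genfun 1 (p E1) z = z * Q z.
Proof. exact: genfun_shift. Qed.

Lemma seeking_ratio z : nrm z <= 1 -> z * Q z =
  lim_ratio (fun w => p00 * w * (1 - al) * (Ae w - 1))
    (fun w => al * (w * Ae w - Ar w) + w * (1 - Ae w)) z.
Proof.
move=> z1; symmetry; apply: (lim_ratioE (g := fun w => w * Q w)) => //.
- by apply: disc_contM; [exact: disc_cont_id|exact: Q_cont].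
- move=> w w1 _; rewrite AeE// ArE//.
  have := pgf_equation_disc lm_gt0 le_gt0 lep_gt0 lr_gt0 lrp_gt0 b_pdf b_mean
    a_pdf S0_meas S0_valid invariant w1; rewrite -/Q => H.
  transitivity (- w * ((1 - al) * (1 - pgf b le lep w) * p00)); first by ring.
  by rewrite -H; move: (pgf b le lep w) (pgf b lr lrp w) (Q w) => *; ring.
- by move=> w w1 /denominator_zero -> // /denominator_zero ->.
Qed.

(** The equation for the seeking function turns the numerator of [K] into its denominator times a
    multiple of [Q]. As [Q] is continuous on the disc, [K] is determined even at an unknown zero of
    the denominator. *)
Lemma retrial_ratio z : nrm z <= 1 -> RtoC lm * al / (1 - al) * Q z =
  lim_ratio (fun w => RtoC lm * al * (p00 * (Ae w - 1) + Ae w * genfun 1 (p E1) w))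
    (fun w => w - al * Ar w) z.
Proof.
move=> z1; symmetry; apply: (lim_ratioE (g := fun w => RtoC lm * al / (1 - al) * Q w)) => //.
- by apply: disc_contM; [exact: disc_cont_cst|exact: Q_cont].
- move=> w w1 _; rewrite seeking_genfun// AeE// ArE//.
  have := pgf_equation_disc lm_gt0 le_gt0 lep_gt0 lr_gt0 lrp_gt0 b_pdf b_mean
    a_pdf S0_meas S0_valid invariant w1; rewrite -/Q => H.
  apply: (mulfI al_neq1).
  transitivity (RtoC lm * al * ((1 - al) * pgf b le lep w * (w * Q w) -
    (1 - al) * (1 - pgf b le lep w) * p00)); first by ring.
  by rewrite -H; move: (pgf b le lep w) (pgf b lr lrp w) (Q w) => *; field.
- by move=> w w1 Dz Dw; exact: seeking_denominator_zero.
Qed.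
End LimRatios.

Section OuterRatio.
Context {R : realType}.
Variables (f : R -> R) (l lp : R).
Hypotheses (f_pdf : is_pdf f) (f_mean : finite_mean f) (l_gt0 : 0 < l) (lp_gt0 : 0 < lp).

Lemma busy_ratio (c z : C R) : nrm z <= 1 -> c * busy_factor f l lp z =
  lim_ratio (fun w => c * w * (1 - RtoC (lst f l) - lim_ratio
      (fun v => RtoC l * (1 - clst f (RtoC lp * (1 - v)))) (fun v => RtoC lp * (1 - v)) w))
    (fun w => RtoC lp * (1 - w) - RtoC l) z.
Proof.
move=> z1; symmetry; apply: (lim_ratioE (g := fun w => c * busy_factor f l lp w)) => //.
- by apply: disc_contM; [exact: disc_cont_cst|exact: busy_factor_cont].
- by move=> w w1 _; rewrite residualE// -mulrA busy_factorE// mulrA.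
- move=> w w1 /eqP; rewrite subr_eq0 => /eqP ez /eqP; rewrite subr_eq0 => /eqP ew.
  by apply: (arg_of_inj lp_gt0); rewrite /arg_of ew ez.
Qed.
End OuterRatio.

Section JointProb.
Context {R : realType} {d : measure_display} {T : measurableType d}.
Variables (P : probability T R) (S0 : T -> state R).
Hypotheses (S0_meas : state_measurable S0) (S0_valid : forall w, valid_state (S0 w)).

Lemma joint_probE k :
  joint_prob P S0 (if k is E1 then 0 else 1) k = state_prob P S0 k.
Proof.
apply/funext => j; congr (fine (P _)); apply/seteqP; split=> w /= [].
  by move=> _ oj ek.
by move=> ek oj; split=> //; rewrite /busy ek; case: k {ek}.
Qed.

Lemma state_prob_orb_min k j : (j < orb_min k)%N -> state_prob P S0 k j = 0.
Proof.
move=> jk; rewrite /state_prob (_ : label S0 k j = set0) ?measure0//.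
apply/seteqP; split=> // w [ek oj]; have [] := S0_valid w.
by rewrite ek oj leqNgt jk.
Qed.

Lemma genfun_orb_min k z : nrm z <= 1 ->
  genfun (orb_min k) (state_prob P S0 k) z = marginal P S0 k z.
Proof.
move=> z1; apply: genfun_drop => //.
- by move=> j; exact: state_prob_ge0.
- exact: state_prob_sum.
- exact: state_prob_orb_min.
Qed.
End JointProb.

(** [lep + (lrp - lep) * lst a lm] is a convex combination of [lep] and [lrp], hence positive;
    multiplying the difference of the two sides by it gives exactly the conclusion. *)
Lemma stable_slope (R : realType) (f a : R -> R) (lm le lep lr lrp : R) :
  0 < le -> 0 < lep -> 0 < lr -> 0 < lrp -> 0 <= lst a lm -> lst a lm < 1 ->
  mean f < lst a lm * (lrp + (lr - lrp) * lst f lr) /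
             (lr * (lep + (lrp - lep) * lst a lm))
           - (1 - lst a lm) * (le - lep) * (1 - lst f le) /
             (le * (lep + (lrp - lep) * lst a lm)) ->
  0 < lst a lm * (1 - mean_arrivals f lr lrp) - (1 - lst a lm) * mean_arrivals f le lep.
Proof.
move=> le0 lep0 lr0 lrp0; rewrite /mean_arrivals.
move: (lst a lm) (lst f lr) (lst f le) (mean f) => al br be bb al0 al1.
have D0 : 0 < lep + (lrp - lep) * al.
  rewrite (_ : _ + _ = (1 - al) * lep + al * lrp); last by ring.
  by rewrite ltr_pwDl ?mulr_gt0 ?mulr_ge0 ?subr_gt0// ltW.
rewrite -subr_gt0 => H.
have := mulr_gt0 H D0; congr (_ < _).
have D1 : lep + (lrp - lep) * al != 0 by rewrite gt_eqF.
have le1 : le != 0 by rewrite gt_eqF.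
have lr1 : lr != 0 by rewrite gt_eqF.
by field; rewrite le1 lr1 D1.
Qed.

Theorem theorem4p1 (R : realType) (d : measure_display)
    (Omega : measurableType d) (P : probability Omega R)
    (lm le lep lr lrp : R) (b a : R -> R)
    (S0 : Omega -> state R) (xi B A : nat -> {RV P >-> R})
    (lm_gt0 : 0 < lm) (le_gt0 : 0 < le) (lep_gt0 : 0 < lep)
    (lr_gt0 : 0 < lr) (lrp_gt0 : 0 < lrp)
    (b_pdf : is_pdf b) (b_mean : finite_mean b) (a_pdf : is_pdf a)
    (xi_law : forall n, has_std_exponential_law (xi n))
    (B_law : forall n, has_pdf (B n) b)
    (A_law : forall n, has_pdf (A n) a)
    (S0_meas : state_measurable S0)
    (S0_valid : forall w, valid_state (S0 w))
    (indep : mutually_independent S0 xi B A)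
    (stat : stationary (Rates lm le lep lr lrp) S0 xi B A) :
  let bbar := mean b in
  let al := lst a lm in
  let be := lst b le in
  let br := lst b lr in
  forall (stable :
    bbar < al * (lrp + (lr - lrp) * br) / (lr * (lep + (lrp - lep) * al))
           - (1 - al) * (le - lep) * (1 - be) / (le * (lep + (lrp - lep) * al))),
  let p00 := joint_prob P S0 0 E1 0 in
  let P0 := genfun 1 (joint_prob P S0 0 E1) in
  let P12 := genfun 0 (joint_prob P S0 1 E2) in
  let P13 := genfun 0 (joint_prob P S0 1 E3) in
  let P14 := genfun 1 (joint_prob P S0 1 E4) in
  let P15 := genfun 2 (joint_prob P S0 1 E5) in
  let P16 := genfun 1 (joint_prob P S0 1 E6) in
  let P17 := genfun 2 (joint_prob P S0 1 E7) in
  let Ae := arrivals_pgf b le lep in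
  let Ar := arrivals_pgf b lr lrp in
  let K := lim_ratio
    (fun z => RtoC lm * RtoC al * (RtoC p00 * (Ae z - 1) + Ae z * P0 z))
    (fun z => z - RtoC al * Ar z) in
  let te := (le - lep) * (1 - be) + le * lep * bbar in
  let tr := (lr - lrp) * br + lrp * (1 - lr * bbar) in
  (forall z : C R, `|z| <= 1 ->
    [/\ P0 z = lim_ratio
          (fun w => RtoC p00 * w * (1 - RtoC al) * (Ae w - 1))
          (fun w => RtoC al * (w * Ae w - Ar w) + w * (1 - Ae w)) z,
        P12 z = RtoC lm * ((1 - RtoC be) / RtoC le) * (RtoC p00 + P0 z),
        P13 z = (1 - RtoC br) / RtoC lr * K z,
        P14 z + P15 z =
          lim_ratio
            (fun w => RtoC lm * w *
               (1 - RtoC be - lim_ratio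
                  (fun v => RtoC le * (1 - clst b (RtoC lep * (1 - v))))
                  (fun v => RtoC lep * (1 - v)) w))
            (fun w => RtoC lep * (1 - w) - RtoC le) z
          * (RtoC p00 + P0 z)
      & P16 z + P17 z =
          lim_ratio
            (fun w => w *
               (1 - RtoC br - lim_ratio
                  (fun v => RtoC lr * (1 - clst b (RtoC lrp * (1 - v))))
                  (fun v => RtoC lrp * (1 - v)) w))
            (fun w => RtoC lrp * (1 - w) - RtoC lr) z
          * K z]) /\
  p00 = (al * (le * tr + lr * te) - lr * te)
        / (al * ((1 + lm * bbar) * le * tr + lm * bbar * lr * te)).
Proof.
move=> bbar al be br stable p00 P0 P12 P13 P14 P15 P16 P17 Ae Ar K te tr.
have lst0 := lst_ge0 a_pdf lm; have lst1 := lst_lt1 a_pdf lm_gt0.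
have {}stable := stable_slope le_gt0 lep_gt0 lr_gt0 lrp_gt0 lst0 lst1 stable.
set r := Rates lm le lep lr lrp in stat.
have rate_gt0 k : 0 < arrival_rate r k by case: k.
have rate_le k : arrival_rate r k <= lm + le + lep + lr + lrp.
  by case: k; rewrite /r /=; lra.
have inv F F' := Ex_generator rate_gt0 b_pdf a_pdf xi_law B_law A_law S0_meas S0_valid
  indep stat rate_le (F := F) (F' := F').
have e0 : P0 = genfun 1 (state_prob P S0 E1) by rewrite /P0 (joint_probE P S0 E1).
have Z0 z : nrm z <= 1 -> P0 z = z * seeking P S0 z by move=> z1; rewrite e0 seeking_genfun.
have pE : p00 = state_prob P S0 E1 0 by rewrite -(joint_probE P S0 E1).
have Kz z : nrm z <= 1 -> RtoC lm * RtoC al / (1 - RtoC al) * seeking P S0 z = K z.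
  move=> z1; rewrite /K pE e0.
  exact: (retrial_ratio lm_gt0 le_gt0 lep_gt0 lr_gt0 lrp_gt0 b_pdf b_mean a_pdf S0_meas
    S0_valid inv stable z1).
split.
  move=> z; rewrite norm_le1 => z1; rewrite -Kz//.
  have E k : genfun (orb_min k) (joint_prob P S0 (if k is E1 then 0 else 1) k) z =
      marginal P S0 k z by rewrite joint_probE genfun_orb_min.
  split.
  - rewrite Z0// pE.
    exact: (seeking_ratio lm_gt0 le_gt0 lep_gt0 lr_gt0 lrp_gt0 b_pdf b_mean a_pdf S0_meas
      S0_valid inv stable z1).
  - rewrite Z0// pE -(marginal_E2 lm_gt0 le_gt0 b_pdf a_pdf S0_meas S0_valid inv z1).
    exact: (E E2).
  - rewrite -(marginal_E3 lm_gt0 lr_gt0 b_pdf a_pdf S0_meas S0_valid inv z1).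
    exact: (E E3).
  - rewrite Z0// pE -busy_ratio//.
    rewrite -(marginal_E45 lm_gt0 le_gt0 lep_gt0 lrp_gt0 b_pdf b_mean a_pdf S0_meas
      S0_valid inv z1).
    by rewrite -(E E4) -(E E5).
  - have := busy_ratio b_pdf b_mean lr_gt0 lrp_gt0 1 z1; rewrite mul1r.
    under [X in lim_ratio X _ _]eq_fun do rewrite mul1r.
    move=> <-.
    rewrite -(marginal_E67 lm_gt0 lep_gt0 lr_gt0 lrp_gt0 b_pdf b_mean a_pdf S0_meas
      S0_valid inv z1).
    by rewrite -(E E6) -(E E7).
have := idle_prob lm_gt0 le_gt0 lep_gt0 lr_gt0 lrp_gt0 b_pdf b_mean a_pdf S0_meas
  S0_valid inv stable.
have mR1 := mR_lt1 lm_gt0 le_gt0 lep_gt0 b_pdf b_mean a_pdf stable.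
have mE0 := mean_arrivals_ge0 b_pdf b_mean le_gt0 lep_gt0.
have al0 := al_gt0 le_gt0 lep_gt0 b_pdf b_mean a_pdf stable.
have bbar0 := mean_ge0 b_pdf.
(* In terms of the mean numbers of arrivals, the claimed fraction is the one given by [idle_prob]
   with numerator and denominator multiplied by [le * lr]. *)
have trE : tr = lr * (1 - mean_arrivals b lr lrp).
  by rewrite /tr /mean_arrivals /br /bbar; field; rewrite gt_eqF.
have teE : te = le * mean_arrivals b le lep.
  by rewrite /te /mean_arrivals /be /bbar; field; rewrite gt_eqF.
rewrite trE teE -pE -/al -/bbar.
rewrite -/al in al0; rewrite -/bbar in bbar0.
set m := mean_arrivals b le lep in mE0 *; set n := mean_arrivals b lr lrp in mR1 *.
pose X := al * ((1 - n) * (1 + lm * bbar) + lm * bbar * m); rewrite -/X => H.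
have X0 : 0 < X.
  apply: mulr_gt0 => //; apply: ltr_pwDl.
    apply: mulr_gt0; first by rewrite subr_gt0.
    by apply: ltr_pwDl => //; rewrite mulr_ge0// ltW.
  by rewrite !mulr_ge0// ltW.
have -> : al * ((1 + lm * bbar) * le * (lr * (1 - n)) + lm * bbar * lr * (le * m)) =
    le * lr * X by rewrite /X; ring.
have d0 : le * lr * X != 0.
  by rewrite gt_eqF//; apply: mulr_gt0 => //; exact: mulr_gt0.
apply: (mulIf d0); rewrite divfK//.
transitivity (le * lr * (p00 * X)); first by ring.
by rewrite H; ring.
Qed.
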